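(* For every real $t$, \[ Z(t)=2\,\Re\bigl\{e^{i\vartheta(t)}U(t)\bigr\}. \]
   Context: Let $\Omega$ be the complex plane with the two cuts $\{iy: y\ge \tfrac12\}$ and $\{iy: y\le -\tfrac12\}$ removed. $\vartheta$ is the Riemann–Siegel theta function: the holomorphic function on $\Omega$ with $\vartheta(0)=0$ and \[ e^{i\vartheta(t)}=\pi^{-it/2}\sqrt{\frac{\Gamma(\frac14+\frac{it}{2})}{\Gamma(\frac14-\frac{it}{2})}}, \] which for real $t$ equals $\pi^{-it/2}\Gamma(\frac14+\frac{it}2)/|\Gamma(\frac14+\frac{it}2)|$. The function $Z(t)=e^{i\vartheta(t)}\zeta(\frac12+it)$ (real for real $t$), where $\zeta$ is the Riemann zeta function. For real $t$ define \[ U(t)=\frac{1}{2\pi i}\int_{-i\sigma-\infty}^{-i\sigma+\infty} e^{i\vartheta(t+x)-i\vartheta(t)}\,\zeta\bigl(\tfrac12+i(t+x)\bigr)\,\frac{\pi}{2\sinh\frac{\pi x}{2}}\,dx, \] with $0<\sigma<\frac12$ (the integration is along the horizontal line $\Im x=-\sigma$; the value is independent of $\sigma\in(0,\frac12)$). *)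

(* Defs.v *)
From Stdlib Require Import Reals.
From Coquelicot Require Import Coquelicot.
Open Scope R_scope.

Definition cexp (z : C) : C := (exp (Re z) * cos (Im z), exp (Re z) * sin (Im z)).

Definition csinh (z : C) : C := ((cexp z - cexp (- z)) / RtoC 2)%C.

(* Sum of a complex series (real and imaginary parts summed separately;
   equals the sum of the series whenever it converges). *)
Definition CSeries (a : nat -> C) : C :=
  (Series (fun n => Re (a n)), Series (fun n => Im (a n))).

Definition Rcpow (b : R) (z : C) : C := cexp (z * RtoC (ln b))%C.

(* Euler's Gamma integral, valid (and used only) for Re z > 0:
   Gamma(z) = \int_0^oo u^(z-1) e^(-u) du. *)
Definition CGamma (z : C) : C :=
  RInt_gen (V := C_R_CompleteNormedModule)
    (fun u : R => (Rcpow u (z - RtoC 1) * RtoC (exp (- u)))%C)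
    (at_right 0) (Rbar_locally p_infty).

(* Dirichlet eta function eta(s) = sum_{n>=1} (-1)^(n-1) n^(-s), convergent for Re s > 0. *)
Definition eta (s : C) : C :=
  CSeries (fun n : nat => (RtoC ((-1) ^ n) * Rcpow (INR (S n)) (- s))%C).

(* Riemann zeta function for Re s > 0, s <> 1 (away from the zeros of 1 - 2^(1-s)),
   via its standard analytic continuation zeta(s) = eta(s) / (1 - 2^(1-s)).
   It is only used here on the strip 0 < Re s < 1. *)
Definition zeta (s : C) : C := (eta s / (RtoC 1 - Rcpow 2 (RtoC 1 - s)))%C.

(* The horizontal strip |Im z| < 1/2 (a connected subset of Omega containing
   every point where theta is evaluated in the statement). *)
Definition strip (z : C) : Prop := Rabs (Im z) < / 2.

Definition is_RS_theta (th : C -> C) : Prop :=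
  (forall z, strip z -> ex_derive (K := C_AbsRing) (V := C_NormedModule) th z) /\
  th (RtoC 0) = RtoC 0 /\
  (forall z, strip z ->
     (cexp (Ci * th z) * cexp (Ci * th z))%C =
     (Rcpow PI (- (Ci * z)) *
        (CGamma (RtoC (/ 4) + Ci * z / RtoC 2) /
         CGamma (RtoC (/ 4) - Ci * z / RtoC 2)))%C).

Definition U (th : C -> C) (sigma t : R) : C :=
  (/ (RtoC (2 * PI) * Ci) *
   RInt_gen (V := C_R_CompleteNormedModule)
     (fun s : R =>
        let x : C := (s, Ropp sigma) in
        (cexp (Ci * th (RtoC t + x) - Ci * th (RtoC t)) *
         zeta (RtoC (/ 2) + Ci * (RtoC t + x)) *
         (RtoC PI / (RtoC 2 * csinh (RtoC PI * x / RtoC 2))))%C)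
     (Rbar_locally m_infty) (Rbar_locally p_infty))%C.

Definition Zfun (th : C -> C) (t : R) : C :=
  (cexp (Ci * th (RtoC t)) * zeta (RtoC (/ 2) + Ci * RtoC t))%C.

(* Main.v *)
Require Import Defs.
From Stdlib Require Import Reals Lra Lia ZArith Classical ClassicalEpsilon.
From Coquelicot Require Import Coquelicot.
Open Scope R_scope.

(** Write W(z) = e^(i theta(z)) zeta(1/2 + i z) on the strip |Im z| < 1/2.  The kernel
    pi / (2 sinh(pi x / 2)) has residue 1 at x = 0, so shifting the contour of U from
    Im x = -sigma to Im x = sigma gives Z(t) = A - B, where A = e^(i theta(t)) U(t) and B
    is the same integral along Im x = sigma.  The functional equation says that W takes
    conjugate values at conjugate points, hence B = - conj A and Z(t) = A + conj A.  It
    also gives W(z)^2 = zeta(s) zeta(1 - s) with s = 1/2 + i z, so that W grows at most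
    linearly and the contour shift is legitimate.

    The functional equation is Riemann's: Jacobi's identity for theta (itself a residue
    computation over a rectangle of width one period) makes
    phi(x) = sum_{n >= 1} e^(-pi n^2 x) - 1 / (2 sqrt x) satisfy
    phi(1/x) = sqrt x phi(x), and in the critical strip the Mellin transform of
    phi(x) - 2 phi(4 x) = sum_{n >= 1} (-1)^(n-1) e^(-pi n^2 x) is
    pi^(-s/2) Gamma(s/2) eta(s). *)

(** The hypotheses determine e^(i theta) only through its square, so the relation between its values
    at conjugate points is first obtained squared; the sign is then settled by continuity along the
    segment from 0, where theta vanishes. Zeta is given as eta(s) / (1 - 2^(1-s)), and this shapes
    the Mellin argument. The series of e^(-pi n^2 x) cannot be integrated term by term in the
    critical strip, but its alternating version can, by the Leibniz bound on the remainder; and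
    passing from phi(x) to phi(x) - 2 phi(4 x) multiplies the transform by exactly 1 - 2^(1-s). In
    Jacobi's identity the dual coefficients e^(-pi k^2 / x) come from raising the line of
    integration by k / x, and the Gaussian integral that appears as a factor is evaluated by the
    identity itself at x = 1. Series of holomorphic functions enter contour integrals only as
    uniform limits of partial sums with explicit remainders. *)

(** * Moduli and the complex exponential *)

Lemma Cmod_minus_sym (z w : C) : Cmod (z - w)%C = Cmod (w - z)%C.
Proof. rewrite <- Cmod_opp. f_equal. ring. Qed.

Lemma Cmod_minus_le (z w : C) : Cmod (z - w)%C <= Cmod z + Cmod w.
Proof. unfold Cminus. rewrite <- (Cmod_opp w). apply Cmod_triangle. Qed.

Lemma Cmod_ge_minus (z w : C) : Cmod z - Cmod w <= Cmod (z + w)%C.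
Proof.
  assert (H := Cmod_triangle (z + w) (- w)). rewrite Cmod_opp in H.
  replace (z + w + - w)%C with z in H by ring. lra.
Qed.

Lemma Cmod_le_abs (z : C) : Cmod z <= Rabs (Re z) + Rabs (Im z).
Proof.
  destruct z as [x y]. simpl.
  replace ((x, y) : C) with (RtoC x + Ci * RtoC y)%C
    by (apply injective_projections; simpl; ring).
  eapply Rle_trans. apply Cmod_triangle.
  rewrite Cmod_mult, Cmod_Ci, !Cmod_R. lra.
Qed.

Lemma im_le_Cmod (z : C) : Rabs (Im z) <= Cmod z.
Proof. eapply Rle_trans; [|apply Rmax_Cmod]. apply Rmax_r. Qed.

(** The common last step of the limit arguments below: uniqueness of limits, the residue theorem and
    the contour shift all bound a difference by an arbitrary eps. *)
Lemma Cmod_small_eq (z w : C) : (forall eps, 0 < eps -> Cmod (z - w)%C <= eps) -> z = w.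
Proof.
  intros H. assert (H0 : Cmod (z - w)%C = 0).
  { apply Rle_antisym; [|apply Cmod_ge_0]. apply le_epsilon. intros e He.
    rewrite Rplus_0_l. now apply H. }
  apply Cmod_eq_0 in H0. replace z with (z - w + w)%C by ring. rewrite H0. ring.
Qed.

Lemma cexp_plus (z w : C) : cexp (z + w)%C = (cexp z * cexp w)%C.
Proof.
  unfold cexp. destruct z as [a b], w as [c d]. simpl.
  rewrite exp_plus, cos_plus, sin_plus. apply injective_projections; simpl; ring.
Qed.

Lemma cexp_0 : cexp (RtoC 0) = RtoC 1.
Proof. unfold cexp. simpl. rewrite exp_0, cos_0, sin_0. apply injective_projections; simpl; ring. Qed.

Lemma Cmod_cexp (z : C) : Cmod (cexp z) = exp (Re z).
Proof.
  unfold cexp, Cmod. simpl.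
  replace (exp (Re z) * cos (Im z) * (exp (Re z) * cos (Im z) * 1) +
    exp (Re z) * sin (Im z) * (exp (Re z) * sin (Im z) * 1))
    with (exp (Re z) * exp (Re z) * ((Rsqr (sin (Im z))) + Rsqr (cos (Im z))))
    by (unfold Rsqr; ring).
  rewrite sin2_cos2, Rmult_1_r. apply sqrt_square. left; apply exp_pos.
Qed.

Lemma cexp_neq_0 (z : C) : cexp z <> RtoC 0.
Proof. apply Cmod_gt_0. rewrite Cmod_cexp. apply exp_pos. Qed.

Lemma cexp_opp (z : C) : cexp (- z)%C = (/ cexp z)%C.
Proof.
  assert (H : (cexp z * cexp (- z) = 1)%C).
  { rewrite <- cexp_plus. replace (z + - z)%C with (RtoC 0) by ring. apply cexp_0. }
  replace (cexp (- z)%C) with (/ cexp z * (cexp z * cexp (- z)))%C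
    by (field; apply cexp_neq_0).
  rewrite H. ring.
Qed.

Lemma cexp_RtoC (x : R) : cexp (RtoC x) = RtoC (exp x).
Proof. unfold cexp. simpl. rewrite cos_0, sin_0. apply injective_projections; simpl; ring. Qed.

Lemma cexp_conj (z : C) : Cconj (cexp z) = cexp (Cconj z).
Proof.
  destruct z as [a b]. unfold cexp, Cconj. simpl. rewrite cos_neg, sin_neg.
  apply injective_projections; simpl; ring.
Qed.

(** * Complex differentiability *)

Definition ccont (f : C -> C) (z : C) : Prop :=
  forall eps, 0 < eps -> exists d, 0 < d /\
    forall w, Cmod (w - z)%C < d -> Cmod (f w - f z)%C < eps.

(** A bound on the linear remainder instead of a limit of quotients: w = z is not a special case,
    and products and composites reduce to adding up error terms. *)
Definition is_cderiv (f : C -> C) (z l : C) : Prop :=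
  forall eps, 0 < eps -> exists d, 0 < d /\
    forall w, Cmod (w - z)%C < d ->
      Cmod (f w - f z - l * (w - z))%C <= eps * Cmod (w - z)%C.

Definition cdiff (f : C -> C) (z : C) : Prop := exists l, is_cderiv f z l.

Lemma is_cderiv_lip (f : C -> C) (z l : C) : is_cderiv f z l ->
  exists d, 0 < d /\ forall w, Cmod (w - z)%C < d ->
    Cmod (f w - f z)%C <= (Cmod l + 1) * Cmod (w - z)%C.
Proof.
  intros H. destruct (H 1 Rlt_0_1) as [d [Hd H1]]. exists d. split; auto.
  intros w Hw. specialize (H1 w Hw).
  replace (f w - f z)%C with ((f w - f z - l * (w - z)) + l * (w - z))%C by ring.
  eapply Rle_trans. apply Cmod_triangle. rewrite Cmod_mult. lra.
Qed.

Lemma cdiff_ccont (f : C -> C) (z : C) : cdiff f z -> ccont f z.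
Proof.
  intros [l H] eps Heps. destruct (is_cderiv_lip f z l H) as [d [Hd H1]].
  assert (Hp : 0 < Cmod l + 1) by (assert (X := Cmod_ge_0 l); lra).
  exists (Rmin d (eps / (Cmod l + 1))). split.
  - apply Rmin_pos; auto. now apply Rdiv_lt_0_compat.
  - intros w Hw. eapply Rle_lt_trans. apply H1. eapply Rlt_le_trans; [apply Hw|apply Rmin_l].
    apply Rlt_le_trans with ((Cmod l + 1) * (eps / (Cmod l + 1))).
    apply Rmult_lt_compat_l; auto. eapply Rlt_le_trans; [apply Hw|apply Rmin_r].
    right. field. lra.
Qed.

Lemma is_cderiv_const (c z : C) : is_cderiv (fun _ => c) z (RtoC 0).
Proof.
  intros eps He. exists 1. split; [lra|]. intros w _.
  replace (c - c - 0 * (w - z))%C with (RtoC 0) by ring. rewrite Cmod_0.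
  apply Rmult_le_pos; [lra|apply Cmod_ge_0].
Qed.

Lemma is_cderiv_id (z : C) : is_cderiv (fun w => w) z (RtoC 1).
Proof.
  intros eps He. exists 1. split; [lra|]. intros w _.
  replace (w - z - 1 * (w - z))%C with (RtoC 0) by ring. rewrite Cmod_0.
  apply Rmult_le_pos; [lra|apply Cmod_ge_0].
Qed.

Lemma is_cderiv_plus (f g : C -> C) (z l m : C) :
  is_cderiv f z l -> is_cderiv g z m -> is_cderiv (fun w => f w + g w)%C z (l + m)%C.
Proof.
  intros Hf Hg eps He.
  destruct (Hf (eps / 2)) as [d1 [Hd1 H1]]; [lra|].
  destruct (Hg (eps / 2)) as [d2 [Hd2 H2]]; [lra|].
  exists (Rmin d1 d2). split; [now apply Rmin_pos|]. intros w Hw.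
  specialize (H1 w (Rlt_le_trans _ _ _ Hw (Rmin_l _ _))).
  specialize (H2 w (Rlt_le_trans _ _ _ Hw (Rmin_r _ _))).
  replace (f w + g w - (f z + g z) - (l + m) * (w - z))%C
    with ((f w - f z - l * (w - z)) + (g w - g z - m * (w - z)))%C by ring.
  eapply Rle_trans. apply Cmod_triangle. lra.
Qed.

Lemma is_cderiv_mult (f g : C -> C) (z l m : C) :
  is_cderiv f z l -> is_cderiv g z m ->
  is_cderiv (fun w => f w * g w)%C z (l * g z + f z * m)%C.
Proof.
  intros Hf Hg eps He.
  (* [B] adds up the factors that multiply eps in the three error terms of the product; the second
     increment is bounded by the Lipschitz constant |l| + 1, and one unit is spare. *)
  set (B := Cmod (f z) + Cmod (g z) + Cmod l + 2).
  assert (HB : 0 < B) by (unfold B; assert (X := Cmod_ge_0 (f z)); assert (Y := Cmod_ge_0 (g z));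
    assert (Z := Cmod_ge_0 l); lra).
  assert (He' : 0 < eps / B) by now apply Rdiv_lt_0_compat.
  destruct (Hf _ He') as [d1 [Hd1 H1]].
  destruct (Hg _ He') as [d2 [Hd2 H2]].
  destruct (is_cderiv_lip f z l Hf) as [d3 [Hd3 H3]].
  destruct (cdiff_ccont g z (ex_intro _ m Hg) _ He') as [d4 [Hd4 H4]].
  exists (Rmin (Rmin d1 d2) (Rmin d3 d4)). split; [repeat apply Rmin_pos; auto|].
  intros w Hw.
  assert (Hw12 := Rlt_le_trans _ _ _ Hw (Rmin_l _ _)).
  assert (Hw34 := Rlt_le_trans _ _ _ Hw (Rmin_r _ _)).
  specialize (H1 w (Rlt_le_trans _ _ _ Hw12 (Rmin_l _ _))).
  specialize (H2 w (Rlt_le_trans _ _ _ Hw12 (Rmin_r _ _))).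
  specialize (H3 w (Rlt_le_trans _ _ _ Hw34 (Rmin_l _ _))).
  specialize (H4 w (Rlt_le_trans _ _ _ Hw34 (Rmin_r _ _))).
  replace (f w * g w - f z * g z - (l * g z + f z * m) * (w - z))%C
    with ((f w - f z - l * (w - z)) * g z + f z * (g w - g z - m * (w - z))
          + (f w - f z) * (g w - g z))%C by ring.
  eapply Rle_trans. apply Cmod_triangle. eapply Rle_trans.
  apply Rplus_le_compat_r, Cmod_triangle. rewrite !Cmod_mult.
  set (h := Cmod (w - z)) in *. set (e := eps / B) in *.
  assert (Hh : 0 <= h) by apply Cmod_ge_0.
  replace (eps * h) with (e * h * Cmod (g z) + Cmod (f z) * (e * h) + (Cmod l + 1) * h * e + e * h)
    by (unfold e, B; field; unfold B in HB; lra).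
  assert (0 <= e * h) by (apply Rmult_le_pos; lra).
  assert (Cmod (f w - f z) * Cmod (g w - g z) <= (Cmod l + 1) * h * e).
  { apply Rmult_le_compat; try apply Cmod_ge_0; lra. }
  assert (Cmod (f w - f z - l * (w - z)) * Cmod (g z) <= e * h * Cmod (g z)).
  { apply Rmult_le_compat_r; auto using Cmod_ge_0. }
  assert (Cmod (f z) * Cmod (g w - g z - m * (w - z)) <= Cmod (f z) * (e * h)).
  { apply Rmult_le_compat_l; auto using Cmod_ge_0. }
  lra.
Qed.

Lemma is_cderiv_comp (f g : C -> C) (z l m : C) :
  is_cderiv f z l -> is_cderiv g (f z) m -> is_cderiv (fun w => g (f w)) z (m * l)%C.
Proof.
  intros Hf Hg eps He.
  set (B := Cmod l + 1 + Cmod m).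
  assert (Hl := Cmod_ge_0 l). assert (Hm := Cmod_ge_0 m).
  assert (HB : 0 < B) by (unfold B; lra).
  assert (He' : 0 < eps / B) by now apply Rdiv_lt_0_compat.
  destruct (Hg _ He') as [d1 [Hd1 H1]].
  destruct (Hf _ He') as [d2 [Hd2 H2]].
  destruct (is_cderiv_lip f z l Hf) as [d3 [Hd3 H3]].
  destruct (cdiff_ccont f z (ex_intro _ l Hf) _ Hd1) as [d4 [Hd4 H4]].
  exists (Rmin d2 (Rmin d3 d4)). split; [repeat apply Rmin_pos; auto|].
  intros w Hw.
  assert (Hw34 := Rlt_le_trans _ _ _ Hw (Rmin_r _ _)).
  specialize (H2 w (Rlt_le_trans _ _ _ Hw (Rmin_l _ _))).
  specialize (H3 w (Rlt_le_trans _ _ _ Hw34 (Rmin_l _ _))).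
  specialize (H4 w (Rlt_le_trans _ _ _ Hw34 (Rmin_r _ _))).
  specialize (H1 (f w) H4).
  replace (g (f w) - g (f z) - m * l * (w - z))%C
    with ((g (f w) - g (f z) - m * (f w - f z)) + m * (f w - f z - l * (w - z)))%C by ring.
  eapply Rle_trans. apply Cmod_triangle. rewrite Cmod_mult.
  set (h := Cmod (w - z)) in *. set (e := eps / B) in *.
  assert (Hh : 0 <= h) by apply Cmod_ge_0.
  replace (eps * h) with (e * ((Cmod l + 1) * h) + Cmod m * (e * h))
    by (unfold e, B; field; unfold B in HB; lra).
  apply Rplus_le_compat.
  - eapply Rle_trans. apply H1. apply Rmult_le_compat_l; lra.
  - apply Rmult_le_compat_l; lra.
Qed.

Lemma is_cderiv_Cinv (z : C) : z <> RtoC 0 -> is_cderiv Cinv z (- / (z * z))%C.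
Proof.
  intros Hz eps He. assert (Hm : 0 < Cmod z) by now apply Cmod_gt_0.
  set (M := Cmod z) in *.
  (* The remainder is (w - z)^2 / (z^2 w). The first radius keeps |w| >= M / 2, and the second then
     makes |w - z| / (M^2 |w|) at most eps. *)
  exists (Rmin (M / 2) (eps * (M * M * M / 2))). split.
  { apply Rmin_pos; [lra|]. repeat apply Rmult_lt_0_compat; lra. }
  intros w Hw. assert (H1 := Rlt_le_trans _ _ _ Hw (Rmin_l _ _)).
  assert (H2 := Rlt_le_trans _ _ _ Hw (Rmin_r _ _)).
  assert (Hw2 : M / 2 <= Cmod w).
  { replace w with (z + (w - z))%C by ring. eapply Rle_trans; [|apply Cmod_ge_minus].
    fold M. lra. }
  assert (Hw0 : w <> RtoC 0) by (apply Cmod_gt_0; lra).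
  replace (/ w - / z - - / (z * z) * (w - z))%C with ((w - z) * ((w - z) / (z * z * w)))%C
    by (field; auto).
  rewrite Cmod_mult, Rmult_comm. apply Rmult_le_compat_r; [apply Cmod_ge_0|].
  assert (Hzzw : (z * z * w)%C <> RtoC 0) by (repeat apply Cmult_neq_0; auto).
  rewrite Cmod_div by auto. rewrite !Cmod_mult. fold M.
  apply Rle_div_l. { repeat apply Rmult_lt_0_compat; lra. }
  eapply Rle_trans. left; apply H2.
  apply Rmult_le_compat_l; [lra|]. replace (M * M * M / 2) with (M * M * (M / 2)) by field.
  apply Rmult_le_compat_l; [nra|lra].
Qed.

Lemma is_derive_0_little_o (f : R -> R) (l : R) : is_derive f 0 l -> forall eps, 0 < eps ->
  exists d, 0 < d /\ forall a, Rabs a < d -> Rabs (f a - f 0 - l * a) <= eps * Rabs a.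
Proof.
  intros H eps He. apply is_derive_Reals in H. destruct (H eps He) as [d Hd].
  exists d. split; [apply cond_pos|]. intros a Ha.
  destruct (Req_dec a 0) as [->|Ha0].
  - replace (f 0 - f 0 - l * 0) with 0 by ring. rewrite Rabs_R0. lra.
  - specialize (Hd a Ha0 Ha). rewrite Rplus_0_l in Hd.
    replace (f a - f 0 - l * a) with (((f a - f 0) / a - l) * a) by (field; auto).
    rewrite Rabs_mult. apply Rmult_le_compat_r; [apply Rabs_pos|lra].
Qed.

Lemma is_cderiv_cexp_0 : is_cderiv cexp (RtoC 0) (RtoC 1).
Proof.
  intros eps He.
  (* The radius below forces h < e, so the quadratic term 4 h^2 counts as 4 e h; all errors then
     total at most 9 e h. *)
  set (e := Rmin 1 (eps / 12)).
  assert (He' : 0 < e) by (apply Rmin_pos; lra).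
  assert (He1 : e <= 1) by apply Rmin_l. assert (He2 : e <= eps / 12) by apply Rmin_r. clearbody e.
  assert (D1 : is_derive exp 0 1).
  { replace 1 with (exp 0) by apply exp_0. apply is_derive_exp. }
  assert (D2 : is_derive sin 0 1).
  { replace 1 with (cos 0) by apply cos_0. apply is_derive_sin. }
  assert (D3 : is_derive cos 0 0).
  { replace 0 with (- sin 0) at 2 by (rewrite sin_0; ring). apply is_derive_cos. }
  destruct (is_derive_0_little_o _ _ D1 e He') as [d1 [Hd1 H1]].
  destruct (is_derive_0_little_o _ _ D2 e He') as [d2 [Hd2 H2]].
  destruct (is_derive_0_little_o _ _ D3 e He') as [d3 [Hd3 H3]].
  exists (Rmin (Rmin d1 d2) (Rmin d3 e)). split; [repeat apply Rmin_pos; auto|].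
  intros w Hw. replace (w - 0)%C with w in * by ring.
  assert (Hw12 := Rlt_le_trans _ _ _ Hw (Rmin_l _ _)).
  assert (Hw34 := Rlt_le_trans _ _ _ Hw (Rmin_r _ _)).
  assert (Ha := re_le_Cmod w). assert (Hb := im_le_Cmod w).
  set (h := Cmod w) in *. rewrite cexp_0.
  specialize (H1 (Re w)). specialize (H2 (Im w)). specialize (H3 (Im w)).
  rewrite exp_0 in H1. rewrite sin_0 in H2. rewrite cos_0 in H3.
  assert (H1' := H1 (Rle_lt_trans _ _ _ Ha (Rlt_le_trans _ _ _ Hw12 (Rmin_l _ _)))).
  assert (H2' := H2 (Rle_lt_trans _ _ _ Hb (Rlt_le_trans _ _ _ Hw12 (Rmin_r _ _)))).
  assert (H3' := H3 (Rle_lt_trans _ _ _ Hb (Rlt_le_trans _ _ _ Hw34 (Rmin_l _ _)))).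
  assert (Hhe : h < e) by (eapply Rlt_le_trans; [apply Hw34|apply Rmin_r]).
  clear H1 H2 H3 Hw Hw12 Hw34.
  set (a := Re w) in *. set (b := Im w) in *.
  assert (Hh : 0 <= h) by apply Cmod_ge_0.
  assert (E1 : Rabs (exp a - 1 - 1 * a) <= e * h).
  { eapply Rle_trans. apply H1'. apply Rmult_le_compat_l; lra. }
  assert (E2 : Rabs (sin b - 0 - 1 * b) <= e * h).
  { eapply Rle_trans. apply H2'. apply Rmult_le_compat_l; lra. }
  assert (E3 : Rabs (cos b - 1 - 0 * b) <= e * h).
  { eapply Rle_trans. apply H3'. apply Rmult_le_compat_l; lra. }
  assert (Heh : 0 <= e * h) by (apply Rmult_le_pos; lra).
  assert (Heh1 : e * h <= h) by nra.
  assert (E4 : Rabs (exp a - 1) <= 2 * h).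
  { replace (exp a - 1) with ((exp a - 1 - 1 * a) + a) by ring.
    eapply Rle_trans. apply Rabs_triang. lra. }
  assert (E5 : Rabs (exp a) <= 3).
  { replace (exp a) with ((exp a - 1) + 1) by ring.
    eapply Rle_trans. apply Rabs_triang. rewrite Rabs_R1. lra. }
  eapply Rle_trans. apply Cmod_le_abs.
  replace (Re (cexp w - 1 - 1 * w)%C) with ((exp a - 1 - 1 * a) + exp a * (cos b - 1 - 0 * b))
    by (unfold cexp; simpl; fold a b; unfold a, b, Re, Im; ring).
  replace (Im (cexp w - 1 - 1 * w)%C) with ((exp a - 1) * (sin b) + (sin b - 0 - 1 * b))
    by (unfold cexp; simpl; fold a b; unfold a, b, Re, Im; ring).
  assert (E6 : Rabs (sin b) <= 2 * h).
  { replace (sin b) with ((sin b - 0 - 1 * b) + b) by ring.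
    eapply Rle_trans. apply Rabs_triang. lra. }
  assert (Rabs (exp a * (cos b - 1 - 0 * b)) <= 3 * (e * h)).
  { rewrite Rabs_mult. apply Rmult_le_compat; try apply Rabs_pos; lra. }
  assert (Rabs ((exp a - 1) * sin b) <= 2 * h * (2 * h)).
  { rewrite Rabs_mult. apply Rmult_le_compat; try apply Rabs_pos; lra. }
  assert (T1 := Rabs_triang (exp a - 1 - 1 * a) (exp a * (cos b - 1 - 0 * b))).
  assert (T2 := Rabs_triang ((exp a - 1) * (sin b)) (sin b - 0 - 1 * b)).
  assert (h * h <= e * h) by nra.
  assert (12 * (e * h) <= eps * h) by nra.
  lra.
Qed.

Lemma is_cderiv_cexp (z : C) : is_cderiv cexp z (cexp z).
Proof.
  intros eps He. assert (Hp : 0 < exp (Re z)) by apply exp_pos.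
  destruct (is_cderiv_cexp_0 (eps / exp (Re z))) as [d [Hd H]].
  { now apply Rdiv_lt_0_compat. }
  exists d. split; auto. intros w Hw.
  specialize (H (w - z)%C). rewrite cexp_0 in H.
  replace (w - z - 0)%C with (w - z)%C in H by ring. specialize (H Hw).
  replace (cexp w - cexp z - cexp z * (w - z))%C
    with (cexp z * (cexp (w - z) - 1 - 1 * (w - z)))%C.
  - rewrite Cmod_mult, Cmod_cexp.
    replace (eps * Cmod (w - z)) with (exp (Re z) * (eps / exp (Re z) * Cmod (w - z)))
      by (field; lra).
    apply Rmult_le_compat_l; lra.
  - replace w with ((w - z) + z)%C at 3 by ring. rewrite (cexp_plus (w - z) z). ring.
Qed.

Lemma cdiff_const (c z : C) : cdiff (fun _ => c) z.
Proof. eexists. apply is_cderiv_const. Qed.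

Lemma cdiff_id (z : C) : cdiff (fun w => w) z.
Proof. eexists. apply is_cderiv_id. Qed.

Lemma cdiff_plus f g z : cdiff f z -> cdiff g z -> cdiff (fun w => f w + g w)%C z.
Proof. intros [l H] [m K]. eexists. apply is_cderiv_plus; eauto. Qed.

Lemma cdiff_mult f g z : cdiff f z -> cdiff g z -> cdiff (fun w => f w * g w)%C z.
Proof. intros [l H] [m K]. eexists. apply is_cderiv_mult; eauto. Qed.

Lemma cdiff_comp f g z : cdiff f z -> cdiff g (f z) -> cdiff (fun w => g (f w)) z.
Proof. intros [l H] [m K]. eexists. eapply is_cderiv_comp; eauto. Qed.

Lemma is_cderiv_ext f g z l : (forall w, f w = g w) -> is_cderiv f z l -> is_cderiv g z l.
Proof. intros H K eps He. destruct (K eps He) as [d [Hd D]]. exists d. split; auto.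
  intros w Hw. rewrite <- !H. auto. Qed.

Lemma cdiff_ext f g z : (forall w, f w = g w) -> cdiff f z -> cdiff g z.
Proof. intros H [l K]. exists l. eapply is_cderiv_ext; eauto. Qed.

Lemma cdiff_opp f z : cdiff f z -> cdiff (fun w => - f w)%C z.
Proof. intros H. apply cdiff_ext with (fun w => (- RtoC 1) * f w)%C.
  intros; ring. apply cdiff_mult; auto. apply cdiff_const. Qed.

Lemma cdiff_minus f g z : cdiff f z -> cdiff g z -> cdiff (fun w => f w - g w)%C z.
Proof. intros. apply cdiff_plus; auto. now apply cdiff_opp. Qed.

Lemma cdiff_cexp f z : cdiff f z -> cdiff (fun w => cexp (f w)) z.
Proof. intros H. apply (cdiff_comp f cexp); auto. eexists. apply is_cderiv_cexp. Qed.

Lemma cdiff_inv f z : cdiff f z -> f z <> RtoC 0 -> cdiff (fun w => / f w)%C z.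
Proof. intros H H0. apply (cdiff_comp f Cinv); auto. eexists. now apply is_cderiv_Cinv. Qed.

Lemma cdiff_div f g z : cdiff f z -> cdiff g z -> g z <> RtoC 0 -> cdiff (fun w => f w / g w)%C z.
Proof. intros. apply cdiff_mult; auto. now apply cdiff_inv. Qed.

Lemma ccont_mult f g z : ccont f z -> ccont g z -> ccont (fun w => f w * g w)%C z.
Proof.
  intros Hf Hg eps He.
  set (B := Cmod (f z) + Cmod (g z) + 1).
  assert (X := Cmod_ge_0 (f z)). assert (Y := Cmod_ge_0 (g z)).
  set (e := Rmin 1 (eps / (2 * B))).
  assert (HB : 0 < B) by (unfold B; lra).
  assert (He0 : 0 < e) by (apply Rmin_pos; [lra|apply Rdiv_lt_0_compat; lra]).
  destruct (Hf e He0) as [d1 [Hd1 H1]]. destruct (Hg e He0) as [d2 [Hd2 H2]].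
  exists (Rmin d1 d2). split; [now apply Rmin_pos|]. intros w Hw.
  specialize (H1 w (Rlt_le_trans _ _ _ Hw (Rmin_l _ _))).
  specialize (H2 w (Rlt_le_trans _ _ _ Hw (Rmin_r _ _))).
  replace (f w * g w - f z * g z)%C
    with ((f w - f z) * g z + f z * (g w - g z) + (f w - f z) * (g w - g z))%C by ring.
  eapply Rle_lt_trans. apply Cmod_triangle. eapply Rle_lt_trans.
  apply Rplus_le_compat_r, Cmod_triangle. rewrite !Cmod_mult.
  assert (e <= 1) by apply Rmin_l.
  assert (e * B <= eps / 2).
  { apply Rle_trans with (eps / (2 * B) * B). apply Rmult_le_compat_r; [lra|apply Rmin_r].
    right. field. lra. }
  assert (Cmod (f w - f z) * Cmod (g z) <= e * Cmod (g z)) by (apply Rmult_le_compat_r; lra).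
  assert (Cmod (f z) * Cmod (g w - g z) <= Cmod (f z) * e) by (apply Rmult_le_compat_l; lra).
  assert (Cmod (f w - f z) * Cmod (g w - g z) <= e * 1).
  { apply Rmult_le_compat; try apply Cmod_ge_0; lra. }
  assert (e * B = e * Cmod (g z) + Cmod (f z) * e + e * 1) by (unfold B; ring).
  lra.
Qed.

Lemma ex_derive_cdiff (f : C -> C) (z : C) :
  ex_derive (K := C_AbsRing) (V := C_NormedModule) f z -> cdiff f z.
Proof.
  intros [l [_ H]]. exists l. intros eps He.
  specialize (H z (fun P HP => HP) (mkposreal eps He)).
  destruct H as [d Hd]. exists d. split; [apply cond_pos|]. intros w Hw.
  specialize (Hd w Hw). simpl in Hd.
  change (Cmod (f w - f z - (w - z) * l)%C <= eps * Cmod (w - z)%C) in Hd.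
  now rewrite Cmult_comm in Hd.
Qed.

(** * Integrals of complex-valued functions of a real variable *)

Notation CI := (RInt (V := C_R_CompleteNormedModule)).
Notation exCI := (ex_RInt (V := C_R_CompleteNormedModule)).
Notation isCI := (is_RInt (V := C_R_CompleteNormedModule)).
Notation RCcont := (continuous (U := C_UniformSpace)).

Lemma norm_C_R (z : C) : norm (V := C_R_NormedModule) z = Cmod z.
Proof.
  change (sqrt (Rabs (fst z) ^ 2 + Rabs (snd z) ^ 2) = Cmod z).
  unfold Cmod. rewrite !pow2_abs. reflexivity.
Qed.

Lemma isCI_pair (f : R -> C) a b (l : C) :
  is_RInt (fun x => Re (f x)) a b (Re l) -> is_RInt (fun x => Im (f x)) a b (Im l) ->
  isCI f a b l.
Proof.
  intros H1 H2. destruct l as [u v].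
  apply (is_RInt_fct_extend_pair (U := R_NormedModule) (V := R_NormedModule) f a b u v H1 H2).
Qed.

Lemma isCI_Re (f : R -> C) a b (l : C) : isCI f a b l -> is_RInt (fun x => Re (f x)) a b (Re l).
Proof. apply (is_RInt_fct_extend_fst (U := R_NormedModule) (V := R_NormedModule)). Qed.

Lemma isCI_Im (f : R -> C) a b (l : C) : isCI f a b l -> is_RInt (fun x => Im (f x)) a b (Im l).
Proof. apply (is_RInt_fct_extend_snd (U := R_NormedModule) (V := R_NormedModule)). Qed.

Lemma CI_correct f a b : exCI f a b -> isCI f a b (CI f a b).
Proof. apply (RInt_correct (V := C_R_CompleteNormedModule)). Qed.

Lemma CI_unique f a b l : isCI f a b l -> CI f a b = l.
Proof. apply (is_RInt_unique (V := C_R_CompleteNormedModule)). Qed.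

Lemma isCI_plus f g a b l m : isCI f a b l -> isCI g a b m ->
  isCI (fun x => f x + g x)%C a b (l + m)%C.
Proof. apply (is_RInt_plus (V := C_R_NormedModule)). Qed.

Lemma isCI_minus f g a b l m : isCI f a b l -> isCI g a b m ->
  isCI (fun x => f x - g x)%C a b (l - m)%C.
Proof. apply (is_RInt_minus (V := C_R_NormedModule)). Qed.

(** Integration here is linear over R; a complex factor mixes the two coordinates, so it is treated
    through them. *)
Lemma isCI_scal (c : C) f a b l : isCI f a b l -> isCI (fun x => c * f x)%C a b (c * l)%C.
Proof.
  intros H. assert (H1 := isCI_Re _ _ _ _ H). assert (H2 := isCI_Im _ _ _ _ H).
  apply isCI_pair.
  - apply (is_RInt_ext (fun x => Re c * Re (f x) - Im c * Im (f x))). reflexivity.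
    change (Re (c * l)%C) with (Re c * Re l - Im c * Im l).
    apply (is_RInt_minus (V := R_NormedModule)); now apply (is_RInt_scal (V := R_NormedModule)).
  - apply (is_RInt_ext (fun x => Re c * Im (f x) + Im c * Re (f x))). reflexivity.
    change (Im (c * l)%C) with (Re c * Im l + Im c * Re l).
    apply (is_RInt_plus (V := R_NormedModule)); now apply (is_RInt_scal (V := R_NormedModule)).
Qed.

Lemma isCI_const (c : C) a b : isCI (fun _ => c) a b (RtoC (b - a) * c)%C.
Proof.
  replace (RtoC (b - a) * c)%C with (scal (V := C_R_NormedModule) (b - a) c).
  apply (is_RInt_const (V := C_R_NormedModule)).
  apply injective_projections; simpl; unfold scal; simpl; unfold mult; simpl; ring.
Qed.

Lemma isCI_ext f g a b l : (forall x, Rmin a b < x < Rmax a b -> f x = g x) ->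
  isCI f a b l -> isCI g a b l.
Proof. apply (is_RInt_ext (V := C_R_NormedModule)). Qed.

Lemma isCI_conj f a b l : isCI f a b l -> isCI (fun x => Cconj (f x)) a b (Cconj l).
Proof.
  intros H. assert (H1 := isCI_Re _ _ _ _ H). assert (H2 := isCI_Im _ _ _ _ H).
  apply isCI_pair. apply H1. apply (is_RInt_opp (V := R_NormedModule)) in H2. apply H2.
Qed.

Lemma CI_scal c f a b : exCI f a b -> CI (fun x => c * f x)%C a b = (c * CI f a b)%C.
Proof. intros H. apply CI_unique, isCI_scal, CI_correct, H. Qed.

Lemma CI_Chasles f a b c : exCI f a b -> exCI f b c -> (CI f a b + CI f b c)%C = CI f a c.
Proof. apply (RInt_Chasles (V := C_R_CompleteNormedModule)). Qed.

Lemma isCI_Cmod_le f g a b l m : a <= b -> (forall x, a <= x <= b -> Cmod (f x) <= g x) ->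
  isCI f a b l -> is_RInt g a b m -> Cmod l <= m.
Proof.
  intros Hab Hfg Hf Hg. rewrite <- norm_C_R.
  apply (norm_RInt_le (V := C_R_NormedModule) f g a b); auto.
  intros x Hx. rewrite norm_C_R. auto.
Qed.

Lemma isCI_Cmod_le_const f M a b l : a <= b -> (forall x, a <= x <= b -> Cmod (f x) <= M) ->
  isCI f a b l -> Cmod l <= (b - a) * M.
Proof.
  intros. apply (isCI_Cmod_le f (fun _ => M) a b l); auto. apply (is_RInt_const (V := R_NormedModule)).
Qed.

Lemma CI_Cmod_le_const f M a b : a <= b -> (forall x, a <= x <= b -> Cmod (f x) <= M) ->
  exCI f a b -> Cmod (CI f a b) <= (b - a) * M.
Proof. intros. eapply isCI_Cmod_le_const; eauto. now apply CI_correct. Qed.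

Lemma exCI_cont f a b : (forall x, Rmin a b <= x <= Rmax a b -> RCcont f x) -> exCI f a b.
Proof. apply (ex_RInt_continuous (V := C_R_CompleteNormedModule)). Qed.

Lemma RCcont_pair (f : R -> C) x :
  continuous (fun y => Re (f y)) x -> continuous (fun y => Im (f y)) x -> RCcont f x.
Proof.
  intros H1 H2. unfold continuous. apply filterlim_locally. intros eps.
  assert (K1 := proj1 (filterlim_locally _ _) H1 eps).
  assert (K2 := proj1 (filterlim_locally _ _) H2 eps).
  generalize (filter_and _ _ K1 K2). apply filter_imp. intros y [A B]. split; auto.
Qed.

Lemma RCcont_Re (f : R -> C) x : RCcont f x -> continuous (fun y => Re (f y)) x.
Proof.
  intros H. apply filterlim_locally. intros eps.
  assert (K := proj1 (filterlim_locally _ _) H eps). revert K. apply filter_imp. now intros y [A B].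
Qed.

Lemma RCcont_Im (f : R -> C) x : RCcont f x -> continuous (fun y => Im (f y)) x.
Proof.
  intros H. apply filterlim_locally. intros eps.
  assert (K := proj1 (filterlim_locally _ _) H eps). revert K. apply filter_imp. now intros y [A B].
Qed.

Lemma RCcont_mult (f g : R -> C) x : RCcont f x -> RCcont g x -> RCcont (fun y => f y * g y)%C x.
Proof.
  intros Hf Hg. assert (A := RCcont_Re _ _ Hf). assert (B := RCcont_Im _ _ Hf).
  assert (A' := RCcont_Re _ _ Hg). assert (B' := RCcont_Im _ _ Hg).
  apply RCcont_pair.
  - apply (continuous_minus (V := R_NormedModule) (fun y => Re (f y) * Re (g y)) (fun y => Im (f y) * Im (g y)));
      now apply (continuous_mult (K := R_AbsRing)).
  - apply (continuous_plus (V := R_NormedModule) (fun y => Re (f y) * Im (g y)) (fun y => Im (f y) * Re (g y)));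
      now apply (continuous_mult (K := R_AbsRing)).
Qed.

Lemma RCcont_RtoC (f : R -> R) x : continuous f x -> RCcont (fun y => RtoC (f y)) x.
Proof. intros H. apply RCcont_pair; [exact H|apply continuous_const]. Qed.

Lemma ccont_RCcont_eps (f : R -> C) x :
  (forall eps, 0 < eps -> exists d, 0 < d /\ forall y, Rabs (y - x) < d -> Cmod (f y - f x)%C < eps) ->
  RCcont f x.
Proof.
  intros H. apply filterlim_locally. intros eps.
  destruct (H eps (cond_pos eps)) as [d [Hd K]]. exists (mkposreal d Hd). intros y Hy.
  apply (C_NormedModule_mixin_compat1 (f x) (f y)). apply K. apply Hy.
Qed.

Lemma ccont_RCcont_h (f : C -> C) x y : ccont f (x, y) -> RCcont (fun s : R => f (s, y)) x.
Proof.
  intros H. apply ccont_RCcont_eps. intros eps He. destruct (H eps He) as [d [Hd K]].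
  exists d. split; auto. intros s Hs. apply K. change (UniformSpace.sort R_UniformSpace) with R.
  replace ((s, y) - (x, y))%C with (RtoC (s - x)) by (apply injective_projections; simpl; ring).
  rewrite Cmod_R. exact Hs.
Qed.

Lemma ccont_RCcont_v (f : C -> C) x y : ccont f (x, y) -> RCcont (fun s : R => f (x, s)) y.
Proof.
  intros H. apply ccont_RCcont_eps. intros eps He. destruct (H eps He) as [d [Hd K]].
  exists d. split; auto. intros s Hs. apply K. change (UniformSpace.sort R_UniformSpace) with R.
  replace ((x, s) - (x, y))%C with (Ci * RtoC (s - y))%C by (apply injective_projections; simpl; ring).
  rewrite Cmod_mult, Cmod_Ci, Cmod_R, Rmult_1_l. exact Hs.
Qed.

(** * Cauchy's theorem and residues on rectangles *)

(** The boundary is run counterclockwise, with dz = i dy on the vertical sides. *)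
Definition rect_int (f : C -> C) (a b c d : R) : C :=
  (CI (fun s : R => f (s, c)) a b - CI (fun s : R => f (s, d)) a b
   + Ci * (CI (fun y : R => f (b, y)) c d - CI (fun y : R => f (a, y)) c d))%C.

Definition ex_rect_int (f : C -> C) (a b c d : R) : Prop :=
  exCI (fun s : R => f (s, c)) a b /\ exCI (fun s : R => f (s, d)) a b /\
  exCI (fun y : R => f (b, y)) c d /\ exCI (fun y : R => f (a, y)) c d.

Lemma exCI_h f a b y : a <= b -> (forall x, a <= x <= b -> ccont f (x, y)) ->
  exCI (fun s : R => f (s, y)) a b.
Proof.
  intros Hab H. apply exCI_cont. rewrite Rmin_left, Rmax_right by auto.
  intros x Hx. apply ccont_RCcont_h. auto.
Qed.

Lemma exCI_v f c d x : c <= d -> (forall y, c <= y <= d -> ccont f (x, y)) ->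
  exCI (fun y : R => f (x, y)) c d.
Proof.
  intros Hab H. apply exCI_cont. rewrite Rmin_left, Rmax_right by auto.
  intros y Hy. apply ccont_RCcont_v. auto.
Qed.

Lemma exB_cont f a b c d : a <= b -> c <= d ->
  (forall x y, a <= x <= b -> c <= y <= d -> x = a \/ x = b \/ y = c \/ y = d -> ccont f (x, y)) ->
  ex_rect_int f a b c d.
Proof.
  intros Hab Hcd H. unfold ex_rect_int. split; [|split; [|split]].
  - apply (exCI_h f a b c Hab). intros; apply H; (lra || auto).
  - apply (exCI_h f a b d Hab). intros; apply H; (lra || auto).
  - apply (exCI_v f c d b Hcd). intros; apply H; (lra || auto).
  - apply (exCI_v f c d a Hcd). intros; apply H; (lra || auto).
Qed.

Lemma CI_minus f g a b : exCI f a b -> exCI g a b ->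
  CI (fun x => f x - g x)%C a b = (CI f a b - CI g a b)%C.
Proof. intros. apply CI_unique, isCI_minus; now apply CI_correct. Qed.

Lemma rect_int_minus f g a b c d : ex_rect_int f a b c d -> ex_rect_int g a b c d ->
  rect_int (fun z => f z - g z)%C a b c d = (rect_int f a b c d - rect_int g a b c d)%C.
Proof.
  intros (F1 & F2 & F3 & F4) (G1 & G2 & G3 & G4). unfold rect_int.
  rewrite (CI_minus (fun s : R => f (s, c)) (fun s : R => g (s, c))) by auto.
  rewrite (CI_minus (fun s : R => f (s, d)) (fun s : R => g (s, d))) by auto.
  rewrite (CI_minus (fun s : R => f (b, s)) (fun s : R => g (b, s))) by auto.
  rewrite (CI_minus (fun s : R => f (a, s)) (fun s : R => g (a, s))) by auto.
  ring.
Qed.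

Lemma rect_int_le f a b c d M : a <= b -> c <= d -> ex_rect_int f a b c d ->
  (forall x y, a <= x <= b -> c <= y <= d -> x = a \/ x = b \/ y = c \/ y = d -> Cmod (f (x, y)) <= M) ->
  Cmod (rect_int f a b c d) <= 2 * ((b - a) + (d - c)) * M.
Proof.
  intros Hab Hcd (F1 & F2 & F3 & F4) H. unfold rect_int.
  eapply Rle_trans. apply Cmod_triangle. rewrite Cmod_mult, Cmod_Ci, Rmult_1_l.
  assert (E1 : Cmod (CI (fun s : R => f (s, c)) a b) <= (b - a) * M).
  { apply CI_Cmod_le_const; auto. intros; apply H; (lra || auto). }
  assert (E2 : Cmod (CI (fun s : R => f (s, d)) a b) <= (b - a) * M).
  { apply CI_Cmod_le_const; auto. intros; apply H; (lra || auto). }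
  assert (E3 : Cmod (CI (fun s : R => f (b, s)) c d) <= (d - c) * M).
  { apply CI_Cmod_le_const; auto. intros; apply H; (lra || auto). }
  assert (E4 : Cmod (CI (fun s : R => f (a, s)) c d) <= (d - c) * M).
  { apply CI_Cmod_le_const; auto. intros; apply H; (lra || auto). }
  assert (T1 := Cmod_minus_le (CI (fun s : R => f (s, c)) a b) (CI (fun s : R => f (s, d)) a b)).
  assert (T2 := Cmod_minus_le (CI (fun s : R => f (b, s)) c d) (CI (fun s : R => f (a, s)) c d)).
  lra.
Qed.

Lemma exCI_sub1 f a m b : a <= m <= b -> exCI f a b -> exCI f a m.
Proof. apply (ex_RInt_Chasles_1 (V := C_R_CompleteNormedModule)). Qed.

Lemma exCI_sub2 f a m b : a <= m <= b -> exCI f a b -> exCI f m b.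
Proof. apply (ex_RInt_Chasles_2 (V := C_R_CompleteNormedModule)). Qed.

Lemma rect_split_x f a m b c d : a <= m <= b ->
  exCI (fun s : R => f (s, c)) a b -> exCI (fun s : R => f (s, d)) a b ->
  rect_int f a b c d = (rect_int f a m c d + rect_int f m b c d)%C.
Proof.
  intros Hm H1 H2. unfold rect_int.
  rewrite <- (CI_Chasles (fun s : R => f (s, c)) a m b) by eauto using exCI_sub1, exCI_sub2.
  rewrite <- (CI_Chasles (fun s : R => f (s, d)) a m b) by eauto using exCI_sub1, exCI_sub2.
  ring.
Qed.

Lemma rect_split_y f a b c m d : c <= m <= d ->
  exCI (fun y : R => f (a, y)) c d -> exCI (fun y : R => f (b, y)) c d ->
  rect_int f a b c d = (rect_int f a b c m + rect_int f a b m d)%C.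
Proof.
  intros Hm H1 H2. unfold rect_int.
  rewrite <- (CI_Chasles (fun s : R => f (a, s)) c m d) by eauto using exCI_sub1, exCI_sub2.
  rewrite <- (CI_Chasles (fun s : R => f (b, s)) c m d) by eauto using exCI_sub1, exCI_sub2.
  ring.
Qed.

Lemma rect_int_alt f a b c d : ex_rect_int f a b c d ->
  rect_int f a b c d = (CI (fun s : R => f (s, c) - f (s, d))%C a b
    + Ci * CI (fun y : R => f (b, y) - f (a, y))%C c d)%C.
Proof.
  intros (F1 & F2 & F3 & F4). unfold rect_int.
  rewrite (CI_minus (fun s : R => f (s, c)) (fun s : R => f (s, d))) by auto.
  rewrite (CI_minus (fun s : R => f (b, s)) (fun s : R => f (a, s))) by auto.
  ring.
Qed.

(** Differences between opposite sides are constant, so the contributions i l (b - a) (c - d) and i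
    l (b - a) (d - c) cancel. This disposes of the tangent map in Goursat's argument. *)
Lemma rect_int_affine (A l : C) a b c d : a <= b -> c <= d ->
  rect_int (fun z => A + l * z)%C a b c d = RtoC 0.
Proof.
  intros Hab Hcd.
  assert (Hc : forall z, ccont (fun z => A + l * z)%C z).
  { intros z. apply cdiff_ccont, cdiff_plus; [apply cdiff_const|].
    apply cdiff_mult; [apply cdiff_const|apply cdiff_id]. }
  rewrite rect_int_alt by (apply exB_cont; auto).
  replace (CI (fun s : R => A + l * (s, c) - (A + l * (s, d)))%C a b)
    with (RtoC (b - a) * (l * Ci * RtoC (c - d)))%C.
  replace (CI (fun y : R => A + l * (b, y) - (A + l * (a, y)))%C c d)
    with (RtoC (d - c) * (l * RtoC (b - a)))%C.
  - rewrite !RtoC_minus. ring.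
  - symmetry. apply CI_unique. eapply isCI_ext; [|apply isCI_const].
    intros x _. simpl. apply injective_projections; simpl; ring.
  - symmetry. apply CI_unique. eapply isCI_ext; [|apply isCI_const].
    intros x _. simpl. apply injective_projections; simpl; ring.
Qed.

Section Goursat.
Variables (f : C -> C) (a0 c0 L H : R).
Hypothesis HL : 0 <= L.
Hypothesis HH : 0 <= H.
Hypothesis Hf : forall x y, a0 <= x <= a0 + L -> c0 <= y <= c0 + H -> cdiff f (x, y).

Let w (n : nat) := L / 2 ^ n.
Let h (n : nat) := H / 2 ^ n.
(** Invariant of the bisection, with [p] the lower left corner of the current subrectangle: the
    boundary integral shrinks no faster than the area. *)
Let P (eta : R) (n : nat) (p : R * R) : Prop :=
  a0 <= fst p /\ fst p + w n <= a0 + L /\ c0 <= snd p /\ snd p + h n <= c0 + H /\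
  eta / 4 ^ n <= Cmod (rect_int f (fst p) (fst p + w n) (snd p) (snd p + h n)).

Lemma pow2_pos n : 0 < 2 ^ n.
Proof. apply pow_lt. lra. Qed.

Lemma width_pos n : 0 <= w n.
Proof. unfold w. apply Rmult_le_pos; auto. left. apply Rinv_0_lt_compat, pow2_pos. Qed.

Lemma height_pos n : 0 <= h n.
Proof. unfold h. apply Rmult_le_pos; auto. left. apply Rinv_0_lt_compat, pow2_pos. Qed.

Lemma width_halve n : w n = w (S n) + w (S n).
Proof. unfold w. simpl. assert (X := pow2_pos n). field. lra. Qed.

Lemma height_halve n : h n = h (S n) + h (S n).
Proof. unfold h. simpl. assert (X := pow2_pos n). field. lra. Qed.

Lemma Goursat_cont x y : a0 <= x <= a0 + L -> c0 <= y <= c0 + H -> ccont f (x, y).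
Proof. intros. apply cdiff_ccont. auto. Qed.

(** The integrals over the four quarters add up to that of the whole, since inner sides cancel;
    hence one quarter retains a fourth of the modulus. *)
Lemma Goursat_step eta n p : P eta n p -> exists q, P eta (S n) q /\
  fst p <= fst q <= fst p + w (S n) /\ snd p <= snd q <= snd p + h (S n).
Proof.
  destruct p as [a c]. intros (H1 & H2 & H3 & H4 & H5). simpl in *.
  assert (W := width_halve n). assert (K := height_halve n).
  assert (WP := width_pos (S n)). assert (KP := height_pos (S n)).
  set (u := w (S n)) in *. set (v := h (S n)) in *. rewrite W, K in *.
  assert (Ex : forall y, c <= y <= c + (v + v) -> exCI (fun s : R => f (s, y)) a (a + (u + u))).
  { intros y Hy. apply exCI_h; [lra|]. intros; apply Goursat_cont; lra. }
  assert (Ey : forall x, a <= x <= a + (u + u) -> exCI (fun s : R => f (x, s)) c (c + (v + v))).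
  { intros x Hx. apply exCI_v; [lra|]. intros; apply Goursat_cont; lra. }
  rewrite (rect_split_x f a (a + u) (a + (u + u))) in H5 by (auto; try apply Ex; lra).
  rewrite (rect_split_y f a (a + u) c (c + v)) in H5 by (auto; try apply Ey; lra).
  rewrite (rect_split_y f (a + u) (a + (u + u)) c (c + v)) in H5 by (auto; try apply Ey; lra).
  replace (a + (u + u)) with (a + u + u) in * by ring.
  replace (c + (v + v)) with (c + v + v) in * by ring.
  assert (E4 : 4 * (eta / 4 ^ S n) = eta / 4 ^ n).
  { simpl. assert (0 < 4 ^ n) by (apply pow_lt; lra). field. lra. }
  rewrite <- E4 in H5.
  set (I1 := rect_int f a (a + u) c (c + v)) in *.
  set (I2 := rect_int f a (a + u) (c + v) (c + v + v)) in *.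
  set (I3 := rect_int f (a + u) (a + u + u) c (c + v)) in *.
  set (I4 := rect_int f (a + u) (a + u + u) (c + v) (c + v + v)) in *.
  assert (T := Cmod_triangle (I1 + I2) (I3 + I4)).
  assert (T1 := Cmod_triangle I1 I2). assert (T2 := Cmod_triangle I3 I4).
  destruct (Rle_dec (eta / 4 ^ S n) (Cmod I1)) as [D1|D1].
  { exists (a, c). unfold P; simpl. fold u v. fold I1. repeat split; auto; lra. }
  destruct (Rle_dec (eta / 4 ^ S n) (Cmod I2)) as [D2|D2].
  { exists (a, c + v). unfold P; simpl. fold u v. fold I2. repeat split; auto; lra. }
  destruct (Rle_dec (eta / 4 ^ S n) (Cmod I3)) as [D3|D3].
  { exists (a + u, c). unfold P; simpl. fold u v. fold I3. repeat split; auto; lra. }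
  destruct (Rle_dec (eta / 4 ^ S n) (Cmod I4)) as [D4|D4].
  { exists (a + u, c + v). unfold P; simpl. fold u v. fold I4. repeat split; auto; lra. }
  exfalso. lra.
Qed.

(** The common point of the nested intervals is the supremum of their left ends. *)
Lemma nested_limit (a s : nat -> R) : (forall n, 0 <= s n) ->
  (forall n, a n <= a (S n) /\ a (S n) + s (S n) <= a n + s n) ->
  exists x, forall n, a n <= x <= a n + s n.
Proof.
  intros Hs Ha.
  assert (M1 : forall n k, a n <= a (n + k)%nat /\ a (n + k)%nat + s (n + k)%nat <= a n + s n).
  { intros n k. induction k. rewrite Nat.add_0_r; lra.
    rewrite Nat.add_succ_r. destruct (Ha (n + k)%nat). lra. }
  assert (M2 : forall n m, a n <= a m + s m).
  { intros n m. destruct (Compare_dec.le_dec n m) as [l|l].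
    - replace m with (n + (m - n))%nat by lia. destruct (M1 n (m - n)%nat).
      assert (X := Hs (n + (m - n))%nat). lra.
    - replace n with (m + (n - m))%nat by lia. destruct (M1 m (n - m)%nat).
      assert (X := Hs (m + (n - m))%nat). lra. }
  destruct (completeness (fun x => exists n, x = a n)) as [x [Hx1 Hx2]].
  - exists (a 0%nat + s 0%nat). intros y [n ->]. apply M2.
  - exists (a 0%nat). now exists 0%nat.
  - exists x. intros n. split.
    + apply Hx1. now exists n.
    + apply Hx2. intros y [m ->]. apply M2.
Qed.

Lemma Goursat_zero : rect_int f a0 (a0 + L) c0 (c0 + H) = RtoC 0.
Proof.
  apply NNPP. intros HI. apply Cmod_gt_0 in HI.
  set (eta := Cmod (rect_int f a0 (a0 + L) c0 (c0 + H))) in *.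
  assert (P0 : P eta 0 (a0, c0)).
  { unfold P, w, h. simpl.
    replace (a0 + L / 1) with (a0 + L) by field.
    replace (c0 + H / 1) with (c0 + H) by field. fold eta. lra. }
  (* The step is made total in [p], so that choice yields a function that can be iterated. *)
  assert (St : forall n p, exists q, P eta n p -> P eta (S n) q /\
    fst p <= fst q <= fst p + w (S n) /\ snd p <= snd q <= snd p + h (S n)).
  { intros n p. destruct (classic (P eta n p)) as [Hp|Hp].
    - destruct (Goursat_step eta n p Hp) as [q Hq]. now exists q.
    - exists p. tauto. }
  set (next := fun n p => proj1_sig (constructive_indefinite_description _ (St n p))).
  assert (Hn : forall n p, P eta n p -> P eta (S n) (next n p) /\
    fst p <= fst (next n p) <= fst p + w (S n) /\ snd p <= snd (next n p) <= snd p + h (S n)).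
  { intros n p. unfold next. now destruct (constructive_indefinite_description _ (St n p)). }
  set (p := fix p n := match n with O => (a0, c0) | S m => next m (p m) end).
  assert (Hp : forall n, P eta n (p n)).
  { induction n. exact P0. now apply (Hn n (p n)). }
  assert (Hp' : forall n, fst (p n) <= fst (p (S n)) <= fst (p n) + w (S n) /\
    snd (p n) <= snd (p (S n)) <= snd (p n) + h (S n)).
  { intros n. now apply (Hn n (p n)). }
  destruct (nested_limit (fun n => fst (p n)) w width_pos) as [x Hx].
  { intros n. destruct (Hp' n). assert (X := width_halve n). lra. }
  destruct (nested_limit (fun n => snd (p n)) h height_pos) as [y Hy].
  { intros n. destruct (Hp' n). assert (X := height_halve n). lra. }
  assert (Hxy : cdiff f (x, y)).
  { apply Hf. specialize (Hx 0%nat). unfold w in Hx; simpl in Hx. lra.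
    specialize (Hy 0%nat). unfold h in Hy; simpl in Hy. lra. }
  destruct Hxy as [l Hl].
  set (S := L + H + 1). assert (HS : 0 < S) by (unfold S; lra).
  (* With this tolerance the non-affine part of f has boundary integral at most 2 (u + v) times eta
     / (4 S^2) (u + v). As u + v <= S / 2^n, this is at most half of eta / 4^n, a contradiction. The
     1 in [S] keeps it positive for a degenerate rectangle. *)
  destruct (Hl (eta / (4 * S * S))) as [d [Hd D]].
  { apply Rdiv_lt_0_compat; auto. nra. }
  assert (Hlim : exists n, S / 2 ^ n < d).
  { destruct (pow_lt_1_zero (1 / 2)) with (y := d / S) as [N HN].
    rewrite Rabs_pos_eq; lra. now apply Rdiv_lt_0_compat.
    exists N. specialize (HN N (Nat.le_refl _)).
    rewrite Rabs_pos_eq in HN by (apply pow_le; lra).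
    unfold Rdiv in HN at 1. rewrite Rmult_1_l, pow_inv in HN.
    apply Rmult_lt_compat_l with (r := S) in HN; auto.
    replace (S * (d / S)) with d in HN by (field; lra). exact HN. }
  destruct Hlim as [n Hn2].
  specialize (Hx n). specialize (Hy n). destruct (Hp n) as (Q1 & Q2 & Q3 & Q4 & Q5).
  assert (WP := width_pos n). assert (KP := height_pos n).
  assert (Hwh : w n + h n <= S / 2 ^ n).
  { unfold w, h, S. assert (X := Rinv_0_lt_compat _ (pow2_pos n)). unfold Rdiv. nra. }
  set (a := fst (p n)) in *. set (c := snd (p n)) in *.
  set (u := w n) in *. set (v := h n) in *.
  set (g := fun z : C => (f (x, y) - l * (x, y) + l * z)%C).
  assert (Gc : forall z, ccont g z).
  { intros z. apply cdiff_ccont, cdiff_plus; [apply cdiff_const|].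
    apply cdiff_mult; [apply cdiff_const|apply cdiff_id]. }
  assert (F1 : ex_rect_int f a (a + u) c (c + v)).
  { apply exB_cont; try lra. intros; apply Goursat_cont; lra. }
  assert (G1 : ex_rect_int g a (a + u) c (c + v)) by (apply exB_cont; try lra; intros; apply Gc).
  assert (E : rect_int f a (a + u) c (c + v) = rect_int (fun z => f z - g z)%C a (a + u) c (c + v)).
  { rewrite rect_int_minus by auto. unfold g. rewrite rect_int_affine by lra. ring. }
  rewrite E in Q5.
  assert (B : Cmod (rect_int (fun z => f z - g z)%C a (a + u) c (c + v)) <=
    2 * ((a + u - a) + (c + v - c)) * (eta / (4 * S * S) * (u + v))).
  { apply rect_int_le; try lra.
    - destruct F1 as (F1 & F2 & F3 & F4), G1 as (G1 & G2 & G3 & G4).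
      (split; [|split; [|split]]); eexists; apply isCI_minus; apply CI_correct; auto.
    - intros x' y' Hx' Hy' _. unfold g.
      replace (f (x', y') - (f (x, y) - l * (x, y) + l * (x', y')))%C
        with (f (x', y') - f (x, y) - l * ((x', y') - (x, y)))%C by ring.
      assert (Hm : Cmod ((x', y') - (x, y))%C <= u + v).
      { eapply Rle_trans. apply Cmod_le_abs. simpl.
        apply Rplus_le_compat; apply Rabs_le; lra. }
      eapply Rle_trans. apply D. lra. apply Rmult_le_compat_l; auto.
      apply Rlt_le, Rdiv_lt_0_compat; auto. nra. }
  replace (2 * ((a + u - a) + (c + v - c)) * (eta / (4 * S * S) * (u + v)))
    with (eta / (2 * S * S) * ((u + v) * (u + v))) in B by (field; lra).
  assert (B2 : (u + v) * (u + v) <= S / 2 ^ n * (S / 2 ^ n)) by nra.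
  assert (B3 : eta / (2 * S * S) * ((u + v) * (u + v)) <= eta / 4 ^ n / 2).
  { replace (eta / 4 ^ n / 2) with (eta / (2 * S * S) * (S / 2 ^ n * (S / 2 ^ n))).
    apply Rmult_le_compat_l; auto. apply Rlt_le, Rdiv_lt_0_compat; auto. nra.
    replace 4 with (2 * 2) by ring. rewrite Rpow_mult_distr. field. split. assert (X := pow2_pos n); lra. lra. }
  assert (0 < eta / 4 ^ n) by (apply Rdiv_lt_0_compat; auto; apply pow_lt; lra).
  lra.
Qed.
End Goursat.

Lemma Goursat f a b c d : a <= b -> c <= d ->
  (forall x y, a <= x <= b -> c <= y <= d -> cdiff f (x, y)) -> rect_int f a b c d = RtoC 0.
Proof.
  intros Hab Hcd Hf. replace b with (a + (b - a)) by ring. replace d with (c + (d - c)) by ring.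
  apply Goursat_zero; try lra. intros; apply Hf; lra.
Qed.

(** * Residues at simple poles *)

(** Twice the angle pi / 2 that a side of a square subtends at its centre; each pair of opposite
    sides contributes this to [rect_int_inv]. *)
Lemma is_RInt_atan_kernel r : 0 < r -> is_RInt (fun u => 2 * r / (u * u + r * r)) (- r) r PI.
Proof.
  intros Hr. replace PI with (minus (2 * atan (r / r)) (2 * atan (- r / r))).
  - apply (is_RInt_derive (V := R_CompleteNormedModule) (fun u => 2 * atan (u / r))).
    + intros x _. auto_derive. lra. field. split; nra.
    + intros x _. apply (ex_derive_continuous (V := R_NormedModule)). auto_derive. nra.
  - replace (- r / r) with (Ropp 1) by (field; lra). replace (r / r) with 1 by (field; lra).
    rewrite atan_opp, atan_1. unfold minus, plus, opp; simpl. field.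
Qed.

Lemma isCI_RtoC g a b m : is_RInt g a b m -> isCI (fun x => RtoC (g x)) a b (RtoC m).
Proof.
  intros H. apply isCI_pair. exact H.
  apply (is_RInt_ext (fun _ => 0)). reflexivity.
  replace (Im (RtoC m)) with (scal (b - a) 0). apply (is_RInt_const (V := R_NormedModule)).
  apply Rmult_0_r.
Qed.

(** Opposite sides are combined before integrating: 1 / (u - i r) - 1 / (u + i r) = 2 i r / (u^2 +
    r^2), and similarly on the vertical sides. Only an arctangent remains, and no branch of the
    logarithm enters. *)
Lemma rect_int_inv (z0 : C) r : 0 < r ->
  rect_int (fun z => / (z - z0))%C (fst z0 - r) (fst z0 + r) (snd z0 - r) (snd z0 + r)
  = (RtoC (2 * PI) * Ci)%C.
Proof.
  destruct z0 as [x0 y0]. simpl. intros Hr.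
  rewrite rect_int_alt.
  2:{ apply exB_cont; try lra. intros x y Hx Hy Hb. apply cdiff_ccont, cdiff_inv.
      apply cdiff_minus; [apply cdiff_id|apply cdiff_const].
      intros E. injection E; intros; simpl in *. lra. }
  assert (K := is_RInt_atan_kernel r Hr).
  replace (CI (fun s : R => / ((s, (y0 - r)%R) - (x0, y0)) - / ((s, (y0 + r)%R) - (x0, y0)))%C (x0 - r) (x0 + r))
    with (Ci * RtoC PI)%C.
  replace (CI (fun s : R => / (((x0 + r)%R, s) - (x0, y0)) - / (((x0 - r)%R, s) - (x0, y0)))%C (y0 - r) (y0 + r))
    with (RtoC PI).
  - replace (2 * PI) with (PI + PI) by ring. rewrite RtoC_plus. ring.
  - symmetry. apply CI_unique.
    (* The shape [1 * s + - y0] is the affine substitution of [is_RInt_comp_lin]. *)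
    apply isCI_ext with (fun s => RtoC (2 * r / ((1 * s + - y0) * (1 * s + - y0) + r * r))).
    + intros s _.
      replace (((x0 + r)%R, s) - (x0, y0))%C with ((r, s - y0) : C)
        by (apply injective_projections; simpl; ring).
      replace (((x0 - r)%R, s) - (x0, y0))%C with ((- r, s - y0) : C)
        by (apply injective_projections; simpl; ring).
      replace (1 * s + - y0) with (s - y0) by ring. set (u := s - y0).
      assert (0 < r * r) by nra. assert (0 <= u * u) by nra.
      apply injective_projections; simpl; field; repeat split; nra.
    + apply isCI_RtoC.
      apply (is_RInt_ext (fun s => scal 1 (2 * r / ((1 * s + - y0) * (1 * s + - y0) + r * r)))).
        intros; apply Rmult_1_l.
        apply (is_RInt_comp_lin (V := R_NormedModule) (fun u => 2 * r / (u * u + r * r))).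
        replace (1 * (y0 - r) + - y0) with (- r) by ring. replace (1 * (y0 + r) + - y0) with r by ring.
        exact K.
  - symmetry. apply CI_unique.
    apply isCI_ext with (fun s => Ci * RtoC (2 * r / ((1 * s + - x0) * (1 * s + - x0) + r * r)))%C.
    + intros s _.
      replace ((s, (y0 - r)%R) - (x0, y0))%C with ((s - x0, - r) : C)
        by (apply injective_projections; simpl; ring).
      replace ((s, (y0 + r)%R) - (x0, y0))%C with ((s - x0, r) : C)
        by (apply injective_projections; simpl; ring).
      replace (1 * s + - x0) with (s - x0) by ring. set (u := s - x0).
      assert (0 < r * r) by nra. assert (0 <= u * u) by nra.
      apply injective_projections; simpl; field; repeat split; nra.
    + apply isCI_scal. apply isCI_RtoC.
      apply (is_RInt_ext (fun s => scal 1 (2 * r / ((1 * s + - x0) * (1 * s + - x0) + r * r)))).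
        intros; apply Rmult_1_l.
        apply (is_RInt_comp_lin (V := R_NormedModule) (fun u => 2 * r / (u * u + r * r))).
        replace (1 * (x0 - r) + - x0) with (- r) by ring. replace (1 * (x0 + r) + - x0) with r by ring.
        exact K.
Qed.

Lemma rect_int_scal k f a b c d : ex_rect_int f a b c d ->
  rect_int (fun z => k * f z)%C a b c d = (k * rect_int f a b c d)%C.
Proof.
  intros (F1 & F2 & F3 & F4). unfold rect_int.
  rewrite (CI_scal k (fun s : R => f (s, c))), (CI_scal k (fun s : R => f (s, d))),
    (CI_scal k (fun s : R => f (b, s))), (CI_scal k (fun s : R => f (a, s))) by auto.
  ring.
Qed.

(** Goursat on the four surrounding strips shrinks the contour to a square of half-side r about z0.
    There f differs from A / (z - z0) by at most (eps / 8) / r, and the perimeter is 8 r. *)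
Theorem residue_rect f (z0 A : C) a b c d : a < fst z0 < b -> c < snd z0 < d ->
  (forall x y, a <= x <= b -> c <= y <= d -> (x, y) <> z0 -> cdiff f (x, y)) ->
  (forall eps, 0 < eps -> exists r, 0 < r /\ forall w, w <> z0 -> Cmod (w - z0)%C < r ->
     Cmod (f w * (w - z0) - A)%C <= eps) ->
  rect_int f a b c d = (RtoC (2 * PI) * Ci * A)%C.
Proof.
  destruct z0 as [x0 y0]. intros Hx0 Hy0 Hf Hlim. simpl in Hx0, Hy0.
  apply Cmod_small_eq. intros eps He.
  destruct (Hlim (eps / 8)) as [r0 [Hr0 Hr]]; [lra|].
  (* Points of the small square lie within 2 r of z0, hence strictly within r0. *)
  set (r := Rmin (r0 / 3) (Rmin (Rmin (x0 - a) (b - x0)) (Rmin (y0 - c) (d - y0)))).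
  assert (Hrp : 0 < r) by (unfold r; repeat apply Rmin_pos; lra).
  assert (Hr1 : r <= r0 / 3) by apply Rmin_l.
  assert (Hr2 : r <= x0 - a /\ r <= b - x0 /\ r <= y0 - c /\ r <= d - y0).
  { unfold r. repeat split; (eapply Rle_trans; [apply Rmin_r|]);
    [eapply Rle_trans; [apply Rmin_l|apply Rmin_l]|eapply Rle_trans; [apply Rmin_l|apply Rmin_r]
    |eapply Rle_trans; [apply Rmin_r|apply Rmin_l]|eapply Rle_trans; [apply Rmin_r|apply Rmin_r]]. }
  clearbody r.
  assert (Hc : forall x y, a <= x <= b -> c <= y <= d -> x <> x0 \/ y <> y0 -> cdiff f (x, y)).
  { intros x y Hx Hy Hxy. apply Hf; auto. intros E; injection E; tauto. }
  assert (E0 : rect_int f a b c d = rect_int f (x0 - r) (x0 + r) (y0 - r) (y0 + r)).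
  { rewrite (rect_split_x f a (x0 - r) b) by
      (try lra; apply exCI_h; try lra; intros; apply cdiff_ccont, Hc; lra).
    rewrite (Goursat f a (x0 - r)) by (try lra; intros; apply Hc; lra).
    rewrite (rect_split_x f (x0 - r) (x0 + r) b) by
      (try lra; apply exCI_h; try lra; intros; apply cdiff_ccont, Hc; lra).
    rewrite (Goursat f (x0 + r) b) by (try lra; intros; apply Hc; lra).
    rewrite (rect_split_y f (x0 - r) (x0 + r) c (y0 - r) d) by
      (try lra; apply exCI_v; try lra; intros; apply cdiff_ccont, Hc; lra).
    rewrite (Goursat f (x0 - r) (x0 + r) c) by (try lra; intros; apply Hc; lra).
    rewrite (rect_split_y f (x0 - r) (x0 + r) (y0 - r) (y0 + r) d) by
      (try lra; apply exCI_v; try lra; intros; apply cdiff_ccont, Hc; lra).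
    rewrite (Goursat f (x0 - r) (x0 + r) (y0 + r) d) by (try lra; intros; apply Hc; lra).
    ring. }
  rewrite E0.
  set (g := fun z : C => (A * / (z - (x0, y0)))%C).
  assert (Gi : ex_rect_int (fun z : C => / (z - (x0, y0)))%C (x0 - r) (x0 + r) (y0 - r) (y0 + r)).
  { apply exB_cont; try lra. intros x y Hx Hy Hb. apply cdiff_ccont, cdiff_inv.
    apply cdiff_minus; [apply cdiff_id|apply cdiff_const].
    intros E. injection E; intros; simpl in *. lra. }
  assert (Eg : rect_int g (x0 - r) (x0 + r) (y0 - r) (y0 + r) = (RtoC (2 * PI) * Ci * A)%C).
  { unfold g. rewrite rect_int_scal by auto.
    assert (EI := rect_int_inv (x0, y0) r Hrp). simpl in EI. rewrite EI. ring. }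
  rewrite <- Eg.
  assert (F1 : ex_rect_int f (x0 - r) (x0 + r) (y0 - r) (y0 + r)).
  { apply exB_cont; try lra. intros; apply cdiff_ccont, Hc; lra. }
  assert (G1 : ex_rect_int g (x0 - r) (x0 + r) (y0 - r) (y0 + r)).
  { destruct Gi as (G1 & G2 & G3 & G4).
    (split; [|split; [|split]]); eexists; apply isCI_scal; apply CI_correct; auto. }
  rewrite <- rect_int_minus by auto.
  eapply Rle_trans.
  - apply rect_int_le with (M := eps / 8 / r); try lra.
    + destruct F1 as (F1 & F2 & F3 & F4), G1 as (G1 & G2 & G3 & G4).
      (split; [|split; [|split]]); eexists; apply isCI_minus; apply CI_correct; auto.
    + intros x y Hx Hy Hb.
      assert (Hne : (x, y) <> (x0, y0)) by (intros E; injection E; intros; lra).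
      assert (Hne' : ((x, y) - (x0, y0))%C <> RtoC 0).
      { intros E. apply Hne. injection E. intros. f_equal; lra. }
      unfold g.
      replace (f (x, y) - A * / ((x, y) - (x0, y0)))%C
        with ((f (x, y) * ((x, y) - (x0, y0)) - A) / ((x, y) - (x0, y0)))%C by (field; auto).
      rewrite Cmod_div by auto.
      assert (Hlow : r <= Cmod ((x, y) - (x0, y0))%C).
      { assert (Y1 := re_le_Cmod ((x, y) - (x0, y0))%C).
        assert (Y2 := im_le_Cmod ((x, y) - (x0, y0))%C). simpl in Y1, Y2.
        destruct Hb as [ -> | [ -> | [ -> | -> ]]].
        - eapply Rle_trans; [|apply Y1]. rewrite Rabs_left; lra.
        - eapply Rle_trans; [|apply Y1]. rewrite Rabs_right; lra.
        - eapply Rle_trans; [|apply Y2]. rewrite Rabs_left; lra.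
        - eapply Rle_trans; [|apply Y2]. rewrite Rabs_right; lra. }
      assert (Hup : Cmod ((x, y) - (x0, y0))%C <= 2 * r).
      { eapply Rle_trans. apply Cmod_le_abs. simpl.
        replace (2 * r) with (r + r) by ring.
        apply Rplus_le_compat; apply Rabs_le; lra. }
      unfold Rdiv at 1. apply Rmult_le_compat; try apply Cmod_ge_0.
      * left. apply Rinv_0_lt_compat. lra.
      * apply Hr; auto. lra.
      * apply Rinv_le_contravar; lra.
  - right. field. lra.
Qed.

(** * Uniform limits under the boundary integral *)

Lemma CI_lim (fN : nat -> R -> C) f a b : a <= b -> (forall n, exCI (fN n) a b) -> exCI f a b ->
  (forall eps, 0 < eps -> exists N, forall n x, (N <= n)%nat -> a <= x <= b -> Cmod (fN n x - f x)%C <= eps) ->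
  forall eps, 0 < eps -> exists N, forall n, (N <= n)%nat -> Cmod (CI (fN n) a b - CI f a b)%C <= eps.
Proof.
  intros Hab H1 H2 H eps He. destruct (H (eps / (b - a + 1))) as [N HN].
  apply Rdiv_lt_0_compat; lra.
  exists N. intros n Hn. rewrite <- CI_minus by auto.
  eapply Rle_trans. apply CI_Cmod_le_const with (M := eps / (b - a + 1)); auto.
  eexists; apply isCI_minus; apply CI_correct; auto.
  apply Rle_trans with ((b - a + 1) * (eps / (b - a + 1))).
  apply Rmult_le_compat_r; [|lra]. apply Rlt_le, Rdiv_lt_0_compat; lra.
  right. field. lra.
Qed.

Lemma rect_int_lim (fN : nat -> C -> C) f a b c d : a <= b -> c <= d ->
  (forall n, ex_rect_int (fN n) a b c d) -> ex_rect_int f a b c d ->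
  (forall eps, 0 < eps -> exists N, forall n x y, (N <= n)%nat -> a <= x <= b -> c <= y <= d ->
     x = a \/ x = b \/ y = c \/ y = d -> Cmod (fN n (x, y) - f (x, y))%C <= eps) ->
  forall eps, 0 < eps -> exists N, forall n, (N <= n)%nat ->
    Cmod (rect_int (fN n) a b c d - rect_int f a b c d)%C <= eps.
Proof.
  intros Hab Hcd H1 H2 H eps He.
  destruct (H (eps / (2 * ((b - a) + (d - c)) + 1))) as [N HN].
  apply Rdiv_lt_0_compat; lra.
  exists N. intros n Hn. rewrite <- rect_int_minus by auto.
  eapply Rle_trans. apply rect_int_le with (M := eps / (2 * ((b - a) + (d - c)) + 1)); auto.
  - destruct (H1 n) as (F1 & F2 & F3 & F4), H2 as (G1 & G2 & G3 & G4).
      (split; [|split; [|split]]); eexists; apply isCI_minus; apply CI_correct; auto.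
  - apply Rle_trans with ((2 * ((b - a) + (d - c)) + 1) * (eps / (2 * ((b - a) + (d - c)) + 1))).
    apply Rmult_le_compat_r; [|lra]. apply Rlt_le, Rdiv_lt_0_compat; lra.
    right. field. lra.
Qed.

Lemma bounded_h f a b y : a <= b -> (forall x, a <= x <= b -> ccont f (x, y)) ->
  exists M, 0 < M /\ forall x, a <= x <= b -> Cmod (f (x, y)) <= M.
Proof.
  intros Hab H.
  destruct (bounded_continuity (V := C_R_NormedModule) (fun s : R => f (s, y)) a b) as [M HM].
  { intros x Hx. apply ccont_RCcont_h. auto. }
  exists (Rmax M 1). split. eapply Rlt_le_trans; [|apply Rmax_r]; lra.
  intros x Hx. specialize (HM x Hx). rewrite norm_C_R in HM. eapply Rle_trans; [|apply Rmax_l]. lra.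
Qed.

Lemma bounded_v f a b x : a <= b -> (forall y, a <= y <= b -> ccont f (x, y)) ->
  exists M, 0 < M /\ forall y, a <= y <= b -> Cmod (f (x, y)) <= M.
Proof.
  intros Hab H.
  destruct (bounded_continuity (V := C_R_NormedModule) (fun s : R => f (x, s)) a b) as [M HM].
  { intros y Hy. apply ccont_RCcont_v. auto. }
  exists (Rmax M 1). split. eapply Rlt_le_trans; [|apply Rmax_r]; lra.
  intros y Hy. specialize (HM y Hy). rewrite norm_C_R in HM. eapply Rle_trans; [|apply Rmax_l]. lra.
Qed.

Lemma bounded_bdry f a b c d : a <= b -> c <= d ->
  (forall x y, a <= x <= b -> c <= y <= d -> x = a \/ x = b \/ y = c \/ y = d -> ccont f (x, y)) ->
  exists M, 0 < M /\ forall x y, a <= x <= b -> c <= y <= d ->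
    x = a \/ x = b \/ y = c \/ y = d -> Cmod (f (x, y)) <= M.
Proof.
  intros Hab Hcd H.
  destruct (bounded_h f a b c) as [M1 [P1 H1]]; auto. { intros; apply H; (lra || auto). }
  destruct (bounded_h f a b d) as [M2 [P2 H2]]; auto. { intros; apply H; (lra || auto). }
  destruct (bounded_v f c d a) as [M3 [P3 H3]]; auto. { intros; apply H; (lra || auto). }
  destruct (bounded_v f c d b) as [M4 [P4 H4]]; auto. { intros; apply H; (lra || auto). }
  exists (M1 + M2 + M3 + M4). split; [lra|].
  intros x y Hx Hy [ -> | [ -> | [ -> | -> ]]].
  - specialize (H3 y Hy); lra.
  - specialize (H4 y Hy); lra.
  - specialize (H1 x Hx); lra.
  - specialize (H2 x Hx); lra.
Qed.

(** At a simple zero of D the residue of g P / D is g P / D'. Of g and P only continuity is used,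
    which matches a numerator known merely as a uniform limit. *)
Lemma residue_quotient (P D g : C -> C) (z0 d0 : C) :
  ccont P z0 -> ccont g z0 -> is_cderiv D z0 d0 -> D z0 = RtoC 0 -> d0 <> RtoC 0 ->
  forall eps, 0 < eps -> exists r, 0 < r /\ forall w, w <> z0 -> Cmod (w - z0)%C < r ->
     Cmod (g w * (P w / D w) * (w - z0) - g z0 * (P z0 / d0))%C <= eps.
Proof.
  intros HP Hg HD HD0 Hd0 eps He.
  assert (Hm : 0 < Cmod d0) by now apply Cmod_gt_0.
  assert (HQ := ccont_mult g P z0 Hg HP).
  set (Q := fun w => (g w * P w)%C) in *.
  set (m := Cmod d0) in *. set (q := Cmod (Q z0)).
  assert (Hq : 0 <= q) by apply Cmod_ge_0.
  set (e1 := eps * m / 4). assert (He1 : 0 < e1) by (unfold e1; nra).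
  destruct (HQ e1 He1) as [r1 [Hr1 H1]].
  (* The bound m / 2 gives |D w| >= (m / 2) k, so dividing by D costs a factor 2 / m. The second
     bound makes the error from linearising D at most eps / 2; q + 1 allows for q = 0. *)
  set (e2 := Rmin (m / 2) (eps * m * m / (4 * (q + 1)))).
  assert (He2 : 0 < e2). { apply Rmin_pos; [lra|]. apply Rdiv_lt_0_compat; [apply Rmult_lt_0_compat; nra|lra]. }
  destruct (HD e2 He2) as [r2 [Hr2 H2]].
  exists (Rmin r1 r2). split; [now apply Rmin_pos|]. intros w Hw0 Hw.
  specialize (H1 w (Rlt_le_trans _ _ _ Hw (Rmin_l _ _))).
  specialize (H2 w (Rlt_le_trans _ _ _ Hw (Rmin_r _ _))).
  rewrite HD0 in H2. replace (D w - 0 - d0 * (w - z0))%C with (D w - d0 * (w - z0))%C in H2 by ring.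
  assert (Hwz : (w - z0)%C <> RtoC 0).
  { intros E. apply Hw0. replace w with (w - z0 + z0)%C by ring. rewrite E. ring. }
  set (k := Cmod (w - z0)) in *. assert (Hk : 0 < k) by now apply Cmod_gt_0.
  assert (He2' : e2 <= m / 2) by apply Rmin_l.
  assert (He2'' : e2 * (q + 1) <= eps * m * m / 4).
  { apply Rle_trans with (eps * m * m / (4 * (q + 1)) * (q + 1)).
    apply Rmult_le_compat_r; [lra|apply Rmin_r]. right. field. lra. }
  assert (HDw : m / 2 * k <= Cmod (D w)).
  { replace (D w) with (d0 * (w - z0) + (D w - d0 * (w - z0)))%C by ring.
    eapply Rle_trans; [|apply Cmod_ge_minus]. rewrite Cmod_mult. fold m k. assert (e2 * k <= m / 2 * k) by (apply Rmult_le_compat_r; lra). lra. }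
  assert (HDw0 : D w <> RtoC 0) by (apply Cmod_gt_0; nra).
  replace (g w * (P w / D w) * (w - z0) - g z0 * (P z0 / d0))%C
    with (((Q w - Q z0) * (w - z0)) / D w - Q z0 * (D w - d0 * (w - z0)) / (d0 * D w))%C
    by (unfold Q; field; auto).
  eapply Rle_trans. apply Cmod_minus_le.
  rewrite !Cmod_div by (try apply Cmult_neq_0; auto). rewrite !Cmod_mult. fold m k q.
  assert (HDp : 0 < Cmod (D w)) by nra.
  assert (A1 : Cmod (Q w - Q z0) * k / Cmod (D w) <= eps / 2).
  { apply Rle_div_l; auto. unfold e1 in H1.
    assert (0 <= eps * (Cmod (D w) - m / 2 * k)) by (apply Rmult_le_pos; lra).
    assert (Cmod (Q w - Q z0) * k <= eps * m / 4 * k) by (apply Rmult_le_compat_r; lra). lra. }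
  assert (A2 : q * Cmod (D w - d0 * (w - z0)) / (m * Cmod (D w)) <= eps / 2).
  { apply Rle_div_l; [nra|].
    assert (q * Cmod (D w - d0 * (w - z0)) <= (q + 1) * (e2 * k)).
    { apply Rmult_le_compat; auto using Cmod_ge_0; lra. }
    assert (e2 * (q + 1) * k <= eps * m * m / 4 * k) by (apply Rmult_le_compat_r; lra).
    assert (0 <= eps * m * (Cmod (D w) - m / 2 * k)) by (apply Rmult_le_pos; [nra|lra]).
    lra. }
  lra.
Qed.

(* The factor [g] is only a uniform limit of holomorphic functions, which spares
   proving that a locally uniform limit is again holomorphic. *)
Theorem residue_rect_lim (P D : C -> C) (gN : nat -> C -> C) (g : C -> C) (z0 d0 : C) a b c d :
  a < fst z0 < b -> c < snd z0 < d ->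
  (forall x y, a <= x <= b -> c <= y <= d -> cdiff P (x, y) /\ cdiff D (x, y)) ->
  (forall x y, a <= x <= b -> c <= y <= d -> (x, y) <> z0 -> D (x, y) <> RtoC 0) ->
  is_cderiv D z0 d0 -> D z0 = RtoC 0 -> d0 <> RtoC 0 ->
  (forall n x y, a <= x <= b -> c <= y <= d -> cdiff (gN n) (x, y)) ->
  (forall x y, a <= x <= b -> c <= y <= d -> ccont g (x, y)) ->
  (forall eps, 0 < eps -> exists N, forall n x y, (N <= n)%nat -> a <= x <= b -> c <= y <= d ->
     Cmod (gN n (x, y) - g (x, y))%C <= eps) ->
  rect_int (fun z => g z * (P z / D z))%C a b c d = (RtoC (2 * PI) * Ci * (g z0 * (P z0 / d0)))%C.
Proof.
  intros Hx0 Hy0 HPD HD0 Hd HDz Hd0 HgN Hg Hlim.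
  destruct z0 as [x0 y0]. simpl in Hx0, Hy0.
  assert (HK : forall x y, a <= x <= b -> c <= y <= d -> x = a \/ x = b \/ y = c \/ y = d ->
    cdiff (fun z => P z / D z)%C (x, y)).
  { intros x y Hx Hy Hb. destruct (HPD x y Hx Hy). apply cdiff_div; auto. apply HD0; auto.
    intros E; injection E; lra. }
  assert (HN : forall n, rect_int (fun z => gN n z * (P z / D z))%C a b c d =
    (RtoC (2 * PI) * Ci * (gN n (x0, y0) * (P (x0, y0) / d0)))%C).
  { intros n. apply residue_rect with (x0, y0); auto.
    - intros x y Hx Hy Hne. destruct (HPD x y Hx Hy). apply cdiff_mult; auto. apply cdiff_div; auto.
    - destruct (HPD x0 y0); try lra. apply residue_quotient; auto; apply cdiff_ccont; auto.
      apply HgN; lra. }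
  assert (Hex : forall u, (forall x y, a <= x <= b -> c <= y <= d -> ccont u (x, y)) ->
    ex_rect_int (fun z => u z * (P z / D z))%C a b c d).
  { intros u Hu. apply exB_cont; try lra. intros x y Hx Hy Hb. apply ccont_mult; auto.
    apply cdiff_ccont, HK; auto. }
  (* The limit is only taken on the boundary, away from the pole, where the quotient is bounded. *)
  destruct (bounded_bdry (fun z => P z / D z)%C a b c d) as [M [HM HMb]]; try lra.
  { intros; apply cdiff_ccont, HK; auto. }
  apply Cmod_small_eq. intros eps He.
  destruct (rect_int_lim (fun n z => gN n z * (P z / D z))%C (fun z => g z * (P z / D z))%C a b c d)
    with (eps := eps / 2) as [N1 HN1]; try lra.
  { intros n. apply Hex. intros; apply cdiff_ccont; auto. }
  { apply Hex; auto. }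
  { intros e Hepos. destruct (Hlim (e / M)) as [N HN']. now apply Rdiv_lt_0_compat.
    exists N. intros n x y Hn Hx Hy Hb.
    replace (gN n (x, y) * (P (x, y) / D (x, y)) - g (x, y) * (P (x, y) / D (x, y)))%C
      with ((gN n (x, y) - g (x, y)) * (P (x, y) / D (x, y)))%C by ring.
    rewrite Cmod_mult. replace e with (e / M * M) by (field; lra).
    apply Rmult_le_compat; auto using Cmod_ge_0. }
  set (B := Cmod (RtoC (2 * PI) * Ci * (P (x0, y0) / d0))%C + 1).
  assert (HB : 0 < B). { unfold B. assert (X := Cmod_ge_0 (RtoC (2 * PI) * Ci * (P (x0, y0) / d0))%C). lra. }
  destruct (Hlim (eps / 2 / B)) as [N2 HN2]. { apply Rdiv_lt_0_compat; lra. }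
  set (n := max N1 N2).
  specialize (HN1 n (Nat.le_max_l _ _)). rewrite HN in HN1.
  assert (HN2' : Cmod (gN n (x0, y0) - g (x0, y0))%C <= eps / 2 / B).
  { apply HN2; [apply Nat.le_max_r|lra|lra]. }
  set (X := rect_int (fun z => g z * (P z / D z))%C a b c d) in *.
  replace (X - RtoC (2 * PI) * Ci * (g (x0, y0) * (P (x0, y0) / d0)))%C
    with (- (RtoC (2 * PI) * Ci * (gN n (x0, y0) * (P (x0, y0) / d0)) - X)
      + (gN n (x0, y0) - g (x0, y0)) * (RtoC (2 * PI) * Ci * (P (x0, y0) / d0)))%C by ring.
  eapply Rle_trans. apply Cmod_triangle. rewrite Cmod_opp, Cmod_mult.
  assert (Cmod (gN n (x0, y0) - g (x0, y0)) * Cmod (RtoC (2 * PI) * Ci * (P (x0, y0) / d0)) <= eps / 2 / B * B).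
  { apply Rmult_le_compat; auto using Cmod_ge_0. unfold B. lra. }
  replace (eps / 2 / B * B) with (eps / 2) in H by (field; lra). lra.
Qed.

(** * Complex sequences and series *)

Definition cvC (u : nat -> C) (l : C) : Prop :=
  forall eps, 0 < eps -> exists N, forall n, (N <= n)%nat -> Cmod (u n - l)%C <= eps.

(** This has n terms, whereas [sum_n a n] has n + 1. The empty sum at 0 lets a remainder bound after
    0 terms serve as a bound for the whole series. *)
Fixpoint csum (a : nat -> C) (n : nat) : C :=
  match n with O => RtoC 0 | S m => (csum a m + a m)%C end.

Lemma cvC_unique u l m : cvC u l -> cvC u m -> l = m.
Proof.
  intros H K. apply Cmod_small_eq. intros eps He.
  destruct (H (eps / 2)) as [N1 H1]; [lra|]. destruct (K (eps / 2)) as [N2 H2]; [lra|].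
  specialize (H1 (max N1 N2) (Nat.le_max_l _ _)). specialize (H2 (max N1 N2) (Nat.le_max_r _ _)).
  replace (l - m)%C with ((u (max N1 N2) - m) - (u (max N1 N2) - l))%C by ring.
  eapply Rle_trans. apply Cmod_minus_le. lra.
Qed.

Lemma cvC_ext u v l : (forall n, u n = v n) -> cvC u l -> cvC v l.
Proof. intros H K eps He. destruct (K eps He) as [N HN]. exists N. intros n Hn. rewrite <- H. auto. Qed.

Lemma cvC_const c : cvC (fun _ => c) c.
Proof. intros eps He. exists 0%nat. intros. replace (c - c)%C with (RtoC 0) by ring. rewrite Cmod_0; lra. Qed.

Lemma cvC_plus u v l m : cvC u l -> cvC v m -> cvC (fun n => u n + v n)%C (l + m)%C.
Proof.
  intros H K eps He. destruct (H (eps / 2)) as [N1 H1]; [lra|]. destruct (K (eps / 2)) as [N2 H2]; [lra|].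
  exists (max N1 N2). intros n Hn. specialize (H1 n ltac:(lia)). specialize (H2 n ltac:(lia)).
  replace (u n + v n - (l + m))%C with ((u n - l) + (v n - m))%C by ring.
  eapply Rle_trans. apply Cmod_triangle. lra.
Qed.

Lemma cvC_scal c u l : cvC u l -> cvC (fun n => c * u n)%C (c * l)%C.
Proof.
  intros H eps He. assert (X := Cmod_ge_0 c). destruct (H (eps / (Cmod c + 1))) as [N HN].
  apply Rdiv_lt_0_compat; lra.
  exists N. intros n Hn. replace (c * u n - c * l)%C with (c * (u n - l))%C by ring.
  rewrite Cmod_mult. specialize (HN n Hn).
  apply Rle_trans with ((Cmod c + 1) * (eps / (Cmod c + 1))).
  apply Rmult_le_compat; auto using Cmod_ge_0; lra. right. field. lra.
Qed.

Lemma cvC_Un_cv u l : cvC u l <-> Un_cv (fun n => Re (u n)) (Re l) /\ Un_cv (fun n => Im (u n)) (Im l).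
Proof.
  split.
  - intros H. split; intros eps He; destruct (H (eps / 2)) as [N HN]; try lra; exists N; intros n Hn;
    specialize (HN n Hn); unfold Rdist.
    + change (Re (u n) - Re l) with (Re (u n - l)%C). assert (X := re_le_Cmod (u n - l)%C). lra.
    + change (Im (u n) - Im l) with (Im (u n - l)%C). assert (X := im_le_Cmod (u n - l)%C). lra.
  - intros [H K] eps He. destruct (H (eps / 2)) as [N1 H1]; [lra|]. destruct (K (eps / 2)) as [N2 H2]; [lra|].
    exists (max N1 N2). intros n Hn. specialize (H1 n ltac:(lia)). specialize (H2 n ltac:(lia)).
    unfold Rdist in *. eapply Rle_trans. apply Cmod_le_abs.
    change (Re (u n) - Re l) with (Re (u n - l)%C) in H1.
    change (Im (u n) - Im l) with (Im (u n - l)%C) in H2. lra.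
Qed.

Lemma cvC_cauchy u : (forall eps, 0 < eps -> exists N, forall n m, (N <= n)%nat -> (n <= m)%nat ->
  Cmod (u m - u n)%C <= eps) -> exists l, cvC u l.
Proof.
  intros H.
  assert (HC : forall n m N eps, (forall n m, (N <= n)%nat -> (n <= m)%nat -> Cmod (u m - u n)%C <= eps) ->
    (N <= n)%nat -> (N <= m)%nat -> Cmod (u n - u m)%C <= eps).
  { intros n m N eps K Hn Hm. destruct (Compare_dec.le_dec n m). rewrite Cmod_minus_sym. apply K; lia. apply K; lia. }
  destruct (Rcomplete.R_complete (fun n => Re (u n))) as [x Hx].
  { intros eps He. destruct (H (eps / 2)) as [N HN]; [lra|]. exists N. intros n m Hn Hm.
    unfold Rdist. change (Re (u n) - Re (u m)) with (Re (u n - u m)%C).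
    assert (X := re_le_Cmod (u n - u m)%C). assert (Y := HC n m N _ HN Hn Hm). lra. }
  destruct (Rcomplete.R_complete (fun n => Im (u n))) as [y Hy].
  { intros eps He. destruct (H (eps / 2)) as [N HN]; [lra|]. exists N. intros n m Hn Hm.
    unfold Rdist. change (Im (u n) - Im (u m)) with (Im (u n - u m)%C).
    assert (X := im_le_Cmod (u n - u m)%C). assert (Y := HC n m N _ HN Hn Hm). lra. }
  exists (x, y). now apply cvC_Un_cv.
Qed.

Lemma sum_n_csum_Re a n : sum_n (fun k => Re (a k)) n = Re (csum a (S n)).
Proof.
  induction n. rewrite sum_O. simpl. unfold Re, Im. ring.
  rewrite sum_Sn, IHn. reflexivity.
Qed.

Lemma sum_n_csum_Im a n : sum_n (fun k => Im (a k)) n = Im (csum a (S n)).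
Proof.
  induction n. rewrite sum_O. simpl. unfold Re, Im. ring.
  rewrite sum_Sn, IHn. reflexivity.
Qed.

Lemma CSeries_unique a l : cvC (csum a) l -> CSeries a = l.
Proof.
  intros H. apply cvC_Un_cv in H. destruct H as [H K].
  apply is_lim_seq_Reals in H. apply is_lim_seq_Reals in K.
  destruct l as [x y]. unfold CSeries. f_equal.
  - apply is_series_unique. apply (is_lim_seq_ext (fun n => Re (csum a (S n))) _ (Finite x)).
    intros; now rewrite sum_n_csum_Re. apply (is_lim_seq_incr_1 (fun n => Re (csum a n))). exact H.
  - apply is_series_unique. apply (is_lim_seq_ext (fun n => Im (csum a (S n))) _ (Finite y)).
    intros; now rewrite sum_n_csum_Im. apply (is_lim_seq_incr_1 (fun n => Im (csum a n))). exact K.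
Qed.

Lemma tele_bound (a : nat -> C) (A : nat -> R) n k :
  (forall n, Cmod (a n) <= A n - A (S n)) -> Cmod (csum a (n + k) - csum a n)%C <= A n - A (n + k)%nat.
Proof.
  intros H. induction k.
  - rewrite Nat.add_0_r. replace (csum a n - csum a n)%C with (RtoC 0) by ring. rewrite Cmod_0; lra.
  - rewrite Nat.add_succ_r. simpl.
    replace (csum a (n + k) + a (n + k)%nat - csum a n)%C
      with ((csum a (n + k) - csum a n) + a (n + k)%nat)%C by ring.
    eapply Rle_trans. apply Cmod_triangle. specialize (H (n + k)%nat). lra.
Qed.

(* A Weierstrass test whose majorant is the telescoping series [A n - A (S n)],
   so that [A] itself bounds the remainders. *)
Lemma tele_series (a : nat -> C) (A : nat -> R) :
  (forall n, Cmod (a n) <= A n - A (S n)) -> Un_cv A 0 ->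
  cvC (csum a) (CSeries a) /\ forall n, Cmod (csum a n - CSeries a)%C <= A n.
Proof.
  intros H HA.
  (* [A] is nonincreasing because moduli are nonnegative, and it tends to 0. *)
  assert (Hpos : forall n, 0 <= A n).
  { intros n. apply Rnot_lt_le. intros Hn. destruct (HA (- A n)) as [N HN]; [lra|].
    specialize (HN (max N n) ltac:(lia)). unfold Rdist in HN.
    assert (X := tele_bound a A n (max N n - n) H).
    replace (n + (max N n - n))%nat with (max N n) in X by lia.
    assert (Y := Cmod_ge_0 (csum a (max N n) - csum a n)%C).
    rewrite Rabs_left in HN; lra. }
  assert (Hex : exists l, cvC (csum a) l).
  { apply cvC_cauchy. intros eps He. destruct (HA eps He) as [N HN]. exists N. intros n m Hn Hm.
    assert (X := tele_bound a A n (m - n) H). replace (n + (m - n))%nat with m in X by lia.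
    specialize (HN n Hn). unfold Rdist in HN. rewrite Rabs_pos_eq in HN by (specialize (Hpos n); lra).
    specialize (Hpos m). lra. }
  destruct Hex as [l Hl]. rewrite (CSeries_unique a l Hl). split; auto.
  intros n. rewrite Cmod_minus_sym.
  apply le_epsilon. intros eps He. destruct (Hl eps He) as [N HN].
  set (m := max N n). specialize (HN m ltac:(lia)).
  assert (X := tele_bound a A n (m - n) H). replace (n + (m - n))%nat with m in X by lia.
  replace (l - csum a n)%C with ((csum a m - csum a n) - (csum a m - l))%C by ring.
  eapply Rle_trans. apply Cmod_minus_le. specialize (Hpos m). lra.
Qed.

Lemma csum_scal c a n : csum (fun k => c * a k)%C n = (c * csum a n)%C.
Proof. induction n; simpl. ring. rewrite IHn. ring. Qed.

Lemma csum_ext a b n : (forall k, a k = b k) -> csum a n = csum b n.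
Proof. intros H. induction n; simpl; auto. now rewrite IHn, H. Qed.

Lemma cdiff_csum (a : nat -> C -> C) n z : (forall k, cdiff (a k) z) -> cdiff (fun w => csum (fun k => a k w) n) z.
Proof.
  intros H. induction n; simpl. apply cdiff_const. apply cdiff_plus; auto.
Qed.

Lemma ccont_unif (gN : nat -> C -> C) g z r : 0 < r ->
  (forall n, ccont (gN n) z) ->
  (forall eps, 0 < eps -> exists n, forall w, Cmod (w - z)%C < r -> Cmod (gN n w - g w)%C <= eps) ->
  ccont g z.
Proof.
  intros Hr Hc Hu eps He. destruct (Hu (eps / 4)) as [n Hn]; [lra|].
  destruct (Hc n (eps / 4)) as [d [Hd Hd']]; [lra|].
  exists (Rmin r d). split; [now apply Rmin_pos|]. intros w Hw.
  assert (H1 := Hn w (Rlt_le_trans _ _ _ Hw (Rmin_l _ _))).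
  assert (H2 := Hd' w (Rlt_le_trans _ _ _ Hw (Rmin_r _ _))).
  assert (H3 : Cmod (gN n z - g z)%C <= eps / 4).
  { apply Hn. replace (z - z)%C with (RtoC 0) by ring. now rewrite Cmod_0. }
  replace (g w - g z)%C with ((gN n w - gN n z) + ((gN n z - g z) - (gN n w - g w)))%C by ring.
  eapply Rle_lt_trans. apply Cmod_triangle.
  assert (X := Cmod_minus_le (gN n z - g z)%C (gN n w - g w)%C). lra.
Qed.

(** * Improper integrals over the real line *)

(** The two ends are independent, and integrability on every segment is built in, so that linear
    operations and substitutions need no side conditions. [improper_CGamma] and [improper_RInt_gen]
    connect this to the filters in the definitions of Gamma and [U]. *)
Definition improper (f : R -> C) (l : C) : Prop :=
  (forall a b, exCI f a b) /\
  forall eps, 0 < eps -> exists T, 0 < T /\ forall a b, a <= - T -> T <= b ->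
    Cmod (CI f a b - l)%C <= eps.

Lemma improper_unique f l m : improper f l -> improper f m -> l = m.
Proof.
  intros [_ H] [_ K]. apply Cmod_small_eq. intros eps He.
  destruct (H (eps / 2)) as [T1 [P1 H1]]; [lra|]. destruct (K (eps / 2)) as [T2 [P2 H2]]; [lra|].
  set (T := Rmax T1 T2). assert (T1 <= T) by apply Rmax_l. assert (T2 <= T) by apply Rmax_r.
  specialize (H1 (- T) T ltac:(lra) ltac:(lra)). specialize (H2 (- T) T ltac:(lra) ltac:(lra)).
  replace (l - m)%C with ((CI f (- T) T - m) - (CI f (- T) T - l))%C by ring.
  eapply Rle_trans. apply Cmod_minus_le. lra.
Qed.

Lemma improper_ext f g l : (forall x, f x = g x) -> improper f l -> improper g l.
Proof.
  intros Hfg [E H].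
  assert (Ei : forall a b, CI g a b = CI f a b).
  { intros a b. apply CI_unique. apply isCI_ext with f; auto. now apply CI_correct. }
  split.
  - intros a b. exists (CI f a b). apply isCI_ext with f; auto. now apply CI_correct.
  - intros eps He. destruct (H eps He) as [T [HT K]]. exists T. split; auto.
    intros a b Ha Hb. rewrite Ei. auto.
Qed.

Lemma improper_minus f g l m : improper f l -> improper g m -> improper (fun x => f x - g x)%C (l - m)%C.
Proof.
  intros [E1 H1] [E2 H2]. split.
  - intros a b. eexists. apply isCI_minus; apply CI_correct; auto.
  - intros eps He. destruct (H1 (eps / 2)) as [T1 [P1 K1]]; [lra|].
    destruct (H2 (eps / 2)) as [T2 [P2 K2]]; [lra|].
    assert (T1 <= Rmax T1 T2) by apply Rmax_l. assert (T2 <= Rmax T1 T2) by apply Rmax_r.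
    exists (Rmax T1 T2). split; [lra|]. intros a b Ha Hb.
    specialize (K1 a b ltac:(lra) ltac:(lra)). specialize (K2 a b ltac:(lra) ltac:(lra)).
    rewrite CI_minus by auto.
    replace (CI f a b - CI g a b - (l - m))%C with ((CI f a b - l) - (CI g a b - m))%C by ring.
    eapply Rle_trans. apply Cmod_minus_le. lra.
Qed.

Lemma improper_scal c f l : improper f l -> improper (fun x => c * f x)%C (c * l)%C.
Proof.
  intros [E H]. split.
  - intros a b. eexists. apply isCI_scal; apply CI_correct; auto.
  - intros eps He. assert (X := Cmod_ge_0 c). destruct (H (eps / (Cmod c + 1))) as [T [P K]].
    apply Rdiv_lt_0_compat; lra.
    exists T. split; auto. intros a b Ha Hb. rewrite CI_scal by auto.
    replace (c * CI f a b - c * l)%C with (c * (CI f a b - l))%C by ring.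
    rewrite Cmod_mult. specialize (K a b Ha Hb).
    apply Rle_trans with ((Cmod c + 1) * (eps / (Cmod c + 1))).
    apply Rmult_le_compat; auto using Cmod_ge_0; lra. right. field. lra.
Qed.

Lemma improper_0 : improper (fun _ => RtoC 0) (RtoC 0).
Proof.
  split. intros; eexists; apply isCI_const. intros eps He. exists 1. split; [lra|]. intros a b _ _.
  rewrite (CI_unique _ _ _ _ (isCI_const (RtoC 0) a b)).
  replace (RtoC (b - a) * 0 - 0)%C with (RtoC 0) by ring. rewrite Cmod_0; lra.
Qed.

Lemma improper_plus f g l m : improper f l -> improper g m -> improper (fun x => f x + g x)%C (l + m)%C.
Proof.
  intros H K. apply improper_ext with (fun x => f x - (- RtoC 1) * g x)%C. intros; ring.
  replace (l + m)%C with (l - (- RtoC 1) * m)%C by ring.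
  apply improper_minus; auto. now apply improper_scal.
Qed.

Lemma improper_csum (f : nat -> R -> C) (l : nat -> C) n : (forall k, improper (f k) (l k)) ->
  improper (fun x => csum (fun k => f k x) n) (csum l n).
Proof. intros H. induction n; simpl. apply improper_0. now apply improper_plus. Qed.

Lemma improper_conj f l : improper f l -> improper (fun x => Cconj (f x)) (Cconj l).
Proof.
  intros [E H]. split.
  - intros a b. eexists. apply isCI_conj, CI_correct; auto.
  - intros eps He. destruct (H eps He) as [T [P K]]. exists T. split; auto. intros a b Ha Hb.
    rewrite (CI_unique _ _ _ _ (isCI_conj _ _ _ _ (CI_correct f a b (E a b)))).
    rewrite <- Cminus_conj, Cmod_conj. auto.
Qed.

Lemma isCI_lin f k v a b l : isCI f (k * a + v) (k * b + v) l ->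
  isCI (fun y => RtoC k * f (k * y + v)%R)%C a b l.
Proof.
  intros H. apply (is_RInt_comp_lin (V := C_R_NormedModule)) in H.
  eapply isCI_ext; [|apply H]. intros x _.
  apply injective_projections; simpl; unfold scal; simpl; unfold mult; simpl; ring.
Qed.

Lemma improper_shift f k l : improper f l -> improper (fun x => f (x + k)) l.
Proof.
  intros [E H].
  assert (K : forall a b, isCI (fun x => f (x + k)) a b (CI f (1 * a + k) (1 * b + k))).
  { intros a b. eapply isCI_ext; [|apply isCI_lin, CI_correct, E].
    intros x _. simpl. rewrite Rmult_1_l. ring. }
  split.
  - intros a b. eexists; apply K.
  - intros eps He. destruct (H eps He) as [T [P Q]]. exists (T + Rabs k).
    assert (X := Rabs_pos k). split; [lra|]. intros a b Ha Hb.
    rewrite (CI_unique _ _ _ _ (K a b)). assert (Y := Rle_abs k). assert (Z := Rle_abs (- k)).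
    rewrite Rabs_Ropp in Z. apply Q; lra.
Qed.

Lemma improper_scale f k l : 0 < k -> improper f l -> improper (fun x => RtoC k * f (k * x)%R)%C l.
Proof.
  intros Hk [E H].
  assert (K : forall a b, isCI (fun x => RtoC k * f (k * x)%R)%C a b (CI f (k * a + 0) (k * b + 0))).
  { intros a b. eapply isCI_ext; [|apply isCI_lin, CI_correct, E].
    intros x _. simpl. now rewrite Rplus_0_r. }
  split.
  - intros a b. eexists; apply K.
  - intros eps He. destruct (H eps He) as [T [P Q]]. exists (T / k).
    split; [now apply Rdiv_lt_0_compat|]. intros a b Ha Hb.
    rewrite (CI_unique _ _ _ _ (K a b)).
    apply Rmult_le_compat_l with (r := k) in Ha; [|lra]. apply Rmult_le_compat_l with (r := k) in Hb; [|lra].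
    replace (k * - (T / k)) with (- T) in Ha by (field; lra).
    replace (k * (T / k)) with T in Hb by (field; lra). apply Q; lra.
Qed.

Lemma isCI_reflect f a b : exCI f (- a) (- b) -> isCI (fun x => f (- x)) a b (CI f (- b) (- a)).
Proof.
  intros E. assert (X := CI_correct _ _ _ E).
  apply (is_RInt_comp_opp (V := C_R_NormedModule)) in X.
  apply (is_RInt_opp (V := C_R_NormedModule)) in X.
  replace (CI f (- b) (- a)) with (opp (CI f (- a) (- b)) : C).
  - eapply isCI_ext; [|apply X]. intros x _. apply (opp_opp (G := C_R_NormedModule)).
  - symmetry. apply CI_unique. apply (is_RInt_swap (V := C_R_NormedModule)). now apply CI_correct.
Qed.

Lemma improper_reflect f l : improper f l -> improper (fun x => f (- x)) l.
Proof.
  intros [E H].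
  assert (K : forall a b, isCI (fun x => f (- x)) a b (CI f (- b) (- a))) by (intros; now apply isCI_reflect).
  split.
  - intros a b. eexists; apply K.
  - intros eps He. destruct (H eps He) as [T [P Q]]. exists T. split; auto. intros a b Ha Hb.
    rewrite (CI_unique _ _ _ _ (K a b)). apply Q; lra.
Qed.

Lemma improper_le f g l m : (forall x, Cmod (f x) <= g x) ->
  improper f l -> improper (fun x => RtoC (g x)) m -> Cmod l <= Re m.
Proof.
  intros Hfg [E H] [E' H']. apply le_epsilon. intros eps He.
  destruct (H (eps / 2)) as [T1 [P1 K1]]; [lra|].
  destruct (H' (eps / 2)) as [T2 [P2 K2]]; [lra|].
  set (T := Rmax T1 T2).
  assert (T1 <= T) by apply Rmax_l. assert (T2 <= T) by apply Rmax_r.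
  specialize (K1 (- T) T ltac:(lra) ltac:(lra)). specialize (K2 (- T) T ltac:(lra) ltac:(lra)).
  assert (B : Cmod (CI f (- T) T) <= Re (CI (fun x => RtoC (g x)) (- T) T)).
  { apply (isCI_Cmod_le f g (- T) T); auto. lra. apply CI_correct; auto.
    apply (isCI_Re (fun x => RtoC (g x))). apply CI_correct; auto. }
  assert (R1 := re_le_Cmod (CI (fun x => RtoC (g x)) (- T) T - m)%C).
  change (Re (CI (fun x => RtoC (g x)) (- T) T - m)%C)
    with (Re (CI (fun x => RtoC (g x)) (- T) T) - Re m) in R1.
  assert (R2 := Rle_abs (Re (CI (fun x => RtoC (g x)) (- T) T) - Re m)).
  replace l with (CI f (- T) T - (CI f (- T) T - l))%C by ring.
  eapply Rle_trans. apply Cmod_minus_le. lra.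
Qed.

Lemma exp_tail f K c T b : 0 < c -> 0 <= T <= b -> exCI f T b -> 0 <= K ->
  (forall x, Cmod (f x) <= K * exp (- (c * Rabs x))) -> Cmod (CI f T b) <= K / c * exp (- (c * T)).
Proof.
  intros Hc HT E HK H.
  apply Rle_trans with (minus (- K / c * exp (- (c * b))) (- K / c * exp (- (c * T)))).
  - apply (isCI_Cmod_le f (fun x => K * exp (- (c * x))) T b); try lra.
    + intros x Hx. eapply Rle_trans. apply H. rewrite Rabs_pos_eq by lra. lra.
    + now apply CI_correct.
    + apply (is_RInt_derive (V := R_CompleteNormedModule) (fun x => - K / c * exp (- (c * x)))).
      * intros x _. auto_derive. auto. field. lra.
      * intros x _. apply (ex_derive_continuous (V := R_NormedModule)). auto_derive. auto.
  - unfold minus, plus, opp; simpl. assert (X := exp_pos (- (c * b))).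
    assert (0 <= K / c) by (apply Rmult_le_pos; [auto|left; now apply Rinv_0_lt_compat]).
    replace (- K / c) with (- (K / c)) by (field; lra). nra.
Qed.

Lemma exp_small c D eps : 0 < c -> 0 < eps -> exists T, 0 < T /\ forall x, T <= x -> D * exp (- (c * x)) <= eps.
Proof.
  intros Hc He. set (T := (Rabs D + 1) / (c * eps)).
  assert (HD := Rabs_pos D). assert (HT : 0 < T) by (apply Rdiv_lt_0_compat; nra).
  exists T. split; auto. intros x Hx.
  assert (H1 : c * x < exp (c * x)) by (assert (0 < c * x) by nra; assert (Y := exp_ineq1 (c * x) ltac:(lra)); lra).
  rewrite exp_Ropp. assert (Hp := exp_pos (c * x)).
  apply Rle_trans with (Rabs D * / exp (c * x)).
  apply Rmult_le_compat_r; [left; now apply Rinv_0_lt_compat|apply Rle_abs].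
  apply Rle_div_l; auto.
  assert (c * T * eps <= c * x * eps) by (apply Rmult_le_compat_r; [lra|]; apply Rmult_le_compat_l; lra).
  assert (c * T * eps = Rabs D + 1) by (unfold T; field; lra).
  nra.
Qed.

(** The limit is built along the segments [-n, n]; the exponential tail bound then compares any
    segment containing [-T, T] with it. *)
Lemma improper_exists f K c : 0 < c -> (forall x, RCcont f x) ->
  (forall x, Cmod (f x) <= K * exp (- (c * Rabs x))) -> exists l, improper f l.
Proof.
  intros Hc Hf H.
  assert (E : forall a b, exCI f a b) by (intros; apply exCI_cont; auto).
  assert (HK : 0 <= K).
  { specialize (H 0). rewrite Rabs_R0, Rmult_0_r, Ropp_0, exp_0 in H.
    assert (X := Cmod_ge_0 (f 0)). lra. }
  assert (Left : forall T b, 0 <= T <= b -> Cmod (CI f (- b) (- T)) <= K / c * exp (- (c * T))).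
  { intros T b HT. assert (X := isCI_reflect f T b (E _ _)). rewrite <- (CI_unique _ _ _ _ X).
    apply (exp_tail (fun x => f (- x))); auto. eexists; apply X.
    intros x. rewrite <- (Rabs_Ropp x). apply H. }
  assert (Main : forall T a b, 0 <= T -> a <= - T -> T <= b ->
    Cmod (CI f a b - CI f (- T) T)%C <= 2 * (K / c) * exp (- (c * T))).
  { intros T a b HT Ha Hb.
    rewrite <- (CI_Chasles f a (- T) b), <- (CI_Chasles f (- T) T b) by auto.
    replace (CI f a (- T) + (CI f (- T) T + CI f T b) - CI f (- T) T)%C
      with (CI f a (- T) + CI f T b)%C by ring.
    eapply Rle_trans. apply Cmod_triangle.
    assert (X := Left T (- a) ltac:(lra)). rewrite Ropp_involutive in X.
    assert (Y := exp_tail f K c T b Hc ltac:(lra) (E T b) HK H). lra. }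
  destruct (cvC_cauchy (fun n => CI f (- INR n) (INR n))) as [l Hl].
  { intros eps He. destruct (exp_small c (2 * (K / c)) eps Hc He) as [T [HT HTe]].
    destruct (INR_unbounded T) as [N HN]. exists N. intros n m Hn Hm.
    eapply Rle_trans. apply Main. apply pos_INR. apply Ropp_le_contravar, le_INR, Hm. apply le_INR, Hm.
    apply HTe. apply le_INR in Hn. lra. }
  exists l. split; auto. intros eps He.
  destruct (exp_small c (2 * (K / c)) (eps / 4) Hc ltac:(lra)) as [T [HT HTe]].
  exists T. split; auto. intros a b Ha Hb.
  destruct (Hl (eps / 4) ltac:(lra)) as [N1 HN1].
  destruct (INR_unbounded T) as [N2 HN2].
  set (n := max N1 N2). specialize (HN1 n ltac:(lia)).
  assert (Hn : INR N2 <= INR n) by (apply le_INR; lia).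
  specialize (HTe T ltac:(lra)).
  assert (B1 := Main T a b ltac:(lra) Ha Hb).
  assert (B2 := Main T (- INR n) (INR n) ltac:(lra) ltac:(lra) ltac:(lra)).
  replace (CI f a b - l)%C with ((CI f a b - CI f (- T) T) - (CI f (- INR n) (INR n) - CI f (- T) T)
    + (CI f (- INR n) (INR n) - l))%C by ring.
  eapply Rle_trans. apply Cmod_triangle. eapply Rle_trans. apply Rplus_le_compat_r, Cmod_minus_le. lra.
Qed.

(** * The Jacobi theta function *)

Lemma Goursat_lim (gN : nat -> C -> C) g a b c d : a <= b -> c <= d ->
  (forall n x y, a <= x <= b -> c <= y <= d -> cdiff (gN n) (x, y)) ->
  (forall x y, a <= x <= b -> c <= y <= d -> ccont g (x, y)) ->
  (forall eps, 0 < eps -> exists N, forall n x y, (N <= n)%nat -> a <= x <= b -> c <= y <= d ->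
     Cmod (gN n (x, y) - g (x, y))%C <= eps) ->
  rect_int g a b c d = RtoC 0.
Proof.
  intros Hab Hcd HgN Hg Hlim. apply Cmod_small_eq. intros eps He.
  destruct (rect_int_lim gN g a b c d Hab Hcd) with (eps := eps) as [N HN]; auto.
  - intros n. apply exB_cont; auto. intros; apply cdiff_ccont; auto.
  - apply exB_cont; auto.
  - intros e Hepos. destruct (Hlim e Hepos) as [N HN]. exists N. auto.
  - specialize (HN N (Nat.le_refl _)). rewrite (Goursat (gN N)) in HN by auto.
    rewrite Cmod_minus_sym. exact HN.
Qed.

Definition gauss (x : R) (z : C) : C := cexp (RtoC (- (PI * x)) * (z * z))%C.

Lemma cdiff_gauss_shift x (k z : C) : cdiff (fun w => gauss x (w + k)%C) z.
Proof.
  unfold gauss. apply cdiff_cexp. apply cdiff_mult. apply cdiff_const.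
  apply cdiff_mult; apply cdiff_plus; try apply cdiff_id; apply cdiff_const.
Qed.

Lemma Cmod_gauss x s y : Cmod (gauss x (s, y)) = exp (- (PI * x) * (s * s - y * y)).
Proof. unfold gauss. rewrite Cmod_cexp. f_equal. simpl. ring. Qed.

(* [hsum x z] is the sum of [gauss x (z + n)] over all integers [n], with [n] and [-n] paired. *)
Definition hterm (x : R) (n : nat) (z : C) : C :=
  (gauss x (z + RtoC (INR (S n))) + gauss x (z + RtoC (- INR (S n))))%C.

Definition hpart (x : R) (n : nat) (z : C) : C :=
  (gauss x (z + RtoC 0) + csum (fun k => hterm x k z) n)%C.

Definition hsum (x : R) (z : C) : C :=
  (gauss x (z + RtoC 0) + CSeries (fun k => hterm x k z))%C.

(** Tail of a geometric series of ratio q = e^(-pi x). On |Re z| <= 1, |Im z| <= Y the paired term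
    of index n is at most 2 e^(pi x Y^2) q^n, because |s + k| >= n for k = n + 1 or -(n + 1), and
    n^2 >= n. *)
Definition hmaj (x Y : R) (n : nat) : R :=
  2 * exp (PI * x * (Y * Y)) / (1 - exp (- (PI * x))) * exp (- (PI * x)) ^ n.

Lemma PI_mult_pos x : 0 < x -> 0 < PI * x.
Proof. intros. apply Rmult_lt_0_compat; auto. apply PI_RGT_0. Qed.

Lemma exp_neg_lt_1 a : 0 < a -> 0 < exp (- a) < 1.
Proof. intros. split. apply exp_pos. rewrite <- exp_0. apply exp_increasing. lra. Qed.

Lemma Rabs_sq a : Rabs a * Rabs a = a * a.
Proof. rewrite <- Rabs_mult. apply Rabs_pos_eq, Rle_0_sqr. Qed.

Lemma exp_mono a b : a <= b -> exp a <= exp b.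
Proof. intros [H| ->]; [left; now apply exp_increasing|lra]. Qed.

Lemma exp_pow a n : exp a ^ n = exp (INR n * a).
Proof.
  induction n. simpl. now rewrite Rmult_0_l, exp_0.
  rewrite S_INR. simpl. rewrite IHn, <- exp_plus. f_equal. ring.
Qed.

Lemma hterm_le x Y n s y : 0 < x -> Rabs s <= 1 -> Rabs y <= Y ->
  Cmod (hterm x n (s, y)) <= hmaj x Y n - hmaj x Y (S n).
Proof.
  intros Hx Hs Hy. assert (Hp := PI_mult_pos x Hx). destruct (exp_neg_lt_1 _ Hp) as [Hq0 Hq1].
  unfold hmaj. replace (2 * exp (PI * x * (Y * Y)) / (1 - exp (- (PI * x))) * exp (- (PI * x)) ^ n -
    2 * exp (PI * x * (Y * Y)) / (1 - exp (- (PI * x))) * exp (- (PI * x)) ^ S n)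
    with (2 * (exp (PI * x * (Y * Y)) * exp (- (PI * x)) ^ n)) by (simpl; field; lra).
  rewrite exp_pow, <- exp_plus.
  assert (B : forall k, INR n <= Rabs (s + k) ->
    Cmod (gauss x ((s, y) + RtoC k)%C) <= exp (PI * x * (Y * Y) + INR n * - (PI * x))).
  { intros k Hk. replace ((s, y) + RtoC k)%C with ((s + k, y) : C)
      by (apply injective_projections; simpl; ring).
    rewrite Cmod_gauss. apply exp_mono.
    assert (E1 : y * y <= Y * Y).
    { replace (y * y) with (Rabs y * Rabs y) by apply Rabs_sq.
      assert (X := Rabs_pos y). nra. }
    assert (E2 : INR n <= (s + k) * (s + k)).
    { replace ((s + k) * (s + k)) with (Rabs (s + k) * Rabs (s + k)) by apply Rabs_sq.
      destruct n. simpl. assert (X := Rabs_pos (s + k)). nra.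
      assert (X : 1 <= INR (S n)) by (rewrite S_INR; assert (Z := pos_INR n); lra). nra. }
    assert (0 <= PI * x * ((Y * Y - y * y) + ((s + k) * (s + k) - INR n))) by (apply Rmult_le_pos; lra).
    lra. }
  unfold hterm. eapply Rle_trans. apply Cmod_triangle.
  assert (Hn := pos_INR n). apply Rabs_le_between in Hs.
  assert (B1 : INR n <= Rabs (s + INR (S n))).
  { rewrite S_INR. rewrite Rabs_pos_eq; lra. }
  assert (B2 : INR n <= Rabs (s + - INR (S n))).
  { rewrite S_INR. rewrite Rabs_left1; lra. }
  assert (C1 := B _ B1). assert (C2 := B _ B2). lra.
Qed.

Lemma hmaj_cv x Y : 0 < x -> Un_cv (hmaj x Y) 0.
Proof.
  intros Hx. destruct (exp_neg_lt_1 _ (PI_mult_pos x Hx)) as [Hq0 Hq1].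
  apply is_lim_seq_Reals. unfold hmaj.
  replace (Finite 0) with (Rbar_mult (2 * exp (PI * x * (Y * Y)) / (1 - exp (- (PI * x)))) 0)
    by (simpl; f_equal; ring).
  apply is_lim_seq_scal_l. apply is_lim_seq_geom. rewrite Rabs_pos_eq; lra.
Qed.

Lemma hsum_cv x s y : 0 < x -> Rabs s <= 1 -> cvC (fun n => hpart x n (s, y)) (hsum x (s, y)).
Proof.
  intros Hx Hs. apply cvC_plus. apply cvC_const.
  apply (tele_series _ (hmaj x (Rabs y))); [|now apply hmaj_cv].
  intros n. apply hterm_le; auto. lra.
Qed.

Lemma hsum_unif x Y n s y : 0 < x -> Rabs s <= 1 -> Rabs y <= Y ->
  Cmod (hpart x n (s, y) - hsum x (s, y))%C <= hmaj x Y n.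
Proof.
  intros Hx Hs Hy. unfold hpart, hsum.
  replace (gauss x ((s, y) + 0) + csum (fun k : nat => hterm x k (s, y)) n -
    (gauss x ((s, y) + 0) + CSeries (fun k : nat => hterm x k (s, y))))%C
    with (csum (fun k : nat => hterm x k (s, y)) n - CSeries (fun k : nat => hterm x k (s, y)))%C by ring.
  apply (tele_series _ (hmaj x Y)); [|now apply hmaj_cv].
  intros k. apply hterm_le; auto.
Qed.

Lemma hsum_unif_eps x Y : 0 < x -> forall eps, 0 < eps -> exists N, forall n s y, (N <= n)%nat ->
  Rabs s <= 1 -> Rabs y <= Y -> Cmod (hpart x n (s, y) - hsum x (s, y))%C <= eps.
Proof.
  intros Hx eps He. destruct (hmaj_cv x Y Hx eps He) as [N HN]. exists N. intros n s y Hn Hs Hy.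
  eapply Rle_trans. apply (hsum_unif x Y); auto. specialize (HN n Hn). unfold Rdist in HN.
  rewrite Rminus_0_r in HN. assert (X := Rle_abs (hmaj x Y n)). lra.
Qed.

Lemma cdiff_hpart x n z : cdiff (hpart x n) z.
Proof.
  unfold hpart. apply cdiff_plus. apply cdiff_gauss_shift.
  apply cdiff_csum. intros k. apply cdiff_plus; apply cdiff_gauss_shift.
Qed.

(** The uniform bound holds for |Re z| <= 1, which contains the disc of radius 1/2 about any point
    with |Re z| <= 1/2. *)
Lemma ccont_hsum x s y : 0 < x -> Rabs s <= / 2 -> ccont (hsum x) (s, y).
Proof.
  intros Hx Hs. apply (ccont_unif (hpart x) (hsum x) (s, y) (/ 2)). lra.
  - intros n. apply cdiff_ccont, cdiff_hpart.
  - intros eps He. destruct (hsum_unif_eps x (Rabs y + 1) Hx eps He) as [N HN].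
    exists N. intros [s' y'] Hw. apply HN; auto.
    + assert (X := re_le_Cmod ((s', y') - (s, y))%C). simpl in X.
      replace s' with (s' + - s + s) by ring. eapply Rle_trans. apply Rabs_triang. lra.
    + assert (X := im_le_Cmod ((s', y') - (s, y))%C). simpl in X.
      replace y' with (y' + - y + y) by ring. eapply Rle_trans. apply Rabs_triang. lra.
Qed.

(** The partial sum runs over -n, ..., n; shifted by one it runs over -n + 1, ..., n + 1, so only
    the end terms survive. *)
Lemma hpart_shift x n z :
  (hpart x n (z + 1) - hpart x n z = gauss x (z + RtoC (INR (S n))) - gauss x (z + RtoC (- INR n)))%C.
Proof.
  induction n.
  - unfold hpart. simpl. replace (z + 1 + 0)%C with (z + 1)%C by ring.
    rewrite Ropp_0. ring.
  - unfold hpart in *. simpl csum.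
    replace (gauss x (z + 1 + 0) + (csum (fun k => hterm x k (z + 1)) n + hterm x n (z + 1)) -
      (gauss x (z + 0) + (csum (fun k => hterm x k z) n + hterm x n z)))%C
      with ((gauss x (z + 1 + 0) + csum (fun k => hterm x k (z + 1)) n -
        (gauss x (z + 0) + csum (fun k => hterm x k z) n)) + (hterm x n (z + 1) - hterm x n z))%C by ring.
    rewrite IHn. unfold hterm.
    replace (z + 1 + RtoC (INR (S n)))%C with (z + RtoC (INR (S (S n))))%C
      by (rewrite !S_INR, !RtoC_plus; ring).
    replace (z + 1 + RtoC (- INR (S n)))%C with (z + RtoC (- INR n))%C
      by (rewrite !S_INR, !RtoC_opp, !RtoC_plus; ring).
    ring.
Qed.

Lemma gauss_cv_0 x s y : 0 < x -> forall eps, 0 < eps -> exists N, forall n, (N <= n)%nat ->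
  Cmod (gauss x ((s, y) + RtoC (INR n)))%C <= eps /\ Cmod (gauss x ((s, y) + RtoC (- INR n)))%C <= eps.
Proof.
  intros Hx eps He. assert (Hp := PI_mult_pos x Hx).
  destruct (exp_small (PI * x) (exp (PI * x * (y * y))) eps Hp He) as [T [HT K]].
  destruct (INR_unbounded (T + 1 + Rabs s)) as [N HN].
  exists N. intros n Hn. apply le_INR in Hn.
  assert (A1 := Rle_abs s). assert (A2 := Rle_abs (- s)). rewrite Rabs_Ropp in A2.
  assert (B : forall k, T + 1 <= Rabs k -> Cmod (gauss x (k, y)) <= eps).
  { intros k Hk. rewrite Cmod_gauss. eapply Rle_trans; [|apply (K (Rabs k)); lra].
    rewrite <- exp_plus. apply exp_mono.
    assert (Rabs k <= k * k).
    { replace (k * k) with (Rabs k * Rabs k) by apply Rabs_sq. nra. }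
    assert (0 <= PI * x * (k * k - Rabs k)) by (apply Rmult_le_pos; lra). lra. }
  split.
  - replace ((s, y) + RtoC (INR n))%C with ((s + INR n, y) : C) by (apply injective_projections; simpl; ring).
    apply B. rewrite Rabs_pos_eq; lra.
  - replace ((s, y) + RtoC (- INR n))%C with ((s + - INR n, y) : C) by (apply injective_projections; simpl; ring).
    apply B. rewrite Rabs_left1; lra.
Qed.

(** The end terms in [hpart_shift] tend to 0. Only the two vertical sides of the period rectangle
    need to be compared. *)
Lemma hsum_periodic x y : 0 < x -> hsum x ((/ 2)%R, y) = hsum x ((- / 2)%R, y).
Proof.
  intros Hx. apply cvC_unique with (fun n => hpart x n ((/ 2)%R, y)).
  - apply hsum_cv; auto. rewrite Rabs_pos_eq; lra.
  - replace (hsum x ((- / 2)%R, y)) with (hsum x ((- / 2)%R, y) + 0)%C by ring.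
    apply cvC_ext with (fun n => hpart x n ((- / 2)%R, y) + (hpart x n ((/ 2)%R, y) - hpart x n ((- / 2)%R, y)))%C.
    intros; ring.
    apply cvC_plus. apply hsum_cv; auto. rewrite Rabs_left1; lra.
    intros eps He. destruct (gauss_cv_0 x (- / 2) y Hx (eps / 2)) as [N HN]; [lra|].
    exists N. intros n Hn.
    replace (((/ 2)%R, y) : C) with (((- / 2)%R, y) + 1)%C by (apply injective_projections; simpl; field).
    rewrite hpart_shift.
    replace (gauss x (((- / 2)%R, y) + RtoC (INR (S n))) - gauss x (((- / 2)%R, y) + RtoC (- INR n)) - 0)%C
      with (gauss x (((- / 2)%R, y) + RtoC (INR (S n))) - gauss x (((- / 2)%R, y) + RtoC (- INR n)))%C by ring.
    eapply Rle_trans. apply Cmod_minus_le.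
    assert (A1 := proj1 (HN (S n) ltac:(lia))). assert (A2 := proj2 (HN n Hn)). lra.
Qed.

Definition hline (x y : R) : C := CI (fun s : R => hsum x (s, y)) (- / 2) (/ 2).

Lemma abs_le_half s : - / 2 <= s <= / 2 -> Rabs s <= / 2.
Proof. intros. apply Rabs_le. lra. Qed.

(** Cauchy's theorem on a rectangle one period wide, whose vertical sides cancel. *)
Lemma hline_const_lt x y1 y2 : 0 < x -> y1 <= y2 -> hline x y1 = hline x y2.
Proof.
  intros Hx Hy.
  assert (H : rect_int (hsum x) (- / 2) (/ 2) y1 y2 = RtoC 0).
  { apply (Goursat_lim (hpart x)); try lra.
    - intros; apply cdiff_hpart.
    - intros; apply ccont_hsum; auto. now apply abs_le_half.
    - intros eps He. destruct (hsum_unif_eps x (Rabs y1 + Rabs y2) Hx eps He) as [N HN].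
      exists N. intros n s y Hn Hs Hy'. apply HN; auto.
      + apply abs_le_half in Hs. lra.
      + assert (A := Rle_abs y2). assert (B := Rle_abs (- y1)). rewrite Rabs_Ropp in B.
        assert (A' := Rabs_pos y2). assert (B' := Rabs_pos y1).
        apply Rabs_le. lra. }
  unfold rect_int in H.
  rewrite (RInt_ext (V := C_R_CompleteNormedModule) (fun y : R => hsum x ((/ 2)%R, y)) (fun y : R => hsum x ((- / 2)%R, y))) in H
    by (intros; now apply hsum_periodic).
  fold (hline x y1) in H. fold (hline x y2) in H.
  replace (hline x y1) with ((hline x y1 - hline x y2 + Ci *
       (CI (fun y : R => hsum x ((- / 2)%R, y)) y1 y2 - CI (fun y : R => hsum x ((- / 2)%R, y)) y1 y2)) + hline x y2)%C
    by ring.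
  rewrite H. ring.
Qed.

Lemma hline_const x y1 y2 : 0 < x -> hline x y1 = hline x y2.
Proof.
  intros Hx. destruct (Rle_dec y1 y2). now apply hline_const_lt. symmetry. apply hline_const_lt; lra.
Qed.

Lemma cexp_2piZ (m : Z) : cexp (Ci * RtoC (2 * PI * IZR m))%C = RtoC 1.
Proof.
  assert (H : forall n, cexp (Ci * RtoC (2 * PI * INR n))%C = RtoC 1).
  { intros n. unfold cexp. simpl.
    replace (0 * 0 + 1 * (2 * PI * INR n)) with (0 + 2 * INR n * PI) by ring.
    replace (0 * (2 * PI * INR n) - 1 * 0) with 0 by ring.
    rewrite cos_period, sin_period, exp_0, cos_0, sin_0. apply injective_projections; simpl; ring. }
  destruct (ZArith_dec.Z_le_dec 0 m).
  - rewrite <- (Z2Nat.id m) by auto. rewrite <- INR_IZR_INZ. apply H.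
  - replace m with (- (- m))%Z by ring. rewrite opp_IZR.
    replace (Ci * RtoC (2 * PI * - IZR (- m)))%C with (- (Ci * RtoC (2 * PI * IZR (- m))))%C
      by (rewrite !RtoC_mult, !RtoC_opp; ring).
    rewrite cexp_opp. rewrite <- (Z2Nat.id (- m)) by lia. rewrite <- INR_IZR_INZ, H.
    apply injective_projections; simpl; field.
Qed.

Definition qfac (x : R) (k : Z) (z : C) : C :=
  (RtoC (exp (PI / x * (IZR k * IZR k))) * cexp (- (Ci * RtoC (2 * PI * IZR k) * z)))%C.

(** Expanding the square, -pi x (z + i k / x)^2 = -pi x z^2 - 2 pi i k z + pi k^2 / x. The
    translation by n adds only the factor e^(-2 pi i k n) = 1, so the multiplier is the same for all
    terms of the sum. *)
Lemma gauss_quasi x (k n : Z) z : 0 < x ->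
  gauss x (z + Ci * RtoC (IZR k / x) + RtoC (IZR n))%C = (qfac x k z * gauss x (z + RtoC (IZR n)))%C.
Proof.
  intros Hx. unfold qfac, gauss. rewrite <- cexp_RtoC.
  assert (E : cexp (Ci * RtoC (2 * PI * IZR (- (k * n))))%C = RtoC 1) by apply cexp_2piZ.
  rewrite <- (Cmult_1_r (_ * cexp (RtoC (- (PI * x)) * ((z + RtoC (IZR n)) * (z + RtoC (IZR n))))))%C.
  rewrite <- E, <- !cexp_plus. f_equal.
  rewrite opp_IZR, mult_IZR. destruct z as [s y].
  apply injective_projections; simpl; field; lra.
Qed.

Lemma hsum_quasi x k s y : 0 < x -> Rabs s <= 1 ->
  hsum x (s, y + IZR k / x) = (qfac x k (s, y) * hsum x (s, y))%C.
Proof.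
  intros Hx Hs. apply cvC_unique with (fun n => hpart x n (s, y + IZR k / x)).
  - now apply hsum_cv.
  - apply cvC_ext with (fun n => qfac x k (s, y) * hpart x n (s, y))%C.
    + intros n. unfold hpart. rewrite Cmult_plus_distr_l, <- csum_scal.
      replace ((s, y + IZR k / x) : C) with ((s, y) + Ci * RtoC (IZR k / x))%C
        by (apply injective_projections; simpl; ring).
      f_equal.
      * symmetry. apply (gauss_quasi x k 0). auto.
      * apply csum_ext. intros j. unfold hterm. rewrite Cmult_plus_distr_l.
        rewrite INR_IZR_INZ, <- opp_IZR, !gauss_quasi by auto. reflexivity.
    + apply cvC_scal. now apply hsum_cv.
Qed.

Lemma exCI_hline x y : 0 < x -> exCI (fun s : R => hsum x (s, y)) (- / 2) (/ 2).
Proof.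
  intros Hx. apply exCI_h; [lra|]. intros; apply ccont_hsum; auto. now apply abs_le_half.
Qed.

(** Quasi-periodicity absorbs e^(-2 pi i k z) by raising the line to height y + k / x, at the price
    of e^(-pi k^2 / x), and [hline] does not depend on the height. *)
Lemma hline_fourier x k y : 0 < x ->
  isCI (fun s : R => hsum x (s, y) * cexp (- (Ci * RtoC (2 * PI * IZR k) * (s, y))))%C (- / 2) (/ 2)
    (RtoC (exp (- (PI / x * (IZR k * IZR k)))) * hline x 0)%C.
Proof.
  intros Hx. rewrite (hline_const x 0 (y + IZR k / x)) by auto.
  apply isCI_ext with (fun s : R => RtoC (exp (- (PI / x * (IZR k * IZR k)))) * hsum x (s, (y + IZR k / x)%R))%C;
    [|apply (isCI_scal _ (fun s : R => hsum x (s, (y + IZR k / x)%R))), CI_correct, exCI_hline, Hx].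
  intros s Hs. rewrite Rmin_left, Rmax_right in Hs by lra. simpl.
  rewrite hsum_quasi by (auto; apply Rabs_le; lra). unfold qfac.
  transitivity (RtoC (exp (- (PI / x * (IZR k * IZR k)))) * RtoC (exp (PI / x * (IZR k * IZR k))) *
    (hsum x (s, y) * cexp (- (Ci * RtoC (2 * PI * IZR k) * (s, y)))))%C. ring.
  rewrite <- RtoC_mult, <- exp_plus.
  replace (- (PI / x * (IZR k * IZR k)) + PI / x * (IZR k * IZR k)) with 0 by ring.
  rewrite exp_0. ring.
Qed.

Lemma cos_eq_1_small u : - PI <= u <= PI -> cos u = 1 -> u = 0.
Proof.
  intros Hu Hc. assert (P := PI_RGT_0).
  assert (E : sin (u / 2) = 0).
  { replace u with (2 * (u / 2)) in Hc by field. rewrite cos_2a_sin in Hc. nra. }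
  destruct (Rtotal_order u 0) as [H|[H|H]]; auto; exfalso.
  - assert (X : 0 < sin (- (u / 2))) by (apply sin_gt_0; lra). rewrite sin_neg in X. lra.
  - assert (X : 0 < sin (u / 2)) by (apply sin_gt_0; lra). lra.
Qed.

(** The zeros are the integers and are simple; in the closed strip |Re z| <= 1/2 only 0 is left, so
    dividing by [hden] isolates the value of [hsum] at 0. *)
Definition hden (z : C) : C := (cexp (Ci * RtoC (2 * PI) * z) - 1)%C.

Lemma is_cderiv_hden (z : C) : is_cderiv hden z (cexp (Ci * RtoC (2 * PI) * z) * (Ci * RtoC (2 * PI)))%C.
Proof.
  unfold hden.
  replace (cexp (Ci * RtoC (2 * PI) * z) * (Ci * RtoC (2 * PI)))%C with
    (cexp (Ci * RtoC (2 * PI) * z) * (0 * z + Ci * RtoC (2 * PI) * 1) + 0)%C by ring.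
  apply (is_cderiv_plus (fun z => cexp (Ci * RtoC (2 * PI) * z)) (fun z => - RtoC 1)%C).
  - apply (is_cderiv_comp (fun z => Ci * RtoC (2 * PI) * z)%C cexp); [|apply is_cderiv_cexp].
    apply (is_cderiv_mult (fun _ => Ci * RtoC (2 * PI))%C (fun z => z)).
    apply is_cderiv_const. apply is_cderiv_id.
  - apply is_cderiv_const.
Qed.

Lemma hden_neq_0 s y : - / 2 <= s <= / 2 -> (s, y) <> RtoC 0 -> hden (s, y) <> RtoC 0.
Proof.
  intros Hs Hne E. apply Hne. assert (P := PI_RGT_0).
  assert (E1 : cexp (Ci * RtoC (2 * PI) * (s, y))%C = RtoC 1).
  { unfold hden in E. replace (cexp (Ci * RtoC (2 * PI) * (s, y))%C)
      with (cexp (Ci * RtoC (2 * PI) * (s, y)) - 1 + 1)%C by ring. rewrite E. ring. }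
  assert (Hy : y = 0).
  { assert (M := Cmod_cexp (Ci * RtoC (2 * PI) * (s, y))%C). rewrite E1, Cmod_1 in M.
    rewrite <- exp_0 in M. apply exp_inv in M. simpl in M. nra. }
  subst y. unfold cexp in E1. injection E1. simpl. intros _ Ec.
  replace ((0 * (2 * PI) - 1 * 0) * s - (0 * 0 + 1 * (2 * PI)) * 0) with 0 in Ec by ring.
  rewrite exp_0, Rmult_1_l in Ec. apply cos_eq_1_small in Ec; [|nra].
  assert (s = 0) by nra. now subst s.
Qed.

(** The residue at 0 is hsum(0) / (2 pi i), and the vertical sides cancel since numerator and
    denominator both have period 1. *)
Lemma hsum_residue x : 0 < x ->
  hsum x (RtoC 0) = (CI (fun s : R => hsum x (s, (-1)%R) * (1 / hden (s, (-1)%R)))%C (- / 2) (/ 2)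
    - CI (fun s : R => hsum x (s, 1%R) * (1 / hden (s, 1%R)))%C (- / 2) (/ 2))%C.
Proof.
  intros Hx. assert (P := PI_RGT_0).
  assert (H2 : (Ci * RtoC (2 * PI))%C <> RtoC 0).
  { apply Cmult_neq_0. intros E. injection E. lra. intros E; apply RtoC_inj in E; lra. }
  assert (H : rect_int (fun z => hsum x z * (1 / hden z))%C (- / 2) (/ 2) (-1) 1
    = (RtoC (2 * PI) * Ci * (hsum x (RtoC 0) * (1 / (Ci * RtoC (2 * PI)))))%C).
  { apply (residue_rect_lim (fun _ => RtoC 1) hden (hpart x) (hsum x)).
    - simpl. lra.
    - simpl. lra.
    - intros. split. apply cdiff_const. eexists. apply is_cderiv_hden.
    - intros s y Hs Hy Hne. apply hden_neq_0; auto.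
    - replace (Ci * RtoC (2 * PI))%C with (cexp (Ci * RtoC (2 * PI) * 0) * (Ci * RtoC (2 * PI)))%C.
      apply is_cderiv_hden. replace (Ci * RtoC (2 * PI) * 0)%C with (RtoC 0) by ring. rewrite cexp_0; ring.
    - unfold hden. replace (Ci * RtoC (2 * PI) * 0)%C with (RtoC 0) by ring. rewrite cexp_0; ring.
    - auto.
    - intros; apply cdiff_hpart.
    - intros; apply ccont_hsum; auto. now apply abs_le_half.
    - intros eps He. destruct (hsum_unif_eps x 1 Hx eps He) as [N HN].
      exists N. intros n s y Hn Hs Hy'. apply HN; auto.
      + apply abs_le_half in Hs. lra.
      + apply Rabs_le. lra. }
  replace (RtoC (2 * PI) * Ci * (hsum x 0 * (1 / (Ci * RtoC (2 * PI)))))%C with (hsum x 0) in H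
    by (field; split; [intros E; apply RtoC_inj in E; lra|intros E; injection E; lra]).
  rewrite <- H. unfold rect_int.
  rewrite (RInt_ext (V := C_R_CompleteNormedModule) (fun y : R => hsum x ((/ 2)%R, y) * (1 / hden ((/ 2)%R, y)))%C
    (fun y : R => hsum x ((- / 2)%R, y) * (1 / hden ((- / 2)%R, y)))%C).
  ring.
  intros y _. rewrite hsum_periodic by auto. enough (E : hden ((/ 2)%R, y) = hden ((- / 2)%R, y)) by now rewrite E.
  unfold hden.
  replace (Ci * RtoC (2 * PI) * ((/ 2)%R, y))%C
    with (Ci * RtoC (2 * PI) * ((- / 2)%R, y) + Ci * RtoC (2 * PI * IZR 1))%C
    by (apply injective_projections; simpl; field).
  rewrite cexp_plus, cexp_2piZ. ring.
Qed.

(** Useful for |w| > 1, on the bottom side; [geom_pos] serves the top side, where |w| < 1. Keeping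
    the remainder exact makes the error explicit. *)
Lemma geom_neg (w : C) (n : nat) : w <> RtoC 0 -> (w - 1)%C <> RtoC 0 ->
  (1 / (w - 1) = csum (fun k => / Cpow w (S k)) n + / Cpow w n / (w - 1))%C.
Proof.
  intros H0 H1. induction n.
  - simpl. field. auto.
  - rewrite IHn. simpl csum. assert (Cpow w n <> RtoC 0) by now apply Cpow_nz.
    simpl. field. repeat split; auto.
Qed.

Lemma geom_pos (w : C) (n : nat) : (w - 1)%C <> RtoC 0 ->
  (- (1 / (w - 1)) = csum (fun k => Cpow w k) n - Cpow w n / (w - 1))%C.
Proof.
  intros H1. induction n.
  - simpl. field. auto.
  - rewrite IHn. simpl. field. auto.
Qed.

Lemma cexp_INR (z : C) n : cexp (RtoC (INR n) * z)%C = Cpow (cexp z) n.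
Proof.
  induction n. simpl. replace (0 * z)%C with (RtoC 0) by ring. apply cexp_0.
  rewrite S_INR, RtoC_plus. replace ((INR n + 1) * z)%C with (INR n * z + z)%C by ring.
  rewrite cexp_plus, IHn. simpl. ring.
Qed.

Lemma isCI_csum (f : nat -> R -> C) (l : nat -> C) a b n :
  (forall k, isCI (f k) a b (l k)) -> isCI (fun s => csum (fun k => f k s) n) a b (csum l n).
Proof.
  intros H. induction n; simpl.
  - assert (X := isCI_const (RtoC 0) a b). rewrite Cmult_0_r in X. exact X.
  - apply isCI_plus; auto.
Qed.

Lemma isCI_csum_mult (u : R -> C) (f : nat -> R -> C) (l : nat -> C) a b n :
  (forall k, isCI (fun s => u s * f k s)%C a b (l k)) ->
  isCI (fun s => u s * csum (fun k => f k s) n)%C a b (csum l n).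
Proof.
  intros H. apply isCI_ext with (fun s => csum (fun k => u s * f k s)%C n).
  intros s _. apply csum_scal. now apply isCI_csum.
Qed.

(** Shared by both horizontal sides: 1 / hden is replaced by [sg] times exponentials of frequencies
    [c k], each integrated by [hline_fourier]. The error is the supremum of [hsum] on the segment
    times the assumed remainder. *)
Lemma hline_approx x y (sg : C) (c : nat -> Z) : 0 < x -> y <> 0 ->
  (forall n s, - / 2 <= s <= / 2 -> Cmod (1 / hden (s, y) - sg *
    csum (fun k => cexp (- (Ci * RtoC (2 * PI * IZR (c k)) * (s, y)))) n)%C <= 2 * exp (- (2 * PI * INR n))) ->
  exists M, 0 <= M /\ forall n,
  Cmod (CI (fun s : R => hsum x (s, y) * (1 / hden (s, y)))%C (- / 2) (/ 2)
    - sg * (hline x 0 * csum (fun k => RtoC (exp (- (PI / x * (IZR (c k) * IZR (c k)))))) n))%C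
    <= M * exp (- (2 * PI * INR n)).
Proof.
  intros Hx Hy H.
  destruct (bounded_h (hsum x) (- / 2) (/ 2) y) as [M [HM HMb]]. lra.
  { intros; apply ccont_hsum; auto. now apply abs_le_half. }
  exists (2 * M). split; [lra|]. intros n.
  assert (E1 : isCI (fun s : R => hsum x (s, y) * (1 / hden (s, y)))%C (- / 2) (/ 2)
    (CI (fun s : R => hsum x (s, y) * (1 / hden (s, y)))%C (- / 2) (/ 2))).
  { apply CI_correct. apply (exCI_h (fun z => hsum x z * (1 / hden z))%C). lra.
    intros s Hs. apply ccont_mult. apply ccont_hsum; auto. now apply abs_le_half.
    apply cdiff_ccont. apply cdiff_div. apply cdiff_const. eexists; apply is_cderiv_hden.
    apply hden_neq_0; auto. intros E. injection E. auto. }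
  assert (E2 : isCI (fun s : R => hsum x (s, y) * csum (fun k => cexp (- (Ci * RtoC (2 * PI * IZR (c k)) * (s, y)))) n)%C
    (- / 2) (/ 2) (csum (fun k => RtoC (exp (- (PI / x * (IZR (c k) * IZR (c k))))) * hline x 0)%C n)).
  { apply isCI_csum_mult. intros k. now apply hline_fourier. }
  rewrite (csum_ext _ (fun k => hline x 0 * RtoC (exp (- (PI / x * (IZR (c k) * IZR (c k)))))))%C in E2
    by (intros; ring).
  rewrite csum_scal in E2.
  assert (E3 := isCI_minus _ _ _ _ _ _ E1 (isCI_scal sg _ _ _ _ E2)).
  replace (2 * M * exp (- (2 * PI * INR n))) with ((/ 2 - - / 2) * (M * (2 * exp (- (2 * PI * INR n))))) by field.
  eapply isCI_Cmod_le_const; [| |apply E3]. lra.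
  intros s Hs. simpl.
  replace (hsum x (s, y) * (1 / hden (s, y)) - sg * (hsum x (s, y) *
    csum (fun k : nat => cexp (- (Ci * RtoC (2 * PI * IZR (c k)) * (s, y)))) n))%C
    with (hsum x (s, y) * (1 / hden (s, y) - sg *
    csum (fun k : nat => cexp (- (Ci * RtoC (2 * PI * IZR (c k)) * (s, y)))) n))%C by ring.
  rewrite Cmod_mult. apply Rmult_le_compat; auto using Cmod_ge_0.
Qed.

Lemma exp_2PI_ge_2 : 2 <= exp (2 * PI).
Proof.
  assert (P := PI_RGT_0). assert (P2 := PI2_1).
  assert (X := exp_ineq1 (2 * PI) ltac:(lra)). lra.
Qed.

(** Here |w| = e^(2 pi), so 1 / hden expands in powers of 1 / w. The frequencies 1, 2, ... here and
    0, -1, -2, ... in [hden_top] cover each integer once. *)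
Lemma hden_bottom n s : - / 2 <= s <= / 2 -> Cmod (1 / hden (s, (-1)%R) - 1 *
  csum (fun k => cexp (- (Ci * RtoC (2 * PI * IZR (Z.of_nat (S k))) * (s, (-1)%R)))) n)%C <= 2 * exp (- (2 * PI * INR n)).
Proof.
  intros Hs. assert (X := exp_2PI_ge_2).
  set (w := cexp (Ci * RtoC (2 * PI) * (s, (-1)%R))).
  assert (Hw : Cmod w = exp (2 * PI)) by (unfold w; rewrite Cmod_cexp; f_equal; simpl; ring).
  assert (Hw0 : w <> RtoC 0) by apply cexp_neq_0.
  assert (Hw1 : 1 <= Cmod (w - 1)%C).
  { unfold Cminus. eapply Rle_trans; [|apply Cmod_ge_minus]. rewrite Cmod_opp, Cmod_1. lra. }
  assert (Hw2 : (w - 1)%C <> RtoC 0) by (apply Cmod_gt_0; lra).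
  rewrite (csum_ext _ (fun k => / Cpow w (S k))%C).
  2:{ intros k. rewrite cexp_opp. f_equal. unfold w. rewrite <- cexp_INR. f_equal.
      rewrite <- INR_IZR_INZ, !RtoC_mult. ring. }
  unfold hden. fold w. rewrite (geom_neg w n) by auto.
  replace (csum (fun k : nat => / w ^ S k) n + / w ^ n / (w - 1) - 1 * csum (fun k : nat => / w ^ S k) n)%C
    with (/ w ^ n / (w - 1))%C by ring.
  assert (Hwn : Cpow w n <> RtoC 0) by now apply Cpow_nz.
  rewrite Cmod_div, Cmod_inv, Cmod_pow, Hw, exp_pow by auto.
  rewrite <- exp_Ropp. replace (- (INR n * (2 * PI))) with (- (2 * PI * INR n)) by ring.
  assert (Y := exp_pos (- (2 * PI * INR n))).
  apply Rle_div_l. lra. nra.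
Qed.

(** Here |w| = e^(-2 pi) <= 1/2, so |w - 1| >= 1/2, which is where the factor 2 comes from. *)
Lemma hden_top n s : - / 2 <= s <= / 2 -> Cmod (1 / hden (s, 1%R) - (- RtoC 1) *
  csum (fun k => cexp (- (Ci * RtoC (2 * PI * IZR (- Z.of_nat k)) * (s, 1%R)))) n)%C <= 2 * exp (- (2 * PI * INR n)).
Proof.
  intros Hs. assert (X := exp_2PI_ge_2).
  set (w := cexp (Ci * RtoC (2 * PI) * (s, 1%R))).
  assert (Hw : Cmod w = exp (- (2 * PI))) by (unfold w; rewrite Cmod_cexp; f_equal; simpl; ring).
  assert (Hw' : Cmod w <= / 2) by (rewrite Hw, exp_Ropp; apply Rinv_le_contravar; lra).
  assert (Hw1 : / 2 <= Cmod (w - 1)%C).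
  { rewrite Cmod_minus_sym. unfold Cminus. eapply Rle_trans; [|apply Cmod_ge_minus]. rewrite Cmod_opp, Cmod_1. lra. }
  assert (Hw2 : (w - 1)%C <> RtoC 0) by (apply Cmod_gt_0; lra).
  rewrite (csum_ext _ (fun k => Cpow w k)%C).
  2:{ intros k. unfold w. rewrite <- cexp_INR. f_equal.
      rewrite opp_IZR, <- INR_IZR_INZ, !RtoC_mult, RtoC_opp. ring. }
  unfold hden. fold w.
  replace (1 / (w - 1))%C with (- (- (1 / (w - 1))))%C by ring. rewrite (geom_pos w n) by auto.
  replace (- (csum (fun k : nat => w ^ k) n - w ^ n / (w - 1)) - (- RtoC 1) * csum (fun k : nat => w ^ k) n)%C
    with (w ^ n / (w - 1))%C by ring.
  rewrite Cmod_div, Cmod_pow, Hw, exp_pow by auto.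
  replace (INR n * - (2 * PI)) with (- (2 * PI * INR n)) by ring.
  assert (Y := exp_pos (- (2 * PI * INR n))).
  apply Rle_div_l. lra. nra.
Qed.

(** Half of Jacobi's theta function minus 1; the shift [S n] makes the sum start at 1. *)
Definition omega (x : R) : R := Series (fun n => exp (- (PI * x * (INR (S n) * INR (S n))))).

Definition wterm (x : R) (n : nat) : C := RtoC (exp (- (PI * x * (INR (S n) * INR (S n))))).

Lemma hterm_0 x n : hterm x n (0, 0) = (2 * wterm x n)%C.
Proof.
  unfold hterm, gauss, wterm. rewrite <- cexp_RtoC.
  replace (RtoC (- (PI * x)) * (((0, 0) + RtoC (INR (S n))) * ((0, 0) + RtoC (INR (S n)))))%C
    with (RtoC (- (PI * x * (INR (S n) * INR (S n))))) by (apply injective_projections; simpl; ring).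
  replace (RtoC (- (PI * x)) * (((0, 0) + RtoC (- INR (S n))) * ((0, 0) + RtoC (- INR (S n)))))%C
    with (RtoC (- (PI * x * (INR (S n) * INR (S n))))) by (apply injective_projections; simpl; ring).
  ring.
Qed.

Lemma wterm_le x n : 0 < x -> Cmod (wterm x n) <= hmaj x 0 n - hmaj x 0 (S n).
Proof.
  intros Hx. eapply Rle_trans; [|apply (hterm_le x 0 n 0 0); auto; rewrite Rabs_R0; lra].
  rewrite hterm_0, Cmod_mult, Cmod_R, Rabs_pos_eq by lra.
  assert (X := Cmod_ge_0 (wterm x n)). lra.
Qed.

Lemma omega_CSeries x : CSeries (wterm x) = RtoC (omega x).
Proof.
  unfold CSeries, omega, wterm, RtoC. simpl. f_equal.
  rewrite (Series_ext _ (fun n => 0 * 0)) by (intros; ring). rewrite Series_scal_l. ring.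
Qed.

Lemma omega_cv x : 0 < x -> cvC (csum (wterm x)) (RtoC (omega x)).
Proof.
  intros Hx. rewrite <- omega_CSeries.
  apply (tele_series _ (hmaj x 0)); [|now apply hmaj_cv]. intros; now apply wterm_le.
Qed.

Lemma hsum_0 x : 0 < x -> hsum x (RtoC 0) = RtoC (1 + 2 * omega x).
Proof.
  intros Hx. apply cvC_unique with (fun n => hpart x n (0, 0)).
  - apply hsum_cv; auto. rewrite Rabs_R0; lra.
  - rewrite RtoC_plus, RtoC_mult. apply cvC_plus.
    + unfold gauss. replace (RtoC (- (PI * x)) * (((0, 0) + 0) * ((0, 0) + 0)))%C with (RtoC 0)
        by (apply injective_projections; simpl; ring). rewrite cexp_0. apply cvC_const.
    + apply cvC_ext with (fun n => RtoC 2 * csum (wterm x) n)%C.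
      intros n. rewrite <- csum_scal. apply csum_ext. intros k. now rewrite hterm_0.
      apply cvC_scal. now apply omega_cv.
Qed.

Lemma csum_shift a n : csum a (S n) = (a O + csum (fun k => a (S k)) n)%C.
Proof. induction n. simpl. ring. change (csum a (S (S n))) with (csum a (S n) + a (S n))%C. rewrite IHn. simpl. ring. Qed.

(** Jacobi's identity up to the factor [hline x 0], which turns out to be a Gaussian integral. *)
Lemma theta_hline x : 0 < x ->
  RtoC (1 + 2 * omega x) = (hline x 0 * RtoC (1 + 2 * omega (/ x)))%C.
Proof.
  intros Hx. assert (Hix : 0 < / x) by now apply Rinv_0_lt_compat.
  rewrite <- hsum_0 by auto. assert (P := PI_RGT_0).
  destruct (hline_approx x (-1) (RtoC 1) (fun k => Z.of_nat (S k)) Hx) as [M1 [HM1 H1]]. lra.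
  { intros; now apply hden_bottom. }
  destruct (hline_approx x 1 (- RtoC 1)%C (fun k => (- Z.of_nat k)%Z) Hx) as [M2 [HM2 H2]]. lra.
  { intros; now apply hden_top. }
  set (A := csum (fun k => RtoC (exp (- (PI / x * (IZR (Z.of_nat (S k)) * IZR (Z.of_nat (S k)))))))) in *.
  set (B := csum (fun k => RtoC (exp (- (PI / x * (IZR (- Z.of_nat k) * IZR (- Z.of_nat k))))))) in *.
  assert (EA : forall n, A n = csum (wterm (/ x)) n).
  { intros n. apply csum_ext. intros k. unfold wterm. rewrite <- INR_IZR_INZ. reflexivity. }
  assert (EB : forall n, B (S n) = (1 + csum (wterm (/ x)) n)%C).
  { intros n. unfold B. rewrite csum_shift. f_equal.
    - simpl. replace (- (PI / x * (0 * 0))) with 0 by ring. now rewrite exp_0.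
    - apply csum_ext. intros k. unfold wterm. rewrite opp_IZR, <- INR_IZR_INZ. do 2 f_equal. unfold Rdiv. ring. }
  (* With n + 1 terms on each side, the top contributes its frequency 0 as the 1 and only n further
     terms. *)
  apply cvC_unique with (fun n => hline x 0 * (csum (wterm (/ x)) (S n) + (1 + csum (wterm (/ x)) n)))%C.
  - intros eps He.
    destruct (exp_small (2 * PI) (M1 + M2) eps ltac:(lra) He) as [T [HT K]].
    destruct (INR_unbounded T) as [N HN]. exists N. intros n Hn.
    rewrite <- EB, <- EA, (hsum_residue x Hx).
    specialize (H1 (S n)). specialize (H2 (S n)).
    set (I1 := CI (fun s : R => hsum x (s, (-1)%R) * (1 / hden (s, (-1)%R)))%C (- / 2) (/ 2)) in *.
    set (I2 := CI (fun s : R => hsum x (s, 1%R) * (1 / hden (s, 1%R)))%C (- / 2) (/ 2)) in *.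
    rewrite Cmod_minus_sym.
    replace (I1 - I2 - hline x 0 * (A (S n) + B (S n)))%C
      with ((I1 - 1 * (hline x 0 * A (S n))) - (I2 - (- RtoC 1) * (hline x 0 * B (S n))))%C by ring.
    eapply Rle_trans. apply Cmod_minus_le.
    assert (Y := K (INR (S n))). apply le_INR in Hn. rewrite S_INR in *.
    specialize (Y ltac:(lra)). lra.
  - apply cvC_scal. rewrite RtoC_plus, RtoC_mult.
    replace (1 + 2 * RtoC (omega (/ x)))%C with (RtoC (omega (/ x)) + (1 + RtoC (omega (/ x))))%C by ring.
    apply cvC_plus.
    + assert (H := omega_cv (/ x) Hix). intros eps He. destruct (H eps He) as [N HN].
      exists N. intros n Hn. apply HN. lia.
    + apply cvC_plus. apply cvC_const. now apply omega_cv.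
Qed.

(** * The Gaussian integral and Jacobi's identity *)

Lemma cdiff_gauss x z : cdiff (gauss x) z.
Proof.
  apply cdiff_ext with (fun w => gauss x (w + RtoC 0)%C). intros; f_equal; ring. apply cdiff_gauss_shift.
Qed.

Lemma gauss_line_cont x (u : R) : RCcont (fun s : R => gauss x (s, 0)) u.
Proof. apply ccont_RCcont_h, cdiff_ccont, cdiff_gauss. Qed.

Lemma isCI_eq f a b (l m : C) : isCI f a b l -> l = m -> isCI f a b m.
Proof. now intros H <-. Qed.

Lemma gauss_CI_shift x k : isCI (fun s : R => gauss x ((s, 0%R) + RtoC k))%C (- / 2) (/ 2)
  (CI (fun s : R => gauss x (s, 0)) (k - / 2) (k + / 2)).
Proof.
  apply isCI_ext with (fun s : R => (RtoC 1 * gauss x ((1 * s + k)%R, 0%R))%C).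
  - intros s _. rewrite Cmult_1_l. f_equal. apply injective_projections; simpl; ring.
  - apply (isCI_lin (fun s : R => gauss x (s, 0))).
    replace (1 * - / 2 + k) with (k - / 2) by ring. replace (1 * / 2 + k) with (k + / 2) by ring.
    apply CI_correct, exCI_cont. intros; apply gauss_line_cont.
Qed.

(** The 2 n + 1 translates of one period tile the segment [-n - 1/2, n + 1/2], so [hline x 0] is the
    Gaussian integral in the limit. *)
Lemma hpart_unfold x n : isCI (fun s : R => hpart x n (s, 0)) (- / 2) (/ 2)
  (CI (fun s : R => gauss x (s, 0)) (- INR n - / 2) (INR n + / 2)).
Proof.
  assert (E : forall a b, exCI (fun s : R => gauss x (s, 0)) a b)
    by (intros; apply exCI_cont; intros; apply gauss_line_cont).
  induction n.
  - unfold hpart. simpl. apply isCI_ext with (fun s : R => gauss x ((s, 0%R) + RtoC 0))%C.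
    intros; simpl; ring. assert (H := gauss_CI_shift x 0).
    replace (- 0 - / 2) with (0 - / 2) by ring. exact H.
  - apply isCI_ext with (fun s : R => hpart x n (s, 0) + (gauss x ((s, 0%R) + RtoC (INR (S n))) +
      gauss x ((s, 0%R) + RtoC (- INR (S n)))))%C.
    { intros s _. unfold hpart. simpl. unfold hterm. simpl. ring. }
    assert (H := isCI_plus _ _ _ _ _ _ IHn
      (isCI_plus _ _ _ _ _ _ (gauss_CI_shift x (INR (S n))) (gauss_CI_shift x (- INR (S n))))).
    rewrite <- (CI_Chasles _ (- INR (S n) - / 2) (- INR n - / 2) (INR (S n) + / 2)) by auto.
    rewrite <- (CI_Chasles _ (- INR n - / 2) (INR n + / 2) (INR (S n) + / 2)) by auto.
    rewrite S_INR in *.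
    replace (INR n + 1 - / 2) with (INR n + / 2) in H by field.
    replace (- (INR n + 1) + / 2) with (- INR n - / 2) in H by field.
    eapply isCI_eq; [exact H|]. ring.
Qed.

Lemma gauss_improper x : 0 < x -> improper (fun u : R => gauss x (u, 0)) (hline x 0).
Proof.
  intros Hx. assert (Hp := PI_mult_pos x Hx).
  (* The constants express |u| <= 1 + u^2. *)
  destruct (improper_exists (fun u : R => gauss x (u, 0)) (exp (PI * x)) (PI * x) Hp) as [l Hl].
  - intros; apply gauss_line_cont.
  - intros u. rewrite Cmod_gauss, <- exp_plus. apply exp_mono.
    assert (0 <= PI * x * (1 + u * u - Rabs u)).
    { apply Rmult_le_pos; [lra|]. rewrite <- Rabs_sq. nra. }
    lra.
  - replace (hline x 0) with l; auto.
    apply cvC_unique with (fun n => CI (fun s : R => gauss x (s, 0)) (- INR n - / 2) (INR n + / 2)).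
    + destruct Hl as [_ Hl]. intros eps He. destruct (Hl eps He) as [T [HT K]].
      destruct (INR_unbounded T) as [N HN]. exists N. intros n Hn. apply le_INR in Hn. apply K; lra.
    + apply cvC_ext with (fun n => CI (fun s : R => hpart x n (s, 0)) (- / 2) (/ 2)).
      intros n. apply CI_unique. apply hpart_unfold.
      unfold cvC. apply (CI_lim (fun n (s : R) => hpart x n (s, 0)) (fun s : R => hsum x (s, 0))). lra.
      * intros n. eexists. apply hpart_unfold.
      * now apply exCI_hline.
      * intros eps He. destruct (hsum_unif_eps x 0 Hx eps He) as [N HN]. exists N.
        intros n s Hn Hs. apply HN; auto. apply Rabs_le; lra. rewrite Rabs_R0; lra.
Qed.

Lemma hline_sqrt x : 0 < x -> (RtoC (sqrt x) * hline x 0)%C = hline 1 0.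
Proof.
  intros Hx. assert (Hs := sqrt_lt_R0 x Hx).
  apply improper_unique with (fun u : R => RtoC (sqrt x) * gauss x (u, 0%R))%C.
  - apply improper_scal. now apply gauss_improper.
  - eapply improper_ext; [|apply (improper_scale _ (sqrt x) _ Hs (gauss_improper 1 Rlt_0_1))].
    intros u. simpl. f_equal. unfold gauss. f_equal.
    assert (E := sqrt_sqrt x ltac:(lra)).
    apply injective_projections; simpl; [|ring].
    transitivity (- (PI * (sqrt x * sqrt x)) * (u * u)). ring. rewrite E. ring.
Qed.

Lemma omega_pos x : 0 < x -> 0 <= omega x.
Proof.
  intros Hx. assert (H := omega_cv x Hx). apply cvC_Un_cv in H. destruct H as [H _].
  apply Rnot_lt_le. intros Hn. destruct (H (- omega x)) as [N HN]; [lra|].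
  specialize (HN N (Nat.le_refl _)). unfold Rdist in HN.
  assert (Y : 0 <= Re (csum (wterm x) N)).
  { clear. induction N. simpl. lra. simpl. assert (X := exp_pos (- (PI * x * (INR (S N) * INR (S N))))).
    unfold Re in IHN. simpl in X. simpl in *. lra. }
  simpl in HN. rewrite Rabs_pos_eq in HN; simpl in *; lra.
Qed.

(** At x = 1 both sides of [theta_hline] contain the same positive value, which forces
    [hline 1 0 = 1]; scaling by sqrt x then gives [hline x 0] for every x. *)
Theorem theta_modular x : 0 < x -> sqrt x * (1 + 2 * omega x) = 1 + 2 * omega (/ x).
Proof.
  intros Hx.
  assert (H1 : hline 1 0 = RtoC 1).
  { assert (H := theta_hline 1 Rlt_0_1). rewrite Rinv_1 in H.
    assert (Hp := omega_pos 1 Rlt_0_1).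
    assert (Hn : RtoC (1 + 2 * omega 1) <> RtoC 0) by (intros E; apply RtoC_inj in E; lra).
    replace (hline 1 0) with (hline 1 0 * RtoC (1 + 2 * omega 1) / RtoC (1 + 2 * omega 1))%C by (field; auto).
    rewrite <- H. field. auto. }
  apply RtoC_inj. rewrite RtoC_mult, (theta_hline x Hx).
  replace (RtoC (sqrt x) * (hline x 0 * RtoC (1 + 2 * omega (/ x))))%C
    with (RtoC (sqrt x) * hline x 0 * RtoC (1 + 2 * omega (/ x)))%C by ring.
  rewrite hline_sqrt, H1 by auto. ring.
Qed.

(** * The eta series *)

Definition eterm (s : C) (n : nat) : C := (RtoC ((-1) ^ n) * Rcpow (INR (S n)) (- s))%C.

(** Pairing consecutive terms gives absolute convergence on all of Re s > 0, with a telescoping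
    majorant from [cexp_diff_le]. *)
Definition pterm (s : C) (m : nat) : C :=
  (Rcpow (INR (S (2 * m))) (- s) - Rcpow (INR (S (S (2 * m)))) (- s))%C.

Lemma csum_eterm_even s n : csum (eterm s) (2 * n) = csum (pterm s) n.
Proof.
  induction n. reflexivity.
  replace (2 * S n)%nat with (S (S (2 * n))) by lia.
  change (csum (eterm s) (S (S (2 * n)))) with (csum (eterm s) (2 * n) + eterm s (2 * n) + eterm s (S (2 * n)))%C.
  change (csum (pterm s) (S n)) with (csum (pterm s) n + pterm s n)%C.
  rewrite IHn. unfold eterm, pterm. rewrite pow_1_even. rewrite pow_1_odd.
  replace (RtoC (-1)) with (- RtoC 1)%C by (apply injective_projections; simpl; ring). ring.
Qed.

Lemma Cmod_Rcpow b z : Cmod (Rcpow b z) = exp (Re z * ln b).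
Proof. unfold Rcpow. rewrite Cmod_cexp. f_equal. unfold Re; simpl; ring. Qed.

(* [e^(-s a) - e^(-s b)] is the integral of [s e^(-s v)] over [[a, b]]. *)
Lemma cexp_diff_le s d a b : 0 < d <= Re s -> 0 <= a <= b ->
  Cmod (cexp (- s * RtoC a) - cexp (- s * RtoC b))%C <= Cmod s / d * (exp (- (d * a)) - exp (- (d * b))).
Proof.
  intros Hd Hab.
  assert (I1 : isCI (fun v : R => s * cexp (- s * RtoC v))%C a b
    (cexp (- s * RtoC a) - cexp (- s * RtoC b))%C).
  { set (x := Re s). set (y := Im s).
    assert (Es : forall v, cexp (- s * RtoC v)%C = (exp (- x * v) * cos (- y * v), exp (- x * v) * sin (- y * v))).
    { intros v. unfold cexp, x, y. destruct s as [p q]. simpl.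
      replace (- p * v - - q * 0) with (- p * v) by ring. replace (- p * 0 + - q * v) with (- q * v) by ring.
      reflexivity. }
    rewrite !Es. apply isCI_pair.
    - replace (Re _) with (minus (- (exp (- x * b) * cos (- y * b))) (- (exp (- x * a) * cos (- y * a))))
        by (unfold minus, plus, opp; simpl; ring).
      apply (is_RInt_ext (fun v => x * (exp (- x * v) * cos (- y * v)) - y * (exp (- x * v) * sin (- y * v)))).
      { intros v _. rewrite Es. reflexivity. }
      apply (is_RInt_derive (V := R_CompleteNormedModule) (fun v => - (exp (- x * v) * cos (- y * v)))); intros v _.
      + auto_derive; auto. ring.
      + apply (ex_derive_continuous (V := R_NormedModule)). auto_derive. auto.
    - replace (Im _) with (minus (- (exp (- x * b) * sin (- y * b))) (- (exp (- x * a) * sin (- y * a))))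
        by (unfold minus, plus, opp; simpl; ring).
      apply (is_RInt_ext (fun v => x * (exp (- x * v) * sin (- y * v)) + y * (exp (- x * v) * cos (- y * v)))).
      { intros v _. rewrite Es. reflexivity. }
      apply (is_RInt_derive (V := R_CompleteNormedModule) (fun v => - (exp (- x * v) * sin (- y * v)))); intros v _.
      + auto_derive; auto. ring.
      + apply (ex_derive_continuous (V := R_NormedModule)). auto_derive. auto. }
  replace (Cmod s / d * (exp (- (d * a)) - exp (- (d * b))))
    with (minus (- (Cmod s / d) * exp (- (d * b))) (- (Cmod s / d) * exp (- (d * a))))
    by (unfold minus, plus, opp; simpl; ring).
  apply (isCI_Cmod_le (fun v : R => s * cexp (- s * RtoC v))%C (fun v => Cmod s * exp (- (d * v))) a b); auto.
  - lra.
  - intros v Hv. rewrite Cmod_mult, Cmod_cexp. apply Rmult_le_compat_l; [apply Cmod_ge_0|].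
    apply exp_mono. change (Re (- s * RtoC v)%C) with (- Re s * v - - Im s * 0). nra.
  - apply (is_RInt_derive (V := R_CompleteNormedModule) (fun x => - (Cmod s / d) * exp (- (d * x)))).
    + intros x _. auto_derive. auto. field. lra.
    + intros x _. apply (ex_derive_continuous (V := R_NormedModule)). auto_derive. auto.
Qed.

(** This is |s| / d times (2 m + 1)^(-d), with d a lower bound for Re s. *)
Definition pmaj (s : C) (d : R) (m : nat) : R := Cmod s / d * exp (- (d * ln (INR (S (2 * m))))).

Lemma ln_INR_S_le n m : (n <= m)%nat -> ln (INR (S n)) <= ln (INR (S m)).
Proof.
  intros H. apply le_n_S, le_INR in H. assert (X := lt_0_INR (S n) ltac:(lia)).
  destruct H as [H|H]. left. now apply ln_increasing. rewrite H; lra.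
Qed.

Lemma ln_INR_S_pos n : 0 <= ln (INR (S n)).
Proof. rewrite <- ln_1. apply (ln_INR_S_le 0 n). lia. Qed.

Lemma pterm_le s d m : 0 < d <= Re s -> Cmod (pterm s m) <= pmaj s d m - pmaj s d (S m).
Proof.
  intros Hd. unfold pterm, Rcpow, pmaj.
  eapply Rle_trans. apply (cexp_diff_le s d); auto.
  { split. apply ln_INR_S_pos. apply ln_INR_S_le. lia. }
  rewrite <- Rmult_minus_distr_l. apply Rmult_le_compat_l.
  - apply Rmult_le_pos; [apply Cmod_ge_0|]. left; apply Rinv_0_lt_compat; lra.
  (* The pair ends at 2 m + 2; replacing that by 2 m + 3 makes the majorant telescope. *)
  - apply Rplus_le_compat_l, Ropp_le_contravar, exp_mono.
    assert (X := ln_INR_S_le (S (2 * m)) (2 * S m) ltac:(lia)). nra.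
Qed.

Lemma exp_ln_small d D eps : 0 < d -> 0 < eps -> exists N, forall n, (N <= n)%nat ->
  D * exp (- (d * ln (INR (S n)))) <= eps.
Proof.
  intros Hd He. destruct (exp_small d D eps Hd He) as [T [HT K]].
  destruct (INR_unbounded (exp T)) as [N HN]. exists N. intros n Hn. apply K.
  rewrite <- (ln_exp T). left. apply ln_increasing. apply exp_pos.
  apply le_INR in Hn. rewrite S_INR. lra.
Qed.

(** [s] enters through its modulus only; later it is a real bound for |s'| over a disc or a
    rectangle. *)
Lemma pmaj_unif s d eps : 0 < d -> 0 < eps -> exists N, forall n s', (N <= n)%nat -> Cmod s' <= Cmod s ->
  pmaj s' d n <= eps.
Proof.
  intros Hd He. destruct (exp_ln_small d (Cmod s / d) eps Hd He) as [N HN].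
  exists N. intros n s' Hn Hs'. eapply Rle_trans; [|apply (HN (2 * n)%nat ltac:(lia))].
  unfold pmaj. apply Rmult_le_compat_r. left; apply exp_pos.
  apply Rmult_le_compat_r; auto. left; now apply Rinv_0_lt_compat.
Qed.

Lemma pmaj_pos s d n : 0 < d -> 0 <= pmaj s d n.
Proof.
  intros Hd. unfold pmaj. apply Rmult_le_pos. apply Rmult_le_pos; [apply Cmod_ge_0|].
  left; now apply Rinv_0_lt_compat. left; apply exp_pos.
Qed.

Lemma pmaj_cv s d : 0 < d -> Un_cv (pmaj s d) 0.
Proof.
  intros Hd eps He. destruct (pmaj_unif s d (eps / 2) Hd ltac:(lra)) as [N HN]. exists N. intros n Hn.
  unfold Rdist. rewrite Rminus_0_r, Rabs_pos_eq by now apply pmaj_pos.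
  specialize (HN n s Hn ltac:(lra)). lra.
Qed.

(** Even partial sums are those of the paired series; an odd one has one more term, which tends to 0
    because Re s > 0. *)
Lemma eta_cv s : 0 < Re s -> cvC (csum (eterm s)) (eta s) /\ eta s = CSeries (pterm s).
Proof.
  intros Hs.
  assert (H : cvC (csum (eterm s)) (CSeries (pterm s))).
  { destruct (tele_series (pterm s) (pmaj s (Re s))) as [H _].
    - intros m. apply pterm_le. lra.
    - apply pmaj_cv; auto.
    - intros eps He. destruct (H (eps / 2) ltac:(lra)) as [N1 H1].
      destruct (exp_ln_small (Re s) 1 (eps / 2) Hs ltac:(lra)) as [N2 H2].
      exists (2 * N1 + N2 + 1)%nat. intros n Hn.
      destruct (Nat.Even_or_Odd n) as [[m Hm]|[m Hm]]; subst n.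
      + rewrite csum_eterm_even. specialize (H1 m ltac:(lia)). lra.
      + replace (2 * m + 1)%nat with (S (2 * m)) by lia.
        change (csum (eterm s) (S (2 * m))) with (csum (eterm s) (2 * m) + eterm s (2 * m))%C.
        rewrite csum_eterm_even. specialize (H1 m ltac:(lia)).
        replace (csum (pterm s) m + eterm s (2 * m) - CSeries (pterm s))%C
          with ((csum (pterm s) m - CSeries (pterm s)) + eterm s (2 * m))%C by ring.
        eapply Rle_trans. apply Cmod_triangle.
        unfold eterm at 1. rewrite pow_1_even, Cmod_mult, Cmod_1, Rmult_1_l, Cmod_Rcpow.
        specialize (H2 (2 * m)%nat ltac:(lia)). rewrite Rmult_1_l in H2.
        change (Re (- s)%C) with (- Re s). rewrite Ropp_mult_distr_l in H2. lra. }
  assert (E : eta s = CSeries (pterm s)) by (apply (CSeries_unique (eterm s)), H).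
  split; auto. now rewrite E.
Qed.

Lemma eta_unif s d n : 0 < d <= Re s -> Cmod (csum (eterm s) (2 * n) - eta s)%C <= pmaj s d n.
Proof.
  intros Hd. destruct (eta_cv s) as [_ E]; [lra|]. rewrite E, csum_eterm_even.
  apply (tele_series (pterm s) (pmaj s d)). intros m. now apply pterm_le. apply pmaj_cv. lra.
Qed.

(** The remainder estimate after zero terms. *)
Lemma eta_le s d : 0 < d <= Re s -> Cmod (eta s) <= Cmod s / d.
Proof.
  intros Hd. assert (H := eta_unif s d 0 Hd). simpl csum in H.
  replace (0 - eta s)%C with (- eta s)%C in H by ring. rewrite Cmod_opp in H.
  unfold pmaj in H. simpl in H. rewrite ln_1, Rmult_0_r, Ropp_0, exp_0 in H. lra.
Qed.

Lemma cdiff_eterm n s : cdiff (fun w => eterm w n) s.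
Proof.
  unfold eterm, Rcpow. apply cdiff_mult. apply cdiff_const. apply cdiff_cexp.
  apply cdiff_mult; [|apply cdiff_const]. apply cdiff_opp, cdiff_id.
Qed.

Lemma ccont_eta s : 0 < Re s -> ccont eta s.
Proof.
  intros Hs.
  apply (ccont_unif (fun n w => csum (eterm w) (2 * n)) eta s (Re s / 2)). lra.
  - intros n. apply cdiff_ccont. apply (cdiff_csum (fun k w => eterm w k)). intros; apply cdiff_eterm.
  - intros eps He.
    destruct (pmaj_unif (RtoC (Cmod s + Re s)) (Re s / 2) eps ltac:(lra) He) as [N HN].
    exists N. intros w Hw.
    assert (X := re_le_Cmod (w - s)%C). change (Re (w - s)%C) with (Re w - Re s) in X.
    assert (Y := Rle_abs (- (Re w - Re s))). rewrite Rabs_Ropp in Y.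
    eapply Rle_trans. apply (eta_unif w (Re s / 2)). lra.
    apply HN. lia. rewrite Cmod_R, Rabs_pos_eq by (assert (Z := Cmod_ge_0 s); lra).
    replace w with (s + (w - s))%C by ring. eapply Rle_trans. apply Cmod_triangle. lra.
Qed.

(** |2^(1-s)| = 2^(1 - Re s) >= 2^d. The zeros of the denominator lie on Re s = 1, so the distance
    from that line gives a uniform bound. *)
Lemma zeta_den_low s d : 0 < d -> Re s <= 1 - d ->
  exp (d * ln 2) - 1 <= Cmod (1 - Rcpow 2 (1 - s))%C.
Proof.
  intros Hd Hs. rewrite Cmod_minus_sym. unfold Cminus.
  eapply Rle_trans; [|apply Cmod_ge_minus]. rewrite Cmod_opp, Cmod_1, Cmod_Rcpow.
  apply Rplus_le_compat_r, exp_mono. apply Rmult_le_compat_r.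
  left; rewrite <- ln_1; apply ln_increasing; lra.
  change (Re (1 + - s)%C) with (1 + - Re s). lra.
Qed.

Lemma exp_ln2_gt_1 d : 0 < d -> 0 < exp (d * ln 2) - 1.
Proof.
  intros Hd. assert (X : 0 < ln 2) by (rewrite <- ln_1; apply ln_increasing; lra).
  assert (Y := exp_ineq1 (d * ln 2)). assert (0 < d * ln 2) by nra. specialize (Y ltac:(lra)). lra.
Qed.

Lemma zeta_den_neq_0 s : Re s < 1 -> (1 - Rcpow 2 (1 - s))%C <> RtoC 0.
Proof.
  intros Hs. apply Cmod_gt_0. eapply Rlt_le_trans; [|apply (zeta_den_low s (1 - Re s)); lra].
  apply exp_ln2_gt_1. lra.
Qed.

Lemma zeta_le s d : 0 < d <= Re s -> Re s <= 1 - d ->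
  Cmod (zeta s) <= Cmod s / d / (exp (d * ln 2) - 1).
Proof.
  intros Hd Hs. unfold zeta. assert (X := exp_ln2_gt_1 d ltac:(lra)).
  assert (Y := zeta_den_low s d ltac:(lra) Hs).
  rewrite Cmod_div by (apply zeta_den_neq_0; lra).
  unfold Rdiv at 1 3. apply Rmult_le_compat.
  - apply Cmod_ge_0.
  - left. apply Rinv_0_lt_compat. lra.
  - now apply eta_le.
  - apply Rinv_le_contravar; lra.
Qed.

(** * Mellin transforms and the functional equation *)

(* Euler's integrand after the substitution [u = e^v].  All Mellin transforms are taken
   in the variable [v], where scaling becomes translation and inversion becomes reflection. *)
Definition gint (z : C) (v : R) : C := (cexp (RtoC v * z) * RtoC (exp (- exp v)))%C.

Lemma RCcont_cexp z (v : R) : RCcont (fun v : R => cexp (RtoC v * z)%C) v.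
Proof.
  apply (ccont_RCcont_h (fun w => cexp (RtoC (Re w) * z)%C) v 0).
  intros eps He. assert (H : ccont (fun w => cexp (w * z)%C) (RtoC v)).
  { apply cdiff_ccont, cdiff_cexp, cdiff_mult; [apply cdiff_id|apply cdiff_const]. }
  destruct (H eps He) as [d [Hd K]]. exists d. split; auto. intros w Hw. apply K.
  simpl. rewrite <- RtoC_minus, Cmod_R. eapply Rle_lt_trans; [|apply Hw].
  apply (re_le_Cmod (w - (v, 0%R))%C).
Qed.

Lemma exp_ge_sq v : 0 <= v -> v * v / 4 <= exp v.
Proof.
  intros Hv. replace v with (v / 2 + v / 2) at 3 by field. rewrite exp_plus.
  assert (X : 1 + v / 2 <= exp (v / 2)). { destruct Hv as [Hv| <-]. left; apply exp_ineq1; lra. rewrite Rdiv_0_l, exp_0; lra. }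
  nra.
Qed.

Lemma gint_improper z : 0 < Re z -> exists l, improper (gint z) l.
Proof.
  (* For v >= 0 the exponent is at most v Re z - v^2 / 4, and (v / 2 - 2 Re z)^2 >= 0 bounds this by
     4 (Re z)^2 - v Re z. For v < 0 the factor e^(v Re z) alone suffices. *)
  intros Hz. apply (improper_exists (gint z) (exp (4 * (Re z * Re z))) (Re z)); auto.
  - intros v. apply RCcont_mult. apply RCcont_cexp. apply RCcont_RtoC.
    apply (ex_derive_continuous (V := R_NormedModule)). auto_derive. auto.
  - intros v. unfold gint. rewrite Cmod_mult, Cmod_cexp, Cmod_R, Rabs_pos_eq by (left; apply exp_pos).
    rewrite <- !exp_plus. apply exp_mono.
    change (Re (RtoC v * z)%C) with (v * Re z - 0 * Im z).
    assert (E := exp_pos v). destruct (Rle_dec 0 v) as [Hv|Hv].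
    + rewrite Rabs_pos_eq by auto. assert (X := exp_ge_sq v Hv).
      assert (0 <= (v / 2 - 2 * Re z) * (v / 2 - 2 * Re z)) by apply Rle_0_sqr. nra.
    + rewrite Rabs_left by lra. nra.
Qed.

(** Under u = e^v the ends 0+ and +oo become -oo and +oo, and du = e^v dv raises the exponent z - 1
    to z. *)
Lemma improper_CGamma z l : improper (gint z) l -> CGamma z = l.
Proof.
  intros [E H]. unfold CGamma.
  apply (is_RInt_gen_unique (V := C_R_CompleteNormedModule)).
  set (f := fun u : R => (Rcpow u (z - RtoC 1) * RtoC (exp (- u)))%C).
  assert (Hf : forall u, 0 < u -> RCcont f u).
  { intros u Hu. apply RCcont_mult.
    - apply (continuous_comp (fun u : R => ln u) (fun v : R => cexp ((z - RtoC 1) * RtoC v)%C)).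
      + apply (ex_derive_continuous (V := R_NormedModule)). auto_derive. auto.
      + apply (continuous_ext (fun v : R => cexp (RtoC v * (z - RtoC 1))%C)).
        intros; f_equal; ring. apply RCcont_cexp.
    - apply RCcont_RtoC. apply (ex_derive_continuous (V := R_NormedModule)). auto_derive. auto. }
  assert (K : forall a b, isCI f (exp a) (exp b) (CI (gint z) a b)).
  { intros a b.
    assert (X := is_RInt_comp (V := C_R_CompleteNormedModule) f exp exp a b).
    assert (X1 : isCI (fun y => scal (V := C_R_NormedModule) (exp y) (f (exp y))) a b (CI f (exp a) (exp b))).
    { apply X.
      - intros v _. apply Hf, exp_pos.
      - intros v _. split. apply is_derive_exp. apply (ex_derive_continuous (V := R_NormedModule)). auto_derive. auto. }
    assert (Ef : exCI f (exp a) (exp b)).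
    { apply exCI_cont. intros u Hu. apply Hf.
      assert (Pa := exp_pos a). assert (Pb := exp_pos b).
      apply Rlt_le_trans with (Rmin (exp a) (exp b)); [now apply Rmin_pos|lra]. }
    replace (CI (gint z) a b) with (CI f (exp a) (exp b)). now apply CI_correct.
    symmetry. apply CI_unique. eapply isCI_ext; [|apply X1].
    intros v _. simpl. unfold f, gint, Rcpow. rewrite ln_exp.
    transitivity (RtoC (exp v) * (cexp ((z - 1) * RtoC v) * RtoC (exp (- exp v))))%C.
    apply injective_projections; simpl; unfold scal; simpl; unfold mult; simpl; ring.
    rewrite <- cexp_RtoC, Cmult_assoc, <- cexp_plus. f_equal. f_equal. ring. }
  intros P [eps HP].
  destruct (H (eps / 2)) as [T [HT Q]]. { apply is_pos_div_2. }
  apply Filter_prod with (fun a => 0 < a < exp (- T)) (fun b => exp T < b).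
  - exists (mkposreal _ (exp_pos (- T))). intros a Ha Ha0. split; auto.
    change (Rabs (a - 0) < exp (- T)) in Ha. rewrite Rminus_0_r, Rabs_pos_eq in Ha; lra.
  - exists (exp T). auto.
  - intros a b [Ha1 Ha2] Hb. simpl. assert (ET := exp_pos T).
    exists (CI (gint z) (ln a) (ln b)). split.
    + rewrite <- (exp_ln a) at 1 by auto. rewrite <- (exp_ln b) at 1 by lra. apply K.
    + apply HP. apply (C_NormedModule_mixin_compat1 l).
      eapply Rle_lt_trans. apply Q.
      * rewrite <- (ln_exp (- T)). left. now apply ln_increasing.
      * rewrite <- (ln_exp T). left. now apply ln_increasing.
      * assert (X := cond_pos eps). lra.
Qed.

Lemma CGamma_improper z : 0 < Re z -> improper (gint z) (CGamma z).
Proof.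
  intros Hz. destruct (gint_improper z Hz) as [l Hl]. now rewrite (improper_CGamma z l Hl).
Qed.

Lemma CGamma_conj z : 0 < Re z -> CGamma (Cconj z) = Cconj (CGamma z).
Proof.
  intros Hz. apply improper_CGamma.
  apply improper_ext with (fun v => Cconj (gint z v)).
  - intros v. unfold gint. rewrite Cmult_conj, cexp_conj, Cmult_conj. f_equal.
    + do 2 f_equal. apply injective_projections; simpl; ring.
    + apply injective_projections; simpl; ring.
  - apply improper_conj, CGamma_improper, Hz.
Qed.

(* [x ^ (-1/2) / 2] is the asymptotic value of [omega x] at [0]; once it is removed,
   the Mellin transform converges exactly in the critical strip. *)
Definition phi (x : R) : R := omega x - / (2 * sqrt x).

(** The terms sqrt x / 2 and 1/2 of Jacobi's identity are exactly those which [phi] removes from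
    [omega] at 1 / x and, after multiplication by sqrt x, at x. *)
Lemma phi_inv x : 0 < x -> phi (/ x) = sqrt x * phi x.
Proof.
  intros Hx. assert (H := theta_modular x Hx). assert (Hs := sqrt_lt_R0 x Hx).
  unfold phi. rewrite sqrt_inv.
  replace (/ (2 * / sqrt x)) with (sqrt x / 2) by (field; lra).
  replace (sqrt x * (omega x - / (2 * sqrt x))) with (sqrt x * omega x - / 2) by (field; lra).
  lra.
Qed.

Lemma Cmod_wterm x n : Cmod (wterm x n) = exp (- (PI * x * (INR (S n) * INR (S n)))).
Proof. unfold wterm. rewrite Cmod_R. apply Rabs_pos_eq. left; apply exp_pos. Qed.

(** Since n^2 >= n, [omega x] is at most q / (1 - q) with q = e^(-pi x), and q (1 + x) <= 1 turns
    this into 1 / x. Decay of order x^(-1/2) is what is wanted, because the term subtracted in [phi]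
    decays no faster. *)
Lemma omega_le x : 1 <= x -> omega x <= 2 * / sqrt x.
Proof.
  intros Hx. assert (P := PI_RGT_0). assert (P2 := PI2_1).
  assert (Hp := PI_mult_pos x ltac:(lra)). destruct (exp_neg_lt_1 _ Hp) as [Q0 Q1].
  set (q := exp (- (PI * x))) in *.
  assert (Hq : q * (1 + x) <= 1).
  { unfold q. rewrite exp_Ropp. apply Rmult_le_reg_l with (exp (PI * x)). apply exp_pos.
    rewrite <- Rmult_assoc, Rinv_r by (apply Rgt_not_eq, exp_pos).
    assert (X := exp_ineq1 (PI * x) ltac:(lra)). nra. }
  assert (B : Cmod (csum (wterm x) 0 - CSeries (wterm x))%C <= q ^ 1 / (1 - q)).
  { apply (tele_series (wterm x) (fun n => q ^ S n / (1 - q))).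
    - intros n. rewrite Cmod_wterm.
      replace (q ^ S n / (1 - q) - q ^ S (S n) / (1 - q)) with (q ^ S n) by (simpl; field; lra).
      unfold q. rewrite exp_pow. apply exp_mono.
      assert (1 <= INR (S n)) by (rewrite S_INR; assert (Z := pos_INR n); lra).
      assert (0 <= PI * x * (INR (S n) * INR (S n) - INR (S n))) by (apply Rmult_le_pos; nra). lra.
    - apply is_lim_seq_Reals.
      apply (is_lim_seq_ext (fun n => q / (1 - q) * q ^ n)). intros; simpl; field; lra.
      replace (Finite 0) with (Rbar_mult (q / (1 - q)) 0) by (simpl; f_equal; ring).
      apply is_lim_seq_scal_l. apply is_lim_seq_geom. rewrite Rabs_pos_eq; lra. }
  rewrite omega_CSeries in B. simpl csum in B. rewrite <- RtoC_minus, Cmod_R in B.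
  replace (0 - omega x) with (- omega x) in B by ring. rewrite Rabs_Ropp in B.
  rewrite Rabs_pos_eq in B by (apply omega_pos; lra). rewrite pow_1 in B.
  assert (B2 : q / (1 - q) <= / x).
  { apply Rmult_le_reg_l with (x * (1 - q)). nra.
    replace (x * (1 - q) * (q / (1 - q))) with (x * q) by (field; lra).
    replace (x * (1 - q) * / x) with (1 - q) by (field; lra). lra. }
  assert (B3 : / x <= / sqrt x).
  { apply Rinv_le_contravar. apply sqrt_lt_R0; lra.
    rewrite <- (sqrt_square x) at 2 by lra. apply sqrt_le_1; nra. }
  assert (0 < / sqrt x) by (apply Rinv_0_lt_compat, sqrt_lt_R0; lra). lra.
Qed.

Definition Mphi (v : R) : R := phi (exp v).

Lemma sqrt_exp v : sqrt (exp v) = exp (v / 2).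
Proof.
  replace v with (v / 2 + v / 2) at 1 by field. rewrite exp_plus. apply sqrt_square. left; apply exp_pos.
Qed.

Lemma Mphi_opp v : Mphi (- v) = exp (v / 2) * Mphi v.
Proof. unfold Mphi. rewrite exp_Ropp, phi_inv, sqrt_exp by apply exp_pos. reflexivity. Qed.

Lemma Mphi_le_pos v : 0 <= v -> Rabs (Mphi v) <= 3 * exp (- (v / 2)).
Proof.
  intros Hv. assert (E : 1 <= exp v) by (rewrite <- exp_0; now apply exp_mono).
  unfold Mphi, phi. assert (A := omega_le (exp v) E). assert (B := omega_pos (exp v) ltac:(lra)).
  rewrite sqrt_exp in *. rewrite exp_Ropp. assert (X := exp_pos (v / 2)).
  assert (Y := Rinv_0_lt_compat _ X).
  replace (/ (2 * exp (v / 2))) with (/ exp (v / 2) / 2) by (field; lra).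
  apply Rabs_le. lra.
Qed.

(** The factor e^(v/2) in the reflection cancels the decay at +oo exactly. Together with
    [Mphi_le_pos] this makes 0 < Re s < 1 the range of convergence of the transform. *)
Lemma Mphi_le_neg v : v <= 0 -> Rabs (Mphi v) <= 3.
Proof.
  intros Hv. replace v with (- (- v)) by ring. rewrite Mphi_opp.
  rewrite Rabs_mult, Rabs_pos_eq by (left; apply exp_pos).
  assert (H := Mphi_le_pos (- v) ltac:(lra)).
  apply Rle_trans with (exp (- v / 2) * (3 * exp (- (- v / 2)))).
  apply Rmult_le_compat_l; auto. left; apply exp_pos.
  rewrite exp_Ropp. right. field. apply Rgt_not_eq, exp_pos.
Qed.

Lemma omega_cont x : 0 < x -> continuous omega x.
Proof.
  intros Hx.
  apply (continuous_ext (fun t => Re (RtoC (omega t)))). reflexivity.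
  apply RCcont_Re. apply ccont_RCcont_eps. intros eps He.
  (* The terms decrease in t, so the majorant at x / 2 serves all t >= x / 2 at once. *)
  destruct (hmaj_cv (x / 2) 0 ltac:(lra) (eps / 4) ltac:(lra)) as [N HN].
  specialize (HN N (Nat.le_refl _)). unfold Rdist in HN. rewrite Rminus_0_r in HN.
  assert (HN' := Rle_lt_trans _ _ _ (Rle_abs _) HN).
  assert (U : forall t, x / 2 <= t -> Cmod (csum (wterm t) N - RtoC (omega t))%C <= eps / 4).
  { intros t Ht. rewrite <- omega_CSeries. apply Rle_trans with (hmaj (x / 2) 0 N); [|lra].
    apply (tele_series (wterm t) (hmaj (x / 2) 0)); [|apply hmaj_cv; lra].
    intros n. eapply Rle_trans; [|apply wterm_le; lra]. rewrite !Cmod_wterm. apply exp_mono.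
    assert (0 <= INR (S n) * INR (S n)) by apply Rle_0_sqr. assert (P := PI_RGT_0).
    assert (0 <= PI * (t - x / 2) * (INR (S n) * INR (S n))) by (apply Rmult_le_pos; auto; nra). lra. }
  assert (Cs : forall n, RCcont (fun t => csum (wterm t) n) x).
  { induction n; simpl. apply continuous_const.
    apply (continuous_plus (V := C_R_NormedModule)); auto. unfold wterm. apply RCcont_RtoC.
    apply (ex_derive_continuous (V := R_NormedModule)). auto_derive. auto. }
  assert (Cr := RCcont_Re _ _ (Cs N)). assert (Ci' := RCcont_Im _ _ (Cs N)).
  apply continuity_pt_filterlim in Cr. apply continuity_pt_filterlim in Ci'.
  destruct (Cr (eps / 8) ltac:(lra)) as [d1 [Hd1 D1]].
  destruct (Ci' (eps / 8) ltac:(lra)) as [d2 [Hd2 D2]].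
  exists (Rmin (x / 2) (Rmin d1 d2)). split; [repeat apply Rmin_pos; auto; lra|].
  intros t Ht.
  assert (T1 := Rlt_le_trans _ _ _ Ht (Rmin_l _ _)).
  assert (T2 := Rlt_le_trans _ _ _ Ht (Rmin_r _ _)).
  assert (T3 := Rlt_le_trans _ _ _ T2 (Rmin_l _ _)).
  assert (T4 := Rlt_le_trans _ _ _ T2 (Rmin_r _ _)).
  apply Rabs_lt_between in T1.
  assert (V1 := U t ltac:(lra)). assert (V2 := U x ltac:(lra)).
  assert (V3 : Cmod (csum (wterm t) N - csum (wterm x) N)%C <= eps / 4).
  { destruct (Req_dec t x) as [->|Hne].
    - replace (csum (wterm x) N - csum (wterm x) N)%C with (RtoC 0) by ring. rewrite Cmod_0; lra.
    - eapply Rle_trans. apply Cmod_le_abs.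
      assert (W1 := D1 t (conj (conj I (not_eq_sym Hne)) T3)). assert (W2 := D2 t (conj (conj I (not_eq_sym Hne)) T4)).
      simpl in W1, W2. unfold Rdist in W1, W2.
      change (Re (csum (wterm t) N - csum (wterm x) N)%C) with (Re (csum (wterm t) N) - Re (csum (wterm x) N)).
      change (Im (csum (wterm t) N - csum (wterm x) N)%C) with (Im (csum (wterm t) N) - Im (csum (wterm x) N)).
      lra. }
  replace (RtoC (omega t) - RtoC (omega x))%C with ((csum (wterm t) N - csum (wterm x) N) +
    ((csum (wterm x) N - RtoC (omega x)) - (csum (wterm t) N - RtoC (omega t))))%C by ring.
  eapply Rle_lt_trans. apply Cmod_triangle.
  assert (X := Cmod_minus_le (csum (wterm x) N - RtoC (omega x))%C (csum (wterm t) N - RtoC (omega t))%C). lra.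
Qed.

Lemma Mphi_cont v : continuous Mphi v.
Proof.
  unfold Mphi. apply (continuous_comp exp phi).
  apply (ex_derive_continuous (V := R_NormedModule)). auto_derive. auto.
  unfold phi. assert (E := exp_pos v). assert (S := sqrt_lt_R0 _ E).
  apply (continuous_minus (V := R_NormedModule) omega (fun x => / (2 * sqrt x))).
  apply omega_cont; auto.
  apply (ex_derive_continuous (V := R_NormedModule)). auto_derive. split; auto. split; auto. lra.
Qed.

(** Integrand of the transform of phi(x) x^(s/2) dx / x, with x = e^v. *)
Definition fint (s : C) (v : R) : C := (RtoC (Mphi v) * cexp (RtoC v * (s / 2)))%C.

Lemma fint_improper s : 0 < Re s < 1 -> exists l, improper (fint s) l.
Proof.
  (* The decay rates are (1 - Re s) / 2 at +oo and Re s / 2 at -oo; [c] is the smaller. *)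
  intros Hs. set (c := Rmin (Re s) (1 - Re s) / 2).
  assert (Hc1 : c <= Re s / 2) by (unfold c; assert (X := Rmin_l (Re s) (1 - Re s)); lra).
  assert (Hc2 : c <= (1 - Re s) / 2) by (unfold c; assert (X := Rmin_r (Re s) (1 - Re s)); lra).
  assert (Hc : 0 < c) by (unfold c; assert (0 < Rmin (Re s) (1 - Re s)) by (apply Rmin_pos; lra); lra).
  apply (improper_exists (fint s) 3 c Hc).
  - intros v. apply RCcont_mult. apply RCcont_RtoC, Mphi_cont. apply RCcont_cexp.
  - intros v. unfold fint. rewrite Cmod_mult, Cmod_cexp, Cmod_R.
    replace (Re (RtoC v * (s / 2))%C) with (v * Re s / 2)
      by (destruct s; simpl; field).
    destruct (Rle_dec 0 v) as [Hv|Hv].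
    + rewrite (Rabs_pos_eq v) by auto. apply Rle_trans with (3 * exp (- (v / 2)) * exp (v * Re s / 2)).
      apply Rmult_le_compat_r. left; apply exp_pos. now apply Mphi_le_pos.
      rewrite Rmult_assoc, <- exp_plus. apply Rmult_le_compat_l; [lra|]. apply exp_mono. nra.
    + rewrite (Rabs_left v) by lra. apply Rmult_le_compat. apply Rabs_pos. left; apply exp_pos.
      apply Mphi_le_neg; lra. apply exp_mono. nra.
Qed.

(** The inversion x -> 1 / x: the factor e^(v/2) from [Mphi_opp] turns e^(-v s / 2) into e^(v (1 -
    s) / 2). This is where s and 1 - s are exchanged. *)
Lemma fint_reflect s v : fint s (- v) = fint (1 - s)%C v.
Proof.
  unfold fint. rewrite Mphi_opp, RtoC_mult, <- cexp_RtoC.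
  transitivity (RtoC (Mphi v) * (cexp (RtoC (v / 2)) * cexp (RtoC (- v) * (s / 2))))%C. ring.
  rewrite <- cexp_plus. do 2 f_equal. destruct s. apply injective_projections; simpl; field.
Qed.

(** * The alternating theta series and its transform *)

(** [omega (4 * x)] collects the even n of [omega x], so this is the alternating sum with positive
    first term. *)
Definition psi (x : R) : R := omega x - 2 * omega (4 * x).

(** The corrections cancel because sqrt (4 x) = 2 sqrt x. *)
Lemma psi_phi x : 0 < x -> psi x = phi x - 2 * phi (4 * x).
Proof.
  intros Hx. unfold psi, phi. assert (S := sqrt_lt_R0 x Hx).
  rewrite sqrt_mult by lra. replace (sqrt 4) with 2. field. lra.
  replace 4 with (2 * 2) by ring. symmetry. apply sqrt_square. lra.
Qed.

Lemma csum_alt x n : csum (fun k => RtoC ((-1) ^ k) * wterm x k)%C (2 * n) =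
  (csum (wterm x) (2 * n) - 2 * csum (wterm (4 * x)) n)%C.
Proof.
  induction n. simpl. ring.
  replace (2 * S n)%nat with (S (S (2 * n))) by lia.
  set (a := fun k => (RtoC ((-1) ^ k) * wterm x k)%C) in *.
  change (csum a (S (S (2 * n)))) with (csum a (2 * n) + a (2 * n)%nat + a (S (2 * n)))%C.
  change (csum (wterm x) (S (S (2 * n)))) with (csum (wterm x) (2 * n) + wterm x (2 * n) + wterm x (S (2 * n)))%C.
  change (csum (wterm (4 * x)) (S n)) with (csum (wterm (4 * x)) n + wterm (4 * x) n)%C.
  rewrite IHn. unfold a. rewrite pow_1_even, pow_1_odd.
  replace (wterm (4 * x) n) with (wterm x (S (2 * n))).
  replace (RtoC (-1)) with (- RtoC 1)%C by (apply injective_projections; simpl; lra). ring.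
  unfold wterm. do 2 f_equal. rewrite !S_INR, mult_INR. simpl. ring.
Qed.

Lemma alt_sum_f_R0 x n : csum (fun k => RtoC ((-1) ^ k) * wterm x k)%C (S n) =
  RtoC (sum_f_R0 (tg_alt (fun k => exp (- (PI * x * (INR (S k) * INR (S k)))))) n).
Proof.
  induction n.
  - change (csum (fun k => RtoC ((-1) ^ k) * wterm x k)%C 1) with (0 + RtoC ((-1) ^ 0) * wterm x 0)%C.
    change (sum_f_R0 (tg_alt (fun k => exp (- (PI * x * (INR (S k) * INR (S k)))))) 0)
      with ((-1) ^ 0 * exp (- (PI * x * (INR 1 * INR 1)))).
    rewrite RtoC_mult. unfold wterm. ring.
  - change (csum (fun k => RtoC ((-1) ^ k) * wterm x k)%C (S (S n)))
      with (csum (fun k => RtoC ((-1) ^ k) * wterm x k) (S n) + RtoC ((-1) ^ S n) * wterm x (S n))%C.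
    rewrite IHn, tech5, RtoC_plus. unfold tg_alt at 3. rewrite RtoC_mult. reflexivity.
Qed.

(** Leibniz: the terms decrease in modulus, so the remainder is at most the first omitted term. The
    bound is integrable in x against x^(s/2) dx / x for every Re s > 0, where absolute summation
    would need Re s > 1. *)
Lemma psi_alt x n : 0 < x ->
  Cmod (RtoC (psi x) - csum (fun k => RtoC ((-1) ^ k) * wterm x k) (2 * S n))%C <=
  exp (- (PI * x * (INR (S (2 * S n)) * INR (S (2 * S n))))).
Proof.
  intros Hx. assert (Hp := PI_mult_pos x Hx).
  set (Un := fun k => exp (- (PI * x * (INR (S k) * INR (S k))))).
  assert (Hdec : Un_decreasing Un).
  { intros k. unfold Un. apply exp_mono. assert (X := pos_INR k). rewrite !S_INR.
    apply Ropp_le_contravar, Rmult_le_compat_l; nra. }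
  assert (Hcv : Un_cv Un 0).
  { intros eps He. destruct (exp_small (PI * x) 1 (eps / 2) Hp ltac:(lra)) as [T [HT K]].
    destruct (INR_unbounded T) as [N HN]. exists N. intros k Hk. apply le_INR in Hk.
    unfold Rdist. rewrite Rminus_0_r, Rabs_pos_eq by (left; apply exp_pos).
    assert (Y : 1 <= INR (S k)) by (rewrite S_INR; assert (X := pos_INR k); lra).
    assert (Y2 : T <= INR (S k)) by (rewrite S_INR; lra).
    specialize (K (INR (S k) * INR (S k)) ltac:(nra)). rewrite Rmult_1_l in K. unfold Un. lra. }
  destruct (alternated_series Un Hdec Hcv) as [l Hl].
  assert (El : l = psi x).
  { assert (C1 : cvC (fun n => csum (fun k => RtoC ((-1) ^ k) * wterm x k)%C (S n)) (RtoC l)).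
    { apply cvC_Un_cv. split.
      - intros eps He. destruct (Hl eps He) as [N HN]. exists N. intros m Hm.
        rewrite alt_sum_f_R0. apply HN. auto.
      - intros eps He. exists 0%nat. intros m Hm. rewrite alt_sum_f_R0. simpl. unfold Rdist.
        rewrite Rminus_0_r, Rabs_R0. auto. }
    apply RtoC_inj. apply cvC_unique with (fun n => csum (fun k => RtoC ((-1) ^ k) * wterm x k)%C (2 * S n)).
    - intros eps He. destruct (C1 eps He) as [N HN]. exists N. intros m Hm.
      replace (2 * S m)%nat with (S (S (2 * m))) by lia. apply HN. lia.
    - apply cvC_ext with (fun n => csum (wterm x) (2 * S n) + (- RtoC 2) * csum (wterm (4 * x)) (S n))%C.
      intros m. rewrite csum_alt. ring.
      unfold psi. rewrite RtoC_minus, RtoC_mult.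
      replace (RtoC (omega x) - 2 * RtoC (omega (4 * x)))%C with (RtoC (omega x) + (- RtoC 2) * RtoC (omega (4 * x)))%C by ring.
      apply cvC_plus.
      + intros eps He. destruct (omega_cv x Hx eps He) as [N HN]. exists N. intros m Hm. apply HN. lia.
      + apply cvC_scal. intros eps He. destruct (omega_cv (4 * x) ltac:(lra) eps He) as [N HN].
        exists N. intros m Hm. apply HN. lia. }
  subst l.
  (* The lower bound of index n and the upper bound of index n + 1 enclose [psi x] between the sum
     of the first 2 n + 2 terms and that sum plus the next term. *)
  assert (I1 := alternated_series_ineq Un (psi x) n Hdec Hcv Hl).
  assert (I2 := alternated_series_ineq Un (psi x) (S n) Hdec Hcv Hl).
  replace (2 * S n)%nat with (S (S (2 * n))) by lia.
  rewrite alt_sum_f_R0. fold Un. rewrite <- RtoC_minus, Cmod_R.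
  replace (2 * S n)%nat with (S (S (2 * n))) in I2 by lia.
  assert (E2 : sum_f_R0 (tg_alt Un) (S (S (2 * n))) = sum_f_R0 (tg_alt Un) (S (2 * n)) + Un (S (S (2 * n)))).
  { rewrite tech5. f_equal. unfold tg_alt. replace (S (S (2 * n))) with (2 * S n)%nat by lia.
    rewrite pow_1_even. ring. }
  rewrite E2 in I2. rewrite Rabs_pos_eq by lra. unfold Un in *. lra.
Qed.

(** Translating v by this amount multiplies e^v by pi (n + 1)^2, which reduces the transform of one
    term to a translate of Euler's integral. *)
Definition wlog (n : nat) : R := ln PI + 2 * ln (INR (S n)).

Lemma exp_wlog n : exp (wlog n) = PI * (INR (S n) * INR (S n)).
Proof.
  unfold wlog. assert (X := lt_0_INR (S n) ltac:(lia)).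
  replace (2 * ln (INR (S n))) with (ln (INR (S n)) + ln (INR (S n))) by ring.
  rewrite !exp_plus, !exp_ln by (auto; apply PI_RGT_0). reflexivity.
Qed.

Lemma wterm_mellin z n : 0 < Re z ->
  improper (fun v => wterm (exp v) n * cexp (RtoC v * z))%C (cexp (- (RtoC (wlog n) * z)) * CGamma z)%C.
Proof.
  intros Hz. apply improper_ext with (fun v => cexp (- (RtoC (wlog n) * z)) * gint z (v + wlog n))%C.
  - intros v. unfold gint, wterm. rewrite exp_plus, exp_wlog.
    replace (- (exp v * (PI * (INR (S n) * INR (S n))))) with (- (PI * exp v * (INR (S n) * INR (S n)))) by ring.
    rewrite Cmult_assoc, <- cexp_plus, Cmult_comm. do 2 f_equal. rewrite RtoC_plus. ring.
  - apply improper_scal. apply improper_shift. now apply CGamma_improper.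
Qed.

Lemma wlog_cexp s n : cexp (- (RtoC (wlog n) * (s / 2)))%C = (Rcpow PI (- (s / 2)) * Rcpow (INR (S n)) (- s))%C.
Proof.
  unfold Rcpow, wlog. rewrite <- cexp_plus. f_equal. destruct s. apply injective_projections; simpl; field.
Qed.

(** Each partial sum transforms into the factor pi^(-s/2) Gamma(s/2) times a partial sum of eta; the
    passage to the limit rests on [psi_alt]. *)
Lemma eta_mellin s Ps : 0 < Re s ->
  improper (fun v => RtoC (psi (exp v)) * cexp (RtoC v * (s / 2)))%C Ps ->
  (Rcpow PI (- (s / 2)) * CGamma (s / 2) * eta s)%C = Ps.
Proof.
  intros Hs HPs.
  assert (Hs2 : Re (s / 2)%C = Re s / 2) by (destruct s; simpl; field).
  set (K := (Rcpow PI (- (s / 2)) * CGamma (s / 2))%C).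
  assert (Hpart : forall n, improper (fun v => csum (fun k => RtoC ((-1) ^ k) * wterm (exp v) k) n * cexp (RtoC v * (s / 2)))%C
    (K * csum (eterm s) n)%C).
  { intros n. rewrite <- csum_scal.
    apply improper_ext with (fun v => csum (fun k => RtoC ((-1) ^ k) * (wterm (exp v) k * cexp (RtoC v * (s / 2))))%C n).
    - intros v. rewrite (Cmult_comm (csum _ n)), <- csum_scal. apply csum_ext. intros k. ring.
    - rewrite (csum_ext _ (fun k => RtoC ((-1) ^ k) * (cexp (- (RtoC (wlog k) * (s / 2))) * CGamma (s / 2)))%C).
      + apply (improper_csum (fun k v => RtoC ((-1) ^ k) * (wterm (exp v) k * cexp (RtoC v * (s / 2))))%C).
        intros k. apply improper_scal. apply wterm_mellin. lra.
      + intros k. unfold K, eterm. rewrite wlog_cexp. ring. }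
  apply cvC_unique with (fun n => K * csum (eterm s) (2 * S n))%C.
  - apply cvC_scal. destruct (eta_cv s Hs) as [H _]. intros eps He. destruct (H eps He) as [N HN].
    exists N. intros m Hm. apply HN. lia.
  (* The error is dominated by the transform of the first omitted term at the real exponent Re s /
     2, again known from [wterm_mellin]: a constant times (m + 1)^(-Re s). *)
  - set (r := RtoC (Re s / 2)). assert (Hr : 0 < Re r) by (simpl; lra).
    intros eps He.
    destruct (exp_ln_small (Re s) (exp (- (ln PI * (Re s / 2))) * Cmod (CGamma r)) eps Hs He) as [N HN].
    exists N. intros n Hn. rewrite Cmod_minus_sym.
    set (m := (2 * S n)%nat) in *.
    set (g := fun v => exp (- (PI * exp v * (INR (S m) * INR (S m)))) * exp (v * (Re s / 2))).
    assert (Hg : improper (fun v => RtoC (g v)) (cexp (- (RtoC (wlog m) * r)) * CGamma r)%C).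
    { eapply improper_ext; [|apply (wterm_mellin r m Hr)].
      intros v. unfold g, wterm. rewrite RtoC_mult. f_equal. unfold r. rewrite <- RtoC_mult. apply cexp_RtoC. }
    eapply Rle_trans. eapply improper_le; [|apply (improper_minus _ _ _ _ HPs (Hpart m))|apply Hg].
    + intros v. cbv beta.
      replace (RtoC (psi (exp v)) * cexp (RtoC v * (s / 2)) - csum (fun k : nat => RtoC ((-1) ^ k) * wterm (exp v) k) m * cexp (RtoC v * (s / 2)))%C
        with ((RtoC (psi (exp v)) - csum (fun k : nat => RtoC ((-1) ^ k) * wterm (exp v) k) m) * cexp (RtoC v * (s / 2)))%C by ring.
      rewrite Cmod_mult, Cmod_cexp.
      replace (Re (RtoC v * (s / 2))%C) with (v * (Re s / 2)) by (destruct s; simpl; field).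
      apply Rmult_le_compat_r. left; apply exp_pos. apply psi_alt. apply exp_pos.
    + eapply Rle_trans; [|apply (HN m ltac:(lia))].
      eapply Rle_trans. apply Rle_abs. eapply Rle_trans. apply re_le_Cmod.
      rewrite Cmod_mult, Cmod_cexp. unfold r at 1, wlog.
      replace (Re (- (RtoC (ln PI + 2 * ln (INR (S m))) * RtoC (Re s / 2)))%C)
        with (- (ln PI * (Re s / 2)) + - (Re s * ln (INR (S m)))) by (unfold Re; simpl; field).
      rewrite exp_plus. right. ring.
Qed.

Theorem zeta_functional s : 0 < Re s < 1 ->
  (Rcpow PI (- (s / 2)) * CGamma (s / 2) * zeta s =
   Rcpow PI (- ((1 - s) / 2)) * CGamma ((1 - s) / 2) * zeta (1 - s))%C.
Proof.
  (* The completed zeta function is identified with the transform of [phi] for every s in the strip;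
     the functional equation is then the reflection v -> -v. *)
  revert s. assert (Main : forall s l, 0 < Re s < 1 -> improper (fint s) l ->
    (Rcpow PI (- (s / 2)) * CGamma (s / 2) * zeta s)%C = l).
  { intros s l Hs Hl.
    assert (Hd := zeta_den_neq_0 s ltac:(lra)).
    (* The scaling by 4 contributes 4^(-s/2), and 2 times this is 2^(1-s), so the transform of [psi]
       carries exactly the denominator of zeta. *)
    assert (H2 : (2 * cexp (- (RtoC (ln 4) * (s / 2))))%C = Rcpow 2 (1 - s)).
    { unfold Rcpow. replace 2 with (exp (ln 2)) at 1 by (apply exp_ln; lra).
      rewrite <- cexp_RtoC, <- cexp_plus. f_equal.
      replace (ln 4) with (ln 2 + ln 2) by (rewrite <- ln_mult by lra; f_equal; ring).
      destruct s. apply injective_projections; simpl; field. }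
    assert (HP : improper (fun v => RtoC (psi (exp v)) * cexp (RtoC v * (s / 2)))%C
      (l - 2 * cexp (- (RtoC (ln 4) * (s / 2))) * l)%C).
    { apply improper_ext with (fun v => fint s v - 2 * cexp (- (RtoC (ln 4) * (s / 2))) * fint s (v + ln 4))%C.
      - intros v. unfold fint, Mphi. rewrite psi_phi by apply exp_pos.
        rewrite exp_plus, exp_ln by lra. rewrite (Rmult_comm (exp v) 4).
        rewrite RtoC_minus, RtoC_mult.
        replace (2 * cexp (- (RtoC (ln 4) * (s / 2))) * (RtoC (phi (4 * exp v)) * cexp (RtoC (v + ln 4) * (s / 2))))%C
          with (2 * RtoC (phi (4 * exp v)) * (cexp (- (RtoC (ln 4) * (s / 2))) * cexp (RtoC (v + ln 4) * (s / 2))))%C by ring.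
        rewrite <- cexp_plus.
        replace (- (RtoC (ln 4) * (s / 2)) + RtoC (v + ln 4) * (s / 2))%C with (RtoC v * (s / 2))%C
          by (rewrite RtoC_plus; ring). ring.
      - apply improper_minus; auto. apply improper_scal. now apply improper_shift. }
    apply eta_mellin in HP; [|lra]. rewrite H2 in HP. unfold zeta.
    replace (Rcpow PI (- (s / 2)) * CGamma (s / 2) * (eta s / (1 - Rcpow 2 (1 - s))))%C
      with (Rcpow PI (- (s / 2)) * CGamma (s / 2) * eta s / (1 - Rcpow 2 (1 - s)))%C by (field; auto).
    rewrite HP. field. auto. }
  intros s Hs. destruct (fint_improper s Hs) as [l Hl].
  rewrite (Main s l Hs Hl). symmetry. apply Main.
  - change (Re (1 - s)%C) with (1 - Re s). lra.
  - apply improper_ext with (fun v => fint s (- v)). intros; apply fint_reflect. now apply improper_reflect.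
Qed.

(** * The contour shift *)

Lemma improper_RInt_gen f l : improper f l ->
  RInt_gen (V := C_R_CompleteNormedModule) f (Rbar_locally m_infty) (Rbar_locally p_infty) = l.
Proof.
  intros [E H]. apply (is_RInt_gen_unique (V := C_R_CompleteNormedModule)).
  intros P [eps HP]. assert (X := cond_pos eps).
  destruct (H (eps / 2) ltac:(lra)) as [T [HT Q]].
  apply Filter_prod with (fun a => a < - T) (fun b => T < b).
  - exists (- T). auto.
  - exists T. auto.
  - intros a b Ha Hb. simpl. exists (CI f a b). split. now apply CI_correct.
    apply HP. apply (C_NormedModule_mixin_compat1 l).
    eapply Rle_lt_trans. apply Q; lra. lra.
Qed.

(** * Conjugation symmetry and growth of W *)

Lemma CSeries_conj a : CSeries (fun n => Cconj (a n)) = Cconj (CSeries a).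
Proof.
  unfold CSeries, Cconj. simpl. f_equal. apply Series_opp.
Qed.

Lemma Rcpow_conj b z : Rcpow b (Cconj z) = Cconj (Rcpow b z).
Proof.
  unfold Rcpow. rewrite cexp_conj, Cmult_conj. do 2 f_equal.
  apply injective_projections; simpl; ring.
Qed.

Lemma Cconj_RtoC x : Cconj (RtoC x) = RtoC x.
Proof. apply injective_projections; simpl; ring. Qed.

Lemma zeta_conj s : Re s < 1 -> zeta (Cconj s) = Cconj (zeta s).
Proof.
  intros Hs. unfold zeta. rewrite Cdiv_conj by now apply zeta_den_neq_0.
  rewrite Cminus_conj, Cconj_RtoC. f_equal.
  - unfold eta. rewrite <- CSeries_conj.
    assert (E : forall n, (RtoC ((-1) ^ n) * Rcpow (INR (S n)) (- Cconj s))%C =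
      Cconj (RtoC ((-1) ^ n) * Rcpow (INR (S n)) (- s))%C).
    { intros n. rewrite Cmult_conj, Cconj_RtoC, <- Rcpow_conj, Copp_conj. reflexivity. }
    unfold CSeries. f_equal; apply Series_ext; intros n; now rewrite E.
  - f_equal. rewrite <- Rcpow_conj, Cminus_conj, Cconj_RtoC. reflexivity.
Qed.

(** Division by 0 yields 0; so in the equation defining theta a zero of either Gamma value would
    annihilate the right-hand side. *)
Lemma Cinv_0 : (/ RtoC 0)%C = RtoC 0.
Proof. apply injective_projections; simpl; unfold Rdiv; ring. Qed.

Lemma Cmult_eq_0 (a b : C) : (a * b)%C = RtoC 0 -> a = RtoC 0 \/ b = RtoC 0.
Proof.
  intros H. destruct (classic (a = RtoC 0)) as [|Ha]; auto. right.
  apply NNPP. intros Hb. now apply (Cmult_neq_0 a b).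
Qed.

Lemma cexp_minus z w : cexp (z - w)%C = (cexp z / cexp w)%C.
Proof. unfold Cminus, Cdiv. now rewrite cexp_plus, cexp_opp. Qed.

Definition sarg (z : C) : C := (RtoC (/ 2) + Ci * z)%C.

Lemma Re_sarg z : Re (sarg z) = / 2 - Im z.
Proof. destruct z. simpl. ring. Qed.

Lemma strip_between z : strip z -> - / 2 < Im z < / 2.
Proof. unfold strip. intros H. apply Rabs_lt_between in H. lra. Qed.

Lemma strip_conj z : strip z -> strip (Cconj z).
Proof. unfold strip. intros H. rewrite im_conj, Rabs_Ropp. exact H. Qed.

Definition Eth (th : C -> C) (z : C) : C := cexp (Ci * th z)%C.

Lemma Eth_cdiff th z : is_RS_theta th -> strip z -> cdiff (Eth th) z.
Proof.
  intros [H _] Hz. unfold Eth. apply cdiff_cexp. apply cdiff_mult. apply cdiff_const.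
  apply ex_derive_cdiff. now apply H.
Qed.

(* The nonvanishing of Gamma on the two lines is read off the defining equation of
   theta, whose left-hand side is an exponential. *)
Lemma Gamma_quotient th z : is_RS_theta th -> strip z ->
  CGamma (sarg z / 2)%C <> RtoC 0 /\ CGamma ((1 - sarg z) / 2)%C <> RtoC 0 /\
  (Eth th z * Eth th z)%C = (Rcpow PI (- (Ci * z)) * (CGamma (sarg z / 2) / CGamma ((1 - sarg z) / 2)))%C.
Proof.
  intros (_ & _ & H) Hz. specialize (H z Hz).
  assert (E1 : (sarg z / 2)%C = (RtoC (/ 4) + Ci * z / RtoC 2)%C)
    by (destruct z; apply injective_projections; simpl; field).
  assert (E2 : ((1 - sarg z) / 2)%C = (RtoC (/ 4) - Ci * z / RtoC 2)%C)
    by (destruct z; apply injective_projections; simpl; field).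
  rewrite E1, E2. split; [|split]; auto.
  - intros E. rewrite E in H. apply (Cmult_neq_0 (Eth th z) (Eth th z)); try apply cexp_neq_0.
    unfold Eth. rewrite H. unfold Cdiv. ring.
  - intros E. rewrite E in H. apply (Cmult_neq_0 (Eth th z) (Eth th z)); try apply cexp_neq_0.
    unfold Eth. rewrite H. unfold Cdiv. rewrite Cinv_0. ring.
Qed.

(** By its definition e^(2 i theta) is the ratio of the factors pi^(-s/2) Gamma(s/2) at s and 1 - s,
    that is zeta(1 - s) / zeta(s) written without division. *)
Lemma Eth_zeta th z : is_RS_theta th -> strip z ->
  (Eth th z * Eth th z * zeta (sarg z))%C = zeta (1 - sarg z)%C.
Proof.
  intros Hth Hz. destruct (Gamma_quotient th z Hth Hz) as (G1 & G2 & HE). rewrite HE.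
  assert (Hs := strip_between z Hz). assert (HR := Re_sarg z).
  assert (F := zeta_functional (sarg z) ltac:(lra)).
  set (A := CGamma (sarg z / 2)%C) in *. set (B := CGamma ((1 - sarg z) / 2)%C) in *.
  assert (P0 : Rcpow PI (- (sarg z / 2))%C <> RtoC 0) by apply cexp_neq_0.
  assert (EP : Rcpow PI (- (Ci * z))%C = (Rcpow PI (- (sarg z / 2)) / Rcpow PI (- ((1 - sarg z) / 2)))%C).
  { unfold Rcpow. rewrite <- cexp_minus. f_equal.
    destruct z. apply injective_projections; simpl; field. }
  assert (P1 : Rcpow PI (- ((1 - sarg z) / 2))%C <> RtoC 0) by apply cexp_neq_0.
  rewrite EP.
  replace (Rcpow PI (- (sarg z / 2)) / Rcpow PI (- ((1 - sarg z) / 2)) * (A / B) * zeta (sarg z))%C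
    with (Rcpow PI (- (sarg z / 2)) * A * zeta (sarg z) / (Rcpow PI (- ((1 - sarg z) / 2)) * B))%C
    by (field; auto).
  rewrite F. field. auto.
Qed.

(** Conjugation exchanges the two Gamma values and inverts the power of pi, so the two right-hand
    sides are reciprocal. The equation for theta gives this for squares only. *)
Lemma Eth_conj_sq th z : is_RS_theta th -> strip z ->
  (Eth th z * Cconj (Eth th (Cconj z)) * (Eth th z * Cconj (Eth th (Cconj z))))%C = RtoC 1.
Proof.
  intros Hth Hz. destruct (Gamma_quotient th z Hth Hz) as (G1 & G2 & HE).
  destruct (Gamma_quotient th (Cconj z) Hth (strip_conj z Hz)) as (G3 & G4 & HE').
  assert (Hs := strip_between z Hz). assert (HR := Re_sarg z).
  replace (Eth th z * Cconj (Eth th (Cconj z)) * (Eth th z * Cconj (Eth th (Cconj z))))%C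
    with ((Eth th z * Eth th z) * Cconj (Eth th (Cconj z) * Eth th (Cconj z)))%C
    by (rewrite Cmult_conj; ring).
  rewrite HE, HE', Cmult_conj, Cdiv_conj by auto.
  assert (C1 : Cconj (CGamma (sarg (Cconj z) / 2)%C) = CGamma ((1 - sarg z) / 2)%C).
  { rewrite <- CGamma_conj. f_equal. destruct z; apply injective_projections; simpl; field.
    replace (Re (sarg (Cconj z) / 2)%C) with ((/ 2 + Im z) / 2) by (destruct z; simpl; field). lra. }
  assert (C2 : Cconj (CGamma ((1 - sarg (Cconj z)) / 2)%C) = CGamma (sarg z / 2)%C).
  { rewrite <- CGamma_conj. f_equal. destruct z; apply injective_projections; simpl; field.
    replace (Re ((1 - sarg (Cconj z)) / 2)%C) with ((/ 2 - Im z) / 2) by (destruct z; simpl; field). lra. }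
  rewrite C1, C2, <- Rcpow_conj.
  assert (EP : (Rcpow PI (- (Ci * z)) * Rcpow PI (Cconj (- (Ci * Cconj z))))%C = RtoC 1).
  { unfold Rcpow. rewrite <- cexp_plus. rewrite <- cexp_0. f_equal.
    destruct z; apply injective_projections; simpl; ring. }
  set (A := CGamma (sarg z / 2)%C) in *. set (B := CGamma ((1 - sarg z) / 2)%C) in *.
  transitivity (Rcpow PI (- (Ci * z)) * Rcpow PI (Cconj (- (Ci * Cconj z))))%C; auto.
  field. auto.
Qed.

Lemma ccont_Cconj f z : ccont f (Cconj z) -> ccont (fun w => Cconj (f (Cconj w))) z.
Proof.
  intros H eps He. destruct (H eps He) as [d [Hd K]]. exists d. split; auto. intros w Hw.
  rewrite <- Cminus_conj, Cmod_conj. apply K. rewrite <- Cminus_conj, Cmod_conj. exact Hw.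
Qed.

(** By [Eth_conj_sq] the product is 1 or -1. It is continuous on the segment from 0 to z, which
    stays in the strip, and equals 1 at 0 because theta(0) = 0. *)
Lemma Eth_conj th z : is_RS_theta th -> strip z -> (Eth th z * Cconj (Eth th (Cconj z)))%C = RtoC 1.
Proof.
  intros Hth Hz.
  set (q := fun w => (Eth th w * Cconj (Eth th (Cconj w)))%C).
  assert (Hq : forall w, strip w -> q w = RtoC 1 \/ q w = (- RtoC 1)%C).
  { intros w Hw. assert (H := Eth_conj_sq th w Hth Hw). fold (q w) in H.
    assert (H' : ((q w - 1) * (q w + 1))%C = RtoC 0).
    { replace ((q w - 1) * (q w + 1))%C with (q w * q w - 1)%C by ring. rewrite H. ring. }
    apply Cmult_eq_0 in H'. destruct H' as [H'|H']; [left|right].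
    - replace (q w) with (q w - 1 + 1)%C by ring. rewrite H'. ring.
    - replace (q w) with (q w + 1 - 1)%C by ring. rewrite H'. ring. }
  assert (Hpath : forall u, 0 <= u <= 1 -> strip (RtoC u * z)%C).
  { intros u Hu. unfold strip in *. replace (Im (RtoC u * z)%C) with (u * Im z) by (destruct z; simpl; ring).
    rewrite Rabs_mult, Rabs_pos_eq by lra. assert (X := Rabs_pos (Im z)). nra. }
  (* The sign is reversed because the intermediate value theorem used here expects a passage from
     negative to positive values. *)
  assert (Hcont : forall u, 0 <= u <= 1 -> continuity_pt (fun u => - Re (q (RtoC u * z)%C)) u).
  { intros u Hu. apply continuity_pt_filterlim.
    apply (continuous_opp (V := R_NormedModule) (fun u => Re (q (RtoC u * z)%C))).
    apply RCcont_Re. apply ccont_RCcont_eps.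
    assert (Hc : ccont q (RtoC u * z)%C).
    { apply ccont_mult. apply cdiff_ccont, Eth_cdiff; auto.
      apply (ccont_Cconj (Eth th)). apply cdiff_ccont, Eth_cdiff; auto. now apply strip_conj, Hpath. }
    intros eps He. destruct (Hc eps He) as [d [Hd K]]. assert (X := Cmod_ge_0 z).
    exists (d / (Cmod z + 1)). split. apply Rdiv_lt_0_compat; lra.
    intros y Hy. apply K. replace (RtoC y * z - RtoC u * z)%C with (RtoC (y - u) * z)%C
      by (rewrite RtoC_minus; ring).
    rewrite Cmod_mult, Cmod_R.
    apply Rle_lt_trans with (Rabs (y - u) * (Cmod z + 1)).
    apply Rmult_le_compat_l; [apply Rabs_pos|lra].
    apply Rlt_le_trans with (d / (Cmod z + 1) * (Cmod z + 1)).
    apply Rmult_lt_compat_r; lra. right; field; lra. }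
  assert (Q0 : q (RtoC 0 * z)%C = RtoC 1).
  { unfold q. replace (RtoC 0 * z)%C with (RtoC 0) by ring. rewrite Cconj_RtoC.
    destruct Hth as (_ & H0 & _). unfold Eth. rewrite H0.
    replace (Ci * 0)%C with (RtoC 0) by ring. rewrite cexp_0, Cconj_RtoC. ring. }
  assert (Q1 : q (RtoC 1 * z)%C = q z) by (f_equal; ring).
  destruct (Hq z Hz) as [H|H]; auto. exfalso.
  destruct (Ranalysis5.IVT_interv (fun u => - Re (q (RtoC u * z)%C)) 0 1) as [u [Hu Eu]]; auto.
  - lra.
  - rewrite Q0. simpl. lra.
  - rewrite Q1, H. simpl. lra.
  - destruct (Hq (RtoC u * z)%C (Hpath u Hu)) as [E|E]; rewrite E in Eu; simpl in Eu; lra.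
Qed.

Definition Wth (th : C -> C) (z : C) : C := (Eth th z * zeta (sarg z))%C.

(** Conjugation sends s at the point conj z to 1 - s at z; the functional equation restores zeta(s)
    with a factor e^(2 i theta(z)), half of which [Eth_conj] absorbs. *)
Lemma Wth_conj th z : is_RS_theta th -> strip z -> Cconj (Wth th (Cconj z)) = Wth th z.
Proof.
  intros Hth Hz. unfold Wth. assert (Hs := strip_between z Hz). assert (HR := Re_sarg (Cconj z)).
  rewrite im_conj in HR.
  rewrite Cmult_conj, <- zeta_conj by lra.
  replace (Cconj (sarg (Cconj z))) with (1 - sarg z)%C
    by (destruct z; apply injective_projections; simpl; field).
  rewrite <- (Eth_zeta th z Hth Hz).
  transitivity (Eth th z * Cconj (Eth th (Cconj z)) * (Eth th z * zeta (sarg z)))%C. ring.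
  rewrite Eth_conj by auto. ring.
Qed.

(* [W^2 = zeta(s) zeta(1 - s)] by the functional equation, so the growth of [W] is
   controlled without any estimate for Gamma. *)
Lemma Wth_le th z d : is_RS_theta th -> 0 < d -> Rabs (Im z) <= / 2 - d ->
  Cmod (Wth th z) <= (Cmod z + 1) / d / (exp (d * ln 2) - 1).
Proof.
  intros Hth Hd Hz.
  assert (Hst : strip z) by (unfold strip; lra).
  apply Rabs_le_between in Hz. assert (HR := Re_sarg z).
  assert (X := exp_ln2_gt_1 d Hd). assert (Y := Cmod_ge_0 z).
  assert (HR' : Re (1 - sarg z)%C = 1 - Re (sarg z)) by reflexivity.
  assert (Hm : forall s, Cmod s <= Cmod z + 1 -> 0 < d <= Re s -> Re s <= 1 - d ->
    Cmod (zeta s) <= (Cmod z + 1) / d / (exp (d * ln 2) - 1)).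
  { intros s Hs1 Hs2 Hs3. eapply Rle_trans. apply (zeta_le s d); auto.
    apply Rmult_le_compat_r. left; now apply Rinv_0_lt_compat.
    apply Rmult_le_compat_r; auto. left; now apply Rinv_0_lt_compat. }
  assert (H1 : Cmod (zeta (sarg z)) <= (Cmod z + 1) / d / (exp (d * ln 2) - 1)).
  { apply Hm; try lra. unfold sarg. eapply Rle_trans. apply Cmod_triangle.
    rewrite Cmod_mult, Cmod_Ci, Cmod_R, Rabs_pos_eq; lra. }
  assert (H2 : Cmod (zeta (1 - sarg z)%C) <= (Cmod z + 1) / d / (exp (d * ln 2) - 1)).
  { apply Hm; try lra. replace (1 - sarg z)%C with (RtoC (/ 2) + - (Ci * z))%C
      by (destruct z; apply injective_projections; simpl; field).
    eapply Rle_trans. apply Cmod_triangle.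
    rewrite Cmod_opp, Cmod_mult, Cmod_Ci, Cmod_R, Rabs_pos_eq; lra. }
  set (B := (Cmod z + 1) / d / (exp (d * ln 2) - 1)) in *.
  assert (HW : (Wth th z * Wth th z)%C = (zeta (1 - sarg z) * zeta (sarg z))%C).
  { rewrite <- (Eth_zeta th z Hth Hst). unfold Wth. ring. }
  assert (HW2 : Cmod (Wth th z) * Cmod (Wth th z) <= B * B).
  { rewrite <- Cmod_mult, HW, Cmod_mult. apply Rmult_le_compat; auto using Cmod_ge_0. }
  assert (Z := Cmod_ge_0 (Wth th z)). assert (Z2 := Cmod_ge_0 (zeta (sarg z))).
  apply Rnot_lt_le. intros Hlt. nra.
Qed.

(** * The kernel and the integrals along the two lines *)

Lemma csinh_low w : exp (Rabs (Re w)) - exp (- Rabs (Re w)) <= 2 * Cmod (csinh w).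
Proof.
  unfold csinh. assert (H2 : RtoC 2 <> RtoC 0) by (intros E; apply RtoC_inj in E; lra).
  rewrite Cmod_div by auto. rewrite Cmod_R, (Rabs_pos_eq 2) by lra.
  replace (2 * (Cmod (cexp w - cexp (- w)) / 2)) with (Cmod (cexp w - cexp (- w))) by field.
  assert (E1 := Cmod_cexp w). assert (E2 := Cmod_cexp (- w)%C).
  change (Re (- w)%C) with (- Re w) in E2.
  destruct (Rle_dec 0 (Re w)).
  - rewrite Rabs_pos_eq by auto. rewrite <- E1, <- E2. unfold Cminus. rewrite <- (Cmod_opp (cexp (- w)%C)).
    apply Cmod_ge_minus.
  - rewrite Rabs_left by lra. rewrite Ropp_involutive, <- E1, <- E2. rewrite Cmod_minus_sym.
    unfold Cminus. rewrite <- (Cmod_opp (cexp w)). apply Cmod_ge_minus.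
Qed.

Definition sden (x : C) : C := (RtoC 2 * csinh (RtoC PI * x / RtoC 2))%C.

(** As pi / 2 >= 1, the real part a of the argument has |a| >= |u| >= 1, so e^(-|a|) is at most half
    of e^|a|. *)
Lemma sden_low u y : 1 <= Rabs u -> exp (Rabs u) <= 2 * Cmod (sden (u, y)).
Proof.
  intros Hu. assert (P := PI2_1). unfold sden. rewrite Cmod_mult, Cmod_R, (Rabs_pos_eq 2) by lra.
  assert (H := csinh_low (RtoC PI * (u, y) / RtoC 2)%C).
  replace (Re (RtoC PI * (u, y) / RtoC 2)%C) with (PI / 2 * u) in H by (simpl; field).
  rewrite Rabs_mult, (Rabs_pos_eq (PI / 2)) in H by lra.
  set (a := PI / 2 * Rabs u) in *. assert (Ha : Rabs u <= a) by (unfold a; nra).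
  assert (E1 : exp (Rabs u) <= exp a) by now apply exp_mono.
  assert (E2 : exp (- a) <= 1) by (rewrite <- exp_0; apply exp_mono; lra).
  assert (E3 : 2 <= exp a). { assert (X := exp_ineq1 a ltac:(lra)). lra. }
  lra.
Qed.

Lemma is_cderiv_sden x : is_cderiv sden x
  (RtoC PI / 2 * cexp (RtoC PI / 2 * x) + RtoC PI / 2 * cexp (- (RtoC PI / 2) * x))%C.
Proof.
  apply is_cderiv_ext with (fun x => cexp (RtoC PI / 2 * x) + (- RtoC 1) * cexp (- (RtoC PI / 2) * x))%C.
  { intros w. unfold sden, csinh.
    replace (RtoC PI * w / RtoC 2)%C with (RtoC PI / 2 * w)%C by (unfold Cdiv; ring).
    replace (- (RtoC PI / 2 * w))%C with (- (RtoC PI / 2) * w)%C by ring.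
    field. }
  assert (L : forall k, is_cderiv (fun x => cexp (k * x)%C) x (cexp (k * x) * k)%C).
  { intros k. replace (cexp (k * x) * k)%C with (cexp (k * x) * (0 * x + k * 1))%C by ring.
    apply (is_cderiv_comp (fun x => k * x)%C cexp); [|apply is_cderiv_cexp].
    apply (is_cderiv_mult (fun _ => k) (fun x => x)). apply is_cderiv_const. apply is_cderiv_id. }
  replace (RtoC PI / 2 * cexp (RtoC PI / 2 * x) + RtoC PI / 2 * cexp (- (RtoC PI / 2) * x))%C
    with (cexp (RtoC PI / 2 * x) * (RtoC PI / 2) + (0 * cexp (- (RtoC PI / 2) * x) +
      (- RtoC 1) * (cexp (- (RtoC PI / 2) * x) * - (RtoC PI / 2))))%C by ring.
  apply is_cderiv_plus. apply L.
  apply (is_cderiv_mult (fun _ => - RtoC 1)%C (fun x => cexp (- (RtoC PI / 2) * x)%C)). apply is_cderiv_const. apply L.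
Qed.

Lemma sden_0 : sden (RtoC 0) = RtoC 0.
Proof.
  unfold sden, csinh. replace (RtoC PI * 0 / RtoC 2)%C with (RtoC 0) by (unfold Cdiv; ring).
  replace (- RtoC 0)%C with (RtoC 0) by ring. unfold Cdiv. ring.
Qed.

(** A zero means e^(pi x) = 1. The modulus gives Re x = 0, and then cos(pi y) = 1 with |pi y| < pi
    leaves only y = 0. *)
Lemma sden_neq_0 u y : Rabs y <= / 2 -> (u, y) <> RtoC 0 -> sden (u, y) <> RtoC 0.
Proof.
  intros Hy Hne E. apply Hne. assert (P := PI_RGT_0). apply Rabs_le_between in Hy.
  assert (H2 : RtoC 2 <> RtoC 0) by (intros E'; apply RtoC_inj in E'; lra).
  set (w := (RtoC PI * (u, y) / RtoC 2)%C).
  assert (E1 : (cexp w - cexp (- w))%C = RtoC 0).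
  { unfold sden, csinh in E. fold w in E. rewrite <- E. field. }
  assert (E2 : cexp (w + w)%C = RtoC 1).
  { rewrite cexp_plus.
    replace (cexp w * cexp w)%C with ((cexp w - cexp (- w)) * cexp w + cexp (- w) * cexp w)%C by ring.
    rewrite E1, <- cexp_plus. replace (- w + w)%C with (RtoC 0) by ring. rewrite cexp_0. ring. }
  replace (w + w)%C with ((PI * u, PI * y) : C) in E2
    by (unfold w; apply injective_projections; simpl; field).
  assert (M := Cmod_cexp (PI * u, PI * y)). rewrite E2, Cmod_1 in M. simpl in M.
  assert (Hu : u = 0). { rewrite <- exp_0 in M. apply exp_inv in M. nra. }
  unfold cexp in E2. injection E2. simpl. intros _ Ec. rewrite <- M, Rmult_1_l in Ec.
  apply cos_eq_1_small in Ec; [|nra]. assert (y = 0) by nra. now subst.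
Qed.

(* [e^(i theta(t))] times the integrand of [U], in the shape required by [residue_rect_lim]. *)
Definition Fth (th : C -> C) (t : R) (x : C) : C :=
  (eta (sarg (RtoC t + x)) *
   ((Eth th (RtoC t + x) / (1 - Rcpow 2 (1 - sarg (RtoC t + x))) * RtoC PI) / sden x))%C.

Lemma Fth_Wth th t x : Fth th t x = (Wth th (RtoC t + x) * (RtoC PI / sden x))%C.
Proof. unfold Fth, Wth, zeta, Cdiv. ring. Qed.

Lemma Im_t_plus t x : Im (RtoC t + x)%C = Im x.
Proof. destruct x; simpl; ring. Qed.

Lemma cdiff_shift f (t : R) x : cdiff f (RtoC t + x)%C -> cdiff (fun x => f (RtoC t + x)%C) x.
Proof.
  intros H. apply (cdiff_comp (fun x => RtoC t + x)%C f); auto.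
  apply cdiff_plus; [apply cdiff_const|apply cdiff_id].
Qed.

Lemma cdiff_sarg z : cdiff sarg z.
Proof.
  apply cdiff_plus; [apply cdiff_const|]. apply cdiff_mult; [apply cdiff_const|apply cdiff_id].
Qed.

Lemma cdiff_numer th t x : is_RS_theta th -> strip x ->
  cdiff (fun x => Eth th (RtoC t + x) / (1 - Rcpow 2 (1 - sarg (RtoC t + x))) * RtoC PI)%C x.
Proof.
  intros Hth Hx. apply cdiff_mult; [|apply cdiff_const]. apply cdiff_div.
  - apply cdiff_shift. apply Eth_cdiff; auto. unfold strip. now rewrite Im_t_plus.
  - apply cdiff_minus; [apply cdiff_const|]. unfold Rcpow. apply cdiff_cexp.
    apply cdiff_mult; [|apply cdiff_const]. apply cdiff_minus; [apply cdiff_const|].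
    apply (cdiff_shift sarg). apply cdiff_sarg.
  - apply zeta_den_neq_0. rewrite Re_sarg, Im_t_plus. apply strip_between in Hx. lra.
Qed.

Lemma ccont_comp f g z : ccont f z -> ccont g (f z) -> ccont (fun w => g (f w)) z.
Proof.
  intros Hf Hg eps He. destruct (Hg eps He) as [d [Hd K]]. destruct (Hf d Hd) as [d' [Hd' K']].
  exists d'. split; auto.
Qed.

Lemma ccont_eta_shift t x : strip x -> ccont (fun x => eta (sarg (RtoC t + x))) x.
Proof.
  intros Hx. apply (ccont_comp (fun x => sarg (RtoC t + x)%C) eta).
  - apply cdiff_ccont, (cdiff_shift sarg), cdiff_sarg.
  - apply ccont_eta. rewrite Re_sarg, Im_t_plus. apply strip_between in Hx. lra.
Qed.

Lemma ccont_Fth th t u y : is_RS_theta th -> Rabs y < / 2 -> (u, y) <> RtoC 0 -> ccont (Fth th t) (u, y).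
Proof.
  intros Hth Hy Hne. unfold Fth. apply ccont_mult. now apply ccont_eta_shift.
  apply cdiff_ccont. apply cdiff_div. now apply cdiff_numer. eexists; apply is_cderiv_sden.
  apply sden_neq_0; auto. lra.
Qed.

(** The linear growth of W costs at most e^(|u|/2), while the kernel gains e^(-|u|). The distance d
    = 1/2 - sigma to the edge of the strip makes the bound uniform in y. *)
Lemma Fth_le th t sigma : is_RS_theta th -> 0 < sigma < / 2 -> exists K, 0 < K /\
  forall u y, 1 <= Rabs u -> Rabs y <= sigma -> Cmod (Fth th t (u, y)) <= K * exp (- (/ 2 * Rabs u)).
Proof.
  intros Hth Hs. set (d := / 2 - sigma). assert (Hd : 0 < d) by (unfold d; lra).
  assert (X := exp_ln2_gt_1 d Hd). assert (P := PI_RGT_0).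
  set (B := / d / (exp (d * ln 2) - 1)).
  assert (HB : 0 < B) by (apply Rmult_lt_0_compat; apply Rinv_0_lt_compat; lra).
  assert (Ht := Rabs_pos t).
  exists (4 * (Rabs t + 2) * B * PI). split.
  { apply Rmult_lt_0_compat; [apply Rmult_lt_0_compat; [lra|exact HB]|exact P]. }
  intros u y Hu Hy.
  assert (HW := Wth_le th (RtoC t + (u, y))%C d Hth Hd). rewrite Im_t_plus in HW.
  specialize (HW ltac:(unfold d; simpl; lra)).
  assert (Hz : Cmod (RtoC t + (u, y))%C + 1 <= 2 * (Rabs t + 2) * exp (/ 2 * Rabs u)).
  { assert (E := exp_ineq1 (/ 2 * Rabs u) ltac:(lra)).
    assert (M : Cmod (RtoC t + (u, y))%C <= Rabs t + (Rabs u + Rabs y)).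
    { eapply Rle_trans. apply Cmod_triangle. rewrite Cmod_R. apply Rplus_le_compat_l.
      apply (Cmod_le_abs (u, y)). }
    nra. }
  assert (HD := sden_low u y Hu). assert (Ep := exp_pos (Rabs u)).
  assert (Hn : sden (u, y) <> RtoC 0) by (apply Cmod_gt_0; lra).
  rewrite Fth_Wth, Cmod_mult, Cmod_div by auto. rewrite Cmod_R, (Rabs_pos_eq PI) by lra.
  assert (H1 : Cmod (Wth th (RtoC t + (u, y))%C) <= 2 * (Rabs t + 2) * exp (/ 2 * Rabs u) * B).
  { eapply Rle_trans. apply HW. unfold B.
    replace ((Cmod (RtoC t + (u, y)) + 1) / d / (exp (d * ln 2) - 1))
      with ((Cmod (RtoC t + (u, y)) + 1) * (/ d / (exp (d * ln 2) - 1))) by (field; lra).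
    apply Rmult_le_compat_r; auto. fold B. lra. }
  assert (H2 : PI / Cmod (sden (u, y)) <= PI * (2 * exp (- Rabs u))).
  { apply Rmult_le_compat_l; [lra|]. rewrite exp_Ropp.
    replace (2 * / exp (Rabs u)) with (/ (exp (Rabs u) / 2)) by (field; lra).
    apply Rinv_le_contravar; lra. }
  replace (4 * (Rabs t + 2) * B * PI * exp (- (/ 2 * Rabs u)))
    with (2 * (Rabs t + 2) * exp (/ 2 * Rabs u) * B * (PI * (2 * exp (- Rabs u)))).
  - apply Rmult_le_compat; auto using Cmod_ge_0.
    apply Rmult_le_pos; [lra|]. left; apply Rinv_0_lt_compat. lra.
  - replace (exp (- (/ 2 * Rabs u))) with (exp (/ 2 * Rabs u) * exp (- Rabs u))
      by (rewrite <- exp_plus; f_equal; field). ring.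
Qed.

Lemma Fth_improper th t sigma y : is_RS_theta th -> 0 < sigma < / 2 -> Rabs y = sigma ->
  exists l, improper (fun u : R => Fth th t (u, y)) l.
Proof.
  intros Hth Hs Hy. destruct (Fth_le th t sigma Hth Hs) as [K [HK HF]].
  assert (Hc : forall u, ccont (Fth th t) (u, y)).
  { intros u. apply ccont_Fth; auto. lra. intros E. injection E. intros. subst y. rewrite Rabs_R0 in Hy. lra. }
  destruct (bounded_h (Fth th t) (-1) 1 y) as [M [HM HMb]]; [lra|auto|].
  (* [K] covers |u| >= 1; on |u| <= 1 the bound [M] is enlarged by e^(1/2), since e^(-|u|/2) >=
     e^(-1/2) there. *)
  apply (improper_exists _ (K + M * exp (/ 2)) (/ 2)). lra.
  - intros u. apply ccont_RCcont_h; auto.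
  - intros u. assert (E := exp_pos (- (/ 2 * Rabs u))). assert (E' := exp_pos (/ 2)).
    destruct (Rle_dec 1 (Rabs u)) as [Hu|Hu].
    + eapply Rle_trans. apply HF; auto. lra. apply Rmult_le_compat_r; nra.
    + eapply Rle_trans. apply HMb. apply Rabs_le_between; lra.
      apply Rle_trans with (M * exp (/ 2) * exp (- (/ 2 * Rabs u))).
      * rewrite Rmult_assoc, <- exp_plus.
        assert (1 <= exp (/ 2 + - (/ 2 * Rabs u))). { rewrite <- exp_0. apply exp_mono. lra. }
        nra.
      * apply Rmult_le_compat_r; lra.
Qed.

(** The derivative of [sden] at 0 is pi, which cancels the pi of the numerator. The factor that is
    only a uniform limit is [eta], approximated by its even partial sums. *)
Lemma Fth_residue th t sigma T : is_RS_theta th -> 0 < sigma < / 2 -> 0 < T ->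
  rect_int (Fth th t) (- T) T (- sigma) sigma = (RtoC (2 * PI) * Ci * Wth th (RtoC t))%C.
Proof.
  intros Hth Hs HT. assert (P := PI_RGT_0).
  assert (HPI : RtoC PI <> RtoC 0) by (intros E; apply RtoC_inj in E; lra).
  assert (Hst : forall y, - sigma <= y <= sigma -> Rabs y < / 2).
  { intros y Hy. apply Rabs_lt_between. lra. }
  replace (Wth th (RtoC t)) with (eta (sarg (RtoC t + 0)) *
    ((Eth th (RtoC t + 0) / (1 - Rcpow 2 (1 - sarg (RtoC t + 0))) * RtoC PI) / RtoC PI))%C.
  2:{ replace (RtoC t + 0)%C with (RtoC t) by ring. unfold Wth, zeta.
      field. split; auto. apply zeta_den_neq_0. rewrite Re_sarg. simpl. lra. }
  unfold Fth.
  apply (residue_rect_lim (fun x => Eth th (RtoC t + x) / (1 - Rcpow 2 (1 - sarg (RtoC t + x))) * RtoC PI)%C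
    sden (fun n x => csum (eterm (sarg (RtoC t + x)%C)) (2 * n)) (fun x => eta (sarg (RtoC t + x)%C))).
  - simpl. lra.
  - simpl. lra.
  - intros u y Hu Hy. split. apply cdiff_numer; auto. now apply Hst. eexists; apply is_cderiv_sden.
  - intros u y Hu Hy Hne. apply sden_neq_0; auto. left; now apply Hst.
  - assert (D := is_cderiv_sden (RtoC 0)).
    replace (RtoC PI / 2 * cexp (RtoC PI / 2 * 0) + RtoC PI / 2 * cexp (- (RtoC PI / 2) * 0))%C with (RtoC PI) in D.
    exact D. replace (RtoC PI / 2 * 0)%C with (RtoC 0) by ring.
    replace (- (RtoC PI / 2) * 0)%C with (RtoC 0) by ring. rewrite cexp_0. field.
  - apply sden_0.
  - auto.
  - intros n u y Hu Hy. apply (cdiff_comp (fun x => sarg (RtoC t + x)%C) (fun s => csum (eterm s) (2 * n))).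
    apply (cdiff_shift sarg), cdiff_sarg. apply (cdiff_csum (fun k w => eterm w k)). intros; apply cdiff_eterm.
  - intros u y Hu Hy. apply ccont_eta_shift. now apply Hst.
  - intros eps He.
    (* A bound for |1/2 + i (t + x)| over the whole rectangle, which makes the remainder of eta
       uniform. *)
    destruct (pmaj_unif (RtoC (1 + (Rabs t + T + 1))) (/ 2 - sigma) eps ltac:(lra) He) as [N HN].
    exists N. intros n u y Hn Hu Hy. eapply Rle_trans. apply (eta_unif _ (/ 2 - sigma)).
    rewrite Re_sarg, Im_t_plus. simpl. lra.
    apply HN; auto. assert (At := Rabs_pos t). rewrite (Cmod_R (1 + _)), Rabs_pos_eq by lra.
    unfold sarg. eapply Rle_trans. apply Cmod_triangle. rewrite Cmod_R, Cmod_mult, Cmod_Ci, Rabs_pos_eq by lra.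
    assert (A1 : Cmod (RtoC t + (u, y))%C <= Rabs t + (Rabs u + Rabs y)).
    { eapply Rle_trans. apply Cmod_triangle. rewrite Cmod_R. apply Rplus_le_compat_l. apply (Cmod_le_abs (u, y)). }
    assert (A2 : Rabs u <= T) by (apply Rabs_le; lra). assert (A3 := Hst y Hy). lra.
Qed.

(** Both factors commute with conjugation: W by [Wth_conj], the kernel because sinh is real on the
    real axis. So the integrals along the two lines are conjugate. *)
Lemma Cconj_Fth th t u y : is_RS_theta th -> Rabs y < / 2 -> (u, y) <> RtoC 0 ->
  Cconj (Fth th t (u, y)) = Fth th t (u, - y).
Proof.
  intros Hth Hy Hne. rewrite !Fth_Wth, Cmult_conj.
  assert (Hs : strip (RtoC t + (u, (- y)%R))%C) by (unfold strip; rewrite Im_t_plus; simpl; now rewrite Rabs_Ropp).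
  rewrite <- (Wth_conj th (RtoC t + (u, (- y)%R))%C Hth Hs).
  replace (Cconj (RtoC t + (u, (- y)%R))) with (RtoC t + (u, y))%C
    by (apply injective_projections; simpl; ring).
  f_equal.
  rewrite Cdiv_conj by (apply sden_neq_0; auto; lra). rewrite Cconj_RtoC. f_equal.
  unfold sden, csinh. assert (H2 : RtoC 2 <> RtoC 0) by (intros E; apply RtoC_inj in E; lra).
  rewrite Cmult_conj, Cdiv_conj, Cminus_conj, !cexp_conj, Cconj_RtoC by auto.
  do 2 f_equal. f_equal; f_equal; apply injective_projections; simpl; field.
Qed.

Theorem mainTheorem1 :
  forall (th : C -> C), is_RS_theta th ->
  forall (sigma : R), 0 < sigma < / 2 ->
  forall t : R,
    Zfun th t = RtoC (2 * Re (cexp (Ci * th (RtoC t)) * U th sigma t)%C).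
Proof.
  intros th Hth sigma Hs t. assert (P := PI_RGT_0).
  destruct (Fth_improper th t sigma (- sigma) Hth Hs) as [A HA].
  { rewrite Rabs_Ropp, Rabs_pos_eq; lra. }
  (* [A] is taken before division by 2 pi i. That factor changes sign under conjugation, hence conj
     A here without a minus sign. *)
  assert (HB : improper (fun u : R => Fth th t (u, sigma)) (Cconj A)).
  { apply improper_ext with (fun u : R => Cconj (Fth th t (u, (- sigma)%R))); [|now apply improper_conj].
    intros u. rewrite Cconj_Fth; auto. now rewrite Ropp_involutive.
    rewrite Rabs_Ropp, Rabs_pos_eq; lra. intros E; injection E; lra. }
  assert (HZ : (A - Cconj A)%C = (RtoC (2 * PI) * Ci * Wth th (RtoC t))%C).
  { destruct (Fth_le th t sigma Hth Hs) as [K [HK HF]].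
    apply Cmod_small_eq. intros eps He.
    destruct (proj2 HA (eps / 3) ltac:(lra)) as [T1 [HT1 K1]].
    destruct (proj2 HB (eps / 3) ltac:(lra)) as [T2 [HT2 K2]].
    (* Two vertical sides, each of length 2 sigma, with integrand at most K e^(-T/2). *)
    destruct (exp_small (/ 2) (4 * sigma * K) (eps / 3) ltac:(lra) ltac:(lra)) as [T3 [HT3 K3]].
    set (T := T1 + T2 + T3 + 1).
    assert (HR := Fth_residue th t sigma T Hth Hs ltac:(unfold T; lra)). rewrite <- HR.
    specialize (K1 (- T) T ltac:(unfold T; lra) ltac:(unfold T; lra)).
    specialize (K2 (- T) T ltac:(unfold T; lra) ltac:(unfold T; lra)).
    specialize (K3 T ltac:(unfold T; lra)).
    assert (HT : 1 <= T) by (unfold T; lra). clearbody T.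
    assert (V : forall u, Rabs u = T ->
      Cmod (CI (fun y : R => Fth th t (u, y)) (- sigma) sigma) <= (sigma - - sigma) * (K * exp (- (/ 2 * T)))).
    { intros u Hu. apply CI_Cmod_le_const. lra.
      - intros y Hy. rewrite <- Hu. apply HF. lra. apply Rabs_le; lra.
      - apply exCI_v. lra. intros y Hy. apply ccont_Fth; auto. apply Rabs_lt_between; lra.
        intros E; injection E; intros. subst u. rewrite Rabs_R0 in Hu. lra. }
    assert (V1 := V T ltac:(rewrite Rabs_pos_eq; lra)).
    assert (V2 := V (- T) ltac:(rewrite Rabs_Ropp, Rabs_pos_eq; lra)).
    unfold rect_int.
    set (I1 := CI (fun s : R => Fth th t (s, (- sigma)%R)) (- T) T) in *.
    set (I2 := CI (fun s : R => Fth th t (s, sigma)) (- T) T) in *.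
    set (J1 := CI (fun y : R => Fth th t (T, y)) (- sigma) sigma) in *.
    set (J2 := CI (fun y : R => Fth th t ((- T)%R, y)) (- sigma) sigma) in *.
    replace (A - Cconj A - (I1 - I2 + Ci * (J1 - J2)))%C
      with (((I2 - Cconj A) - (I1 - A)) - Ci * (J1 - J2))%C by ring.
    eapply Rle_trans. apply Cmod_minus_le. rewrite Cmod_mult, Cmod_Ci, Rmult_1_l.
    assert (X1 := Cmod_minus_le (I2 - Cconj A)%C (I1 - A)%C).
    assert (X2 := Cmod_minus_le J1 J2). lra. }
  assert (HU : (cexp (Ci * th (RtoC t)) * U th sigma t)%C = (A / (RtoC (2 * PI) * Ci))%C).
  { unfold U.
    rewrite (improper_RInt_gen _ (cexp (- (Ci * th (RtoC t))) * A)%C).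
    - rewrite cexp_opp. field. repeat split; try apply cexp_neq_0.
      + intros E; injection E; lra.
      + intros E; apply RtoC_inj in E; lra.
    - eapply improper_ext; [|apply (improper_scal (cexp (- (Ci * th (RtoC t)))) _ _ HA)].
      intros u. cbv beta zeta. rewrite Fth_Wth. unfold Wth, Eth. fold sden.
      change (RtoC (/ 2) + Ci * (RtoC t + (u, (- sigma)%R)))%C with (sarg (RtoC t + (u, (- sigma)%R))%C).
      change (RtoC 2 * csinh (RtoC PI * (u, (- sigma)%R) / RtoC 2))%C with (sden (u, (- sigma)%R)).
      unfold Cminus. rewrite cexp_plus. ring. }
  rewrite HU.
  change (Zfun th t) with (Wth th (RtoC t)).
  assert (H0 : (RtoC (2 * PI) * Ci)%C <> RtoC 0).
  { apply Cmult_neq_0. intros E; apply RtoC_inj in E; lra. intros E; injection E; lra. }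
  replace (Wth th (RtoC t)) with ((A - Cconj A) / (RtoC (2 * PI) * Ci))%C by (rewrite HZ; field; split;
    intros E; [injection E; lra|apply RtoC_inj in E; lra]).
  (* Both sides equal a2 / pi: dividing by 2 pi i turns the imaginary part of [A] into the real
     part. *)
  destruct A as [a1 a2]. apply injective_projections; simpl; field; lra.
Qed.
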